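(* Fix any field $\mathbb{K}$. For every finite simple graph $H$ the limit $c_H=\lim_{n\to\infty}\sqrt[n]{b_H(n)}$ exists. Moreover: (i) If $H$ is not an induced subgraph of the infinite complete multipartite graph $K_{5,5,\dots}$ (infinitely many parts, each of size $5$), then $c_H=4^{1/5}$. (ii) For every $i\in\{1,\dots,5\}$ there is a value $c'_i$ such that whenever $H=K_{i_1,\dots,i_m}$ is a complete multipartite graph with $5\ge i_1\ge\cdots\ge i_m\ge 1$ (for $m=1$ this is the edgeless graph $I_{i_1}$ on $i_1$ vertices), we have $c_H=c'_{i_1}$. Moreover $c'_5=3^{1/4}$, $c'_4=2^{1/3}$, $c'_3\in[8^{1/14},\Gamma_4]$, and $c'_2=c'_1=1$.
   Context: For a graph $G$, $\mathrm{cl}(G)$ denotes its clique complex (the simplicial complex whose faces are the vertex sets of cliques of $G$, including the empty face). For a finite simple graph $H$ and a field $\mathbb{K}$, $b_H(n)=\max_G \sum_{i\ge -1}\dim_{\mathbb{K}}\widetilde H_i(\mathrm{cl}(G);\mathbb{K})$, where $G$ ranges over all simple graphs on at most $n$ vertices containing no induced copy of $H$ (reduced homology; the empty graph contributes $1$, so $b_H(0)=1$). $\Gamma_4$ is the unique root in $[1,2]$ of $x^{8}-x^{3}-x^{2}-x-1=0$ ($\Gamma_4\approx 1.2434$). *)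

(* Defs.v *)
From HB Require Import structures.
From mathcomp Require Import all_boot all_order all_algebra.

Set Implicit Arguments.
Unset Strict Implicit.
Unset Printing Implicit Defensive.

Import GRing.Theory.

Definition graph (m : nat) := {ffun 'I_m * 'I_m -> bool}.

Definition simple_graph m (G : graph m) : bool :=
  [forall x, ~~ G (x, x)] && [forall x, forall y, G (x, y) == G (y, x)].

(* vertex sets of cliques of G = faces of the clique complex cl(G)
   (the empty set is a clique: the empty face) *)
Definition is_clique m (G : graph m) (s : {set 'I_m}) : bool :=
  [forall x in s, forall y in s, (x != y) ==> G (x, y)].

(* number of faces of cl(G) with d vertices, i.e. of dimension d-1 *)
Definition nfaces m (G : graph m) (d : nat) : nat :=
  #|[set s : {set 'I_m} | is_clique G s & #|s| == d]|.

(* simplicial boundary map of cl(G) from faces with d vertices to faces with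
   d-1 vertices (oriented by the order of 'I_m), as a matrix indexed by all
   vertex subsets; rows = source faces, columns = target faces. *)
Definition boundary_mx (K : fieldType) m (G : graph m) (d : nat)
  : 'M[K]_(#|{set 'I_m}|) :=
  \matrix_(i, j)
    (let s := enum_val (A := {: {set 'I_m}}) i in
     let t := enum_val (A := {: {set 'I_m}}) j in
     if is_clique G s && (#|s| == d) then
       (\sum_(v in s) (if t == s :\ v then (-1) ^+ #|[set u in s | (u < v)%N]|
                      else 0))%R
     else 0%R).

(* dim_K of reduced homology \tilde H_{d-1}(cl(G); K)
   = dim ker \partial_{d-1} - dim im \partial_d *)
Definition reduced_betti (K : fieldType) m (G : graph m) (d : nat) : nat :=
  nfaces G d - \rank (boundary_mx K G d) - \rank (boundary_mx K G d.+1).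

(* sum over i >= -1 of dim \tilde H_i (faces have at most m vertices) *)
Definition betti_sum (K : fieldType) m (G : graph m) : nat :=
  \sum_(0 <= d < m.+1) reduced_betti K G d.

Definition has_induced k (H : graph k) m (G : graph m) : bool :=
  [exists f : {ffun 'I_k -> 'I_m},
     injectiveb f && [forall x, forall y, H (x, y) == G (f x, f y)]].

(* b_H(n): max over simple graphs on at most n vertices (up to isomorphism,
   graphs on 'I_m, m <= n) with no induced copy of H *)
Definition bH (K : fieldType) k (H : graph k) (n : nat) : nat :=
  \max_(m < n.+1)
     \max_(G : graph m | simple_graph G && ~~ has_induced H G) betti_sum K G.

(* H is an induced subgraph of K_{5,5,...}: vertices nat * 'I_5, adjacent iff
   in different parts (different first coordinates) *)
Definition induced_in_K5inf k (H : graph k) : Prop :=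
  exists f : 'I_k -> nat * 'I_5,
    injective f /\ forall x y, H (x, y) = ((f x).1 != (f y).1).

Definition complete_multipartite k (H : graph k) (s : seq nat) : Prop :=
  exists p : 'I_k -> 'I_(size s),
    (forall j : 'I_(size s), #|[set x | p x == j]| = nth 0 s j) /\
    forall x y, H (x, y) = (p x != p y).

(* Main.v *)
(* Work in the complement graph, where faces are independent sets, and let b(A)
   be the total Betti number of the subgraph induced on A. The total
   differential D of the clique complex satisfies b = #faces - 2 rank D, so
   block-triangularity gives b(A) <= b(A - w) + b(A - N[w]), while b(A) = 0 as
   soon as the complement has an isolated vertex. Deleting the neighbours
   w_1, ..., w_d of a vertex v one after the other yields
   b(A) <= sum_j b(A - {w_1, ..., w_(j-1)} - N[w_j]), and branching on v of
   minimal degree bounds b by t^|A| with t^5 = 4 in general, t^4 = 3 if the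
   complement has no K_5, t^8 = t^3 + t^2 + t + 1 if it has no triangle. If it
   has no K_4 the bound t^3 = 2 requires ordering the w_j so that a later w_k is
   left with degree at most one in some branch, or with two neighbours not
   forming a triangle component.

   If G contains no K_{i,...,i} with j parts, branch on vertices of large degree
   in the complement, which costs a factor arbitrarily close to 1 per vertex.
   Once these degrees are bounded, boundedly many vertices meet all independent
   i-sets of G; hence the growth rate is the one for graphs without independent
   i-sets. The latter exists by supermultiplicativity (joins multiply Betti
   numbers), and lower bounds come from joins of edgeless graphs and of a
   14-vertex graph built from the Fano plane, whose reduced Euler characteristic
   is 8 in absolute value. *)
Require Import Defs.
From mathcomp Require Import all_boot all_order all_algebra zify.

Set Implicit Arguments.
Unset Strict Implicit.
Unset Printing Implicit Defensive.

Import GRing.Theory.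

(** * Differentials and their homology *)

Section Differentials.
Variable K : fieldType.
Local Open Scope ring_scope.

(** The grading is discarded at once: the sum over all dimensions becomes #faces - 2 rank D for one
    square matrix over all vertex subsets, so every homological step is a rank inequality. Put u =
    1/t. A branch that loses k vertices weighs u^k, and a bound b <= t^|A| is certified by branch
    weights of sum at most 1. The constants come from r isolated points, whose total Betti number is
    r - 1: among the roots (r - 1)^(1/r) the largest is 4^(1/5), and r = 4, 3 give 3^(1/4), 2^(1/3),
    the best once five, respectively four, independent vertices are forbidden. Plain counting at
    minimum degree d gives d u^(d+1). For t^5 = 4 this is at most 1 for all d <= 4, and larger
    degrees are cheap. For t^4 = 3 only d = 4 fails. For t^3 = 2 the degrees 3, 4 and 5 fail (about
    1.19, 1.26, 1.25), while u + u^7 < 1 settles degree 6. This is the obstacle behind the long case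
    analysis: the graph on a neighbourhood is triangle-free, its few shapes are listed by
    computation, and the hardest ones (perfect matching, pentagon) end in a forced K_4. *)

Definition fun_mx (S T : finType) (f : S -> T -> K) : 'M[K]_(#|S|, #|T|) :=
  \matrix_(i, j) f (enum_val i) (enum_val j).

Lemma eq_fun_mx (S T : finType) (f g : S -> T -> K) :
  f =2 g -> fun_mx f = fun_mx g.
Proof. by move=> fg; apply/matrixP=> i j; rewrite !mxE fg. Qed.

Lemma fun_mxM (S T U : finType) (f : S -> T -> K) (g : T -> U -> K) :
  fun_mx f *m fun_mx g = fun_mx (fun s u => \sum_t f s t * g t u).
Proof.
apply/matrixP=> i j; rewrite !mxE.
rewrite [RHS](reindex (@enum_val T T)) /=; last exact/onW_bij/enum_val_bij.
by apply: eq_bigr => k _; rewrite !mxE.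
Qed.

Lemma fun_mxD (S T : finType) (f g : S -> T -> K) :
  fun_mx f + fun_mx g = fun_mx (fun s t => f s t + g s t).
Proof. by apply/matrixP=> i j; rewrite !mxE. Qed.

Lemma fun_mx0 (S T : finType) : fun_mx (fun (_ : S) (_ : T) => 0) = 0.
Proof. by apply/matrixP=> i j; rewrite !mxE. Qed.

Lemma fun_mx1 (S : finType) :
  fun_mx (fun s t : S => (s == t)%:R) = 1%:M.
Proof. by apply/matrixP=> i j; rewrite !mxE (inj_eq enum_val_inj). Qed.

Lemma fun_mxN (S T : finType) (f : S -> T -> K) :
  - fun_mx f = fun_mx (fun s t => - f s t).
Proof. by apply/matrixP=> i j; rewrite !mxE. Qed.

(** Diagonal projection onto the coordinates in [F]. Identities such as [P *m X = X] and
    [X *m Q = X] record on which rows and columns a matrix is supported. *)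
Definition pred_mx (T : finType) (F : pred T) :=
  fun_mx (fun s t : T => (F s && (s == t))%:R).

Lemma sum_pred_l (T : finType) (F : pred T) (s : T) (g : T -> K) :
  \sum_t (F s && (s == t))%:R * g t = (F s)%:R * g s.
Proof.
rewrite (bigD1 s) //= eqxx andbT big1 ?addr0 // => t /negbTE ts.
by rewrite eq_sym ts andbF mul0r.
Qed.

Lemma sum_pred_r (T : finType) (F : pred T) (s : T) (g : T -> K) :
  \sum_t g t * (F t && (t == s))%:R = g s * (F s)%:R.
Proof.
rewrite (bigD1 s) //= eqxx andbT big1 ?addr0 // => t /negbTE ts.
by rewrite ts andbF mulr0.
Qed.

Lemma rank_pred_mx (T : finType) (F : pred T) : \rank (pred_mx F) = #|F|.
Proof.
pose E := fun_mx (fun (s : {x | F x}) (t : T) => (val s == t)%:R).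
pose E' := fun_mx (fun (t : T) (s : {x | F x}) => (val s == t)%:R).
have EE : E *m E' = 1%:M.
  rewrite fun_mxM -fun_mx1; apply: eq_fun_mx => s t.
  rewrite (bigD1 (val s)) //= eqxx mul1r big1 ?addr0 ?[val t == _]eq_sym//.
  by move=> u /negbTE; rewrite eq_sym => ->; rewrite mul0r.
have PE : pred_mx F = E' *m E.
  rewrite fun_mxM; apply: eq_fun_mx => s t.
  case: (boolP (F s)) => Fs.
    rewrite (bigD1 (Sub s Fs)) //= eqxx mul1r big1 ?addr0 // => u.
    by rewrite -val_eqE /= => /negbTE->; rewrite mul0r.
  rewrite big1 // => u _; case: eqP => [us|_]; last by rewrite mul0r.
  by rewrite -us (valP u) in Fs.
have rE : \rank E = #|F|.
  by apply/eqP; rewrite -[#|F|]card_sig; apply/row_freeP; exists E'.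
apply/eqP; rewrite eqn_leq -{2}rE PE -{1}rE mxrankM_maxr /=.
by rewrite -{1}[E]mul1mx -EE -mulmxA mxrankM_maxr.
Qed.

(** Matrices act on row vectors from the right, so the row space of [D'] lies in the kernel of [D]
    within the row space of [P], a space of dimension rank P - rank D. *)
Lemma rank_exact_le (n : nat) (P D D' : 'M[K]_n) :
  P *m D = D -> D' *m P = D' -> D' *m D = 0 ->
  (\rank D + \rank D' <= \rank P)%N.
Proof.
move=> PD DP DD; rewrite -(mxrank_mul_ker P D) PD leq_add2l.
apply: mxrankS; rewrite sub_capmx; apply/andP; split.
  by rewrite -DP submxMl.
exact/sub_kermxP.
Qed.

(** [P] recovers [X] from [X + Y], so both row spaces lie in that of the sum; [Q] fixes one and
    kills the other, so they meet in 0. *)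
Lemma rank_add_split (n : nat) (P Q X Y : 'M[K]_n) :
  P *m X = X -> P *m Y = 0 -> X *m Q = X -> Y *m Q = 0 ->
  \rank (X + Y)%R = (\rank X + \rank Y)%N.
Proof.
move=> PX PY XQ YQ; apply/eqP; rewrite eqn_leq mxrank_add /=.
rewrite -mxrank_disjoint_sum.
  apply: mxrankS; rewrite addsmx_sub; apply/andP; split.
    by rewrite -{1}PX -[P *m X]addr0 -PY -mulmxDr submxMl.
  have {1}-> : Y = (1%:M - P) *m (X + Y).
    by rewrite mulmxBl mul1mx mulmxDr PX PY addr0 addrC addKr.
  exact: submxMl.
apply/eqP; rewrite -submx0; apply/rV_subP => v.
rewrite sub_capmx => /andP[/submxP[a va] /submxP[c vc]].
have : v *m Q = v by rewrite va -mulmxA XQ.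
by rewrite {1}vc -mulmxA YQ mulmx0 => <-; rewrite sub0mx.
Qed.

(* The rows of [Z] are cycles and the columns of [C] cocycles forming dual bases
   of the homology of [D] on the range of [P]. *)
Lemma homology_dual_bases (n : nat) (P D : 'M[K]_n) :
  P *m D = D -> D *m P = D -> D *m D = 0 ->
  exists (Z : 'M[K]_(\rank P - 2 * \rank D, n)) (C : 'M_(n, _)),
    [/\ (Z <= P)%MS, Z *m D = 0, D *m C = 0 & Z *m C = 1%:M].
Proof.
(* [W] complements the boundaries inside the cycles. *)
move=> PD DP DD; pose W := ((P :&: kermx D) :\: D)%MS.
have DPk : (D <= P :&: kermx D)%MS.
  by rewrite sub_capmx -{1}DP submxMl; apply/sub_kermxP.
have rW : \rank W = (\rank P - 2 * \rank D)%N.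
  have := mxrank_cap_compl (P :&: kermx D)%MS D.
  rewrite (_ : \rank (_ :&: D) = \rank D); last first.
    by have /eqmxP/eqmx_rank := capmx_idPr DPk.
  by have := mxrank_mul_ker P D; rewrite PD -/W; lia.
(* The cocycles are the projection onto [W] along the boundaries, read in a basis of [W]; hence they
   vanish on [D]. *)
rewrite -rW; exists (row_base W), (proj_mx W D *m pinvmx (row_base W)).
have dW : (W :&: D = 0)%MS by rewrite /W capmx_diff.
have sW : (row_base W <= P :&: kermx D)%MS by rewrite eq_row_base diffmxSl.
split.
- exact: submx_trans sW (capmxSl _ _).
- by apply/sub_kermxP; apply: submx_trans sW (capmxSr _ _).
- by rewrite mulmxA proj_mx_0 ?mul0mx.
- by rewrite mulmxA proj_mx_id ?eq_row_base // mulmxVp ?row_base_free.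
Qed.

(** Pairing with [C] is faithful on [Z] and kills boundaries, so the rows of [Z] are independent
    modulo the row space of [D]. *)
Lemma dual_bases_le_homology (n k : nat) (P D : 'M[K]_n)
    (Z : 'M[K]_(k, n)) (C : 'M_(n, k)) :
  P *m D = D -> D *m P = D -> D *m D = 0 ->
  (Z <= P)%MS -> Z *m D = 0 -> D *m C = 0 -> Z *m C = 1%:M ->
  (k <= \rank P - 2 * \rank D)%N.
Proof.
move=> PD DP DD ZP ZD DC ZC.
have rZ : \rank Z = k by apply/eqP/row_freeP; exists C.
have dZ : (Z :&: D = 0)%MS.
  apply/eqP; rewrite -submx0; apply/rV_subP => v.
  rewrite sub_capmx => /andP[/submxP[a va] /submxP[c vc]].
  have : v *m C = 0 by rewrite vc -mulmxA DC mulmx0.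
  by rewrite va -mulmxA ZC mulmx1 => ->; rewrite mul0mx sub0mx.
have : (\rank (Z + D)%MS <= \rank (P :&: kermx D)%MS)%N.
  apply: mxrankS; rewrite addsmx_sub !sub_capmx ZP /=.
  have -> : (D <= P)%MS by rewrite -DP submxMl.
  by apply/andP; split; apply/sub_kermxP.
rewrite mxrank_disjoint_sum // rZ.
by have := mxrank_mul_ker P D; rewrite PD; lia.
Qed.

End Differentials.

(** * Simplicial boundaries of clique complexes *)

Lemma card_predU (T : finType) (F F1 F2 : pred T) :
  (forall x, F x = F1 x (+) F2 x) -> (forall x, F1 x -> ~~ F2 x) ->
  #|F| = (#|F1| + #|F2|)%N.
Proof.
move=> FE F12; rewrite -(cardID F1 F); congr (_ + _)%N; apply: eq_card => x;
  rewrite /in_mem /= /in_mem /= FE; move: (F12 x);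
  by case: (F1 x); case: (F2 x) => //= /(_ isT).
Qed.

Section Boundary.
Variables (K : fieldType) (m : nat).
Local Open Scope ring_scope.
Implicit Types (s t A : {set 'I_m}) (F : pred {set 'I_m}).

Definition face_sign s (v : 'I_m) : K := (-1) ^+ #|[set u in s | (u < v)%N]|.

(** Only the source face is filtered; targets lie in [F] as soon as [F] is closed under deleting a
    vertex. Besides complexes, [F] is later the set of faces of one size or of one parity. *)
Definition bd F s t : K :=
  if F s then \sum_(v in s) (if t == s :\ v then face_sign s v else 0) else 0.

Definition bd_mx F := fun_mx (bd F).

Lemma face_sign_sqr s v : face_sign s v * face_sign s v = 1.
Proof. by rewrite -expr2 sqrr_sign. Qed.

Lemma face_signD1_lt s (u v : 'I_m) :
  u \in s -> (u < v)%N -> face_sign (s :\ u) v = - face_sign s v.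
Proof.
move=> us uv; rewrite /face_sign [in RHS](cardsD1 u) inE us uv exprS mulN1r opprK.
by congr (_ ^+ _); apply: eq_card => x; rewrite !inE andbA.
Qed.

Lemma face_signD1_ge s (u v : 'I_m) :
  (v <= u)%N -> face_sign (s :\ u) v = face_sign s v.
Proof.
move=> vu; rewrite /face_sign; congr (_ ^+ _); apply: eq_card => x; rewrite !inE.
by case: (eqVneq x u) => [->|_] //=; rewrite ltnNge vu andbF.
Qed.

(** Deleting the smaller vertex shifts the position of the larger one by one, while deleting the
    larger leaves the smaller in place. *)
Lemma face_signC s (u v : 'I_m) : u \in s -> v \in s -> u != v ->
  face_sign s u * face_sign (s :\ u) v = - (face_sign s v * face_sign (s :\ v) u).
Proof.
move=> us vs; rewrite neq_ltn => /orP[uv|uv].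
  by rewrite face_signD1_lt // face_signD1_ge ?(ltnW uv) // mulrN mulrC.
by rewrite face_signD1_ge ?(ltnW uv) // face_signD1_lt // mulrN opprK mulrC.
Qed.

Lemma sum_bd_l F s (g : {set 'I_m} -> K) :
  \sum_t bd F s t * g t =
  if F s then \sum_(v in s) face_sign s v * g (s :\ v) else 0.
Proof.
rewrite /bd; case: (F s); last by rewrite big1 // => t _; rewrite mul0r.
under eq_bigr do rewrite mulr_suml.
rewrite exchange_big /=; apply: eq_bigr => v vs.
rewrite (bigD1 (s :\ v)) //= eqxx big1 ?addr0 // => t /negbTE->.
by rewrite mul0r.
Qed.

Lemma bd_mx_sq0 F F' : (forall s v, F s -> v \in s -> F' (s :\ v)) ->
  bd_mx F *m bd_mx F' = 0.
Proof.
move=> FF'; rewrite fun_mxM -fun_mx0; apply: eq_fun_mx => s t.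
rewrite sum_bd_l; case: ifP => // Fs.
pose a v w := face_sign s v * (if t == s :\ v :\ w then face_sign (s :\ v) w else 0).
have aC v w : v \in s -> w \in s -> v != w -> a v w = - a w v.
  move=> vs ws vw; rewrite /a.
  have -> : s :\ w :\ v = s :\ v :\ w by rewrite !setDDl setUC.
  by case: ifP => _; rewrite ?mulr0 ?oppr0 // face_signC.
transitivity (\sum_(v in s) \sum_(w in s | w != v) a v w).
  apply: eq_bigr => v vs; rewrite /bd FF' // mulr_sumr.
  by apply: eq_bigl => w; rewrite !inE andbC.
(* Antisymmetry of the whole sum would only give 2S = 0, which is empty in characteristic 2; the sum
   is cut into w < v and v < w and cancelled termwise. *)
have -> : \sum_(v in s) \sum_(w in s | w != v) a v w =
   \sum_(v in s) \sum_(w in s | (w < v)%N) a v w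
   + \sum_(v in s) \sum_(w in s | (v < w)%N) a v w.
  rewrite -big_split /=; apply: eq_bigr => v vs.
  rewrite (bigID (fun w : 'I_m => (w < v)%N)) /=; congr (_ + _);
    apply: eq_bigl => w; rewrite -!andbA; congr (_ && _).
    by rewrite neq_ltn; case: ltngtP.
  by rewrite neq_ltn; case: ltngtP.
rewrite [X in _ + X](exchange_big_dep (mem s)) /=; last by move=> v w _ /andP[].
rewrite -big_split big1 // => v vs /=.
rewrite [X in _ + X](eq_bigl (fun w => (w \in s) && (w < v)%N)); last first.
  by move=> w /=; rewrite vs.
rewrite -big_split big1 //= => w /andP[ws wv].
by rewrite aC ?addNr // neq_ltn wv orbT.
Qed.

Lemma pred_bd_mx F : pred_mx K F *m bd_mx F = bd_mx F.
Proof.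
rewrite fun_mxM; apply: eq_fun_mx => s t; rewrite sum_pred_l /bd.
by case: ifP; rewrite ?mul1r ?mul0r.
Qed.

Lemma pred_bd_mx0 F F' : (forall s, F s -> ~~ F' s) -> pred_mx K F *m bd_mx F' = 0.
Proof.
move=> FF; rewrite fun_mxM -fun_mx0; apply: eq_fun_mx => s t.
rewrite sum_pred_l /bd; case: (boolP (F s)) => [/FF/negbTE->|_].
  by rewrite mulr0.
by rewrite mul0r.
Qed.

Lemma bd_pred_mx F F' : (forall s v, F s -> v \in s -> F' (s :\ v)) ->
  bd_mx F *m pred_mx K F' = bd_mx F.
Proof.
move=> FF; rewrite fun_mxM; apply: eq_fun_mx => s t; rewrite sum_pred_r /bd.
case: ifP => Fs; last by rewrite mul0r.
rewrite mulr_suml; apply: eq_bigr => v vs; case: eqP => [->|_].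
  by rewrite FF // mulr1.
by rewrite mul0r.
Qed.

Lemma bd_pred_mx0 F F' : (forall s v, F s -> v \in s -> ~~ F' (s :\ v)) ->
  bd_mx F *m pred_mx K F' = 0.
Proof.
move=> FF; rewrite fun_mxM -fun_mx0; apply: eq_fun_mx => s t.
rewrite sum_pred_r /bd; case: ifP => Fs; last by rewrite mul0r.
rewrite mulr_suml big1 // => v vs; case: eqP => [->|_]; last by rewrite mul0r.
by rewrite (negbTE (FF _ _ Fs vs)) mulr0.
Qed.

Lemma bd_mxU F F' : (forall s, F s -> ~~ F' s) ->
  bd_mx (predU F F') = bd_mx F + bd_mx F'.
Proof.
move=> FF; rewrite fun_mxD; apply: eq_fun_mx => s t; rewrite /bd /=.
case: (boolP (F s)) => /= [/FF/negbTE->|_]; first by rewrite addr0.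
by rewrite add0r.
Qed.

Lemma eq_bd_mx F F' : F =1 F' -> bd_mx F = bd_mx F'.
Proof. by move=> FF; apply: eq_fun_mx => s t; rewrite /bd FF. Qed.

End Boundary.

(** * Total Betti number of an induced clique complex *)

Section CliqueBetti.
Variables (K : fieldType) (m : nat) (G : graph m).
Hypothesis sG : simple_graph G.
Local Open Scope ring_scope.
Implicit Types (s t A : {set 'I_m}).

Lemma graphC x y : G (x, y) = G (y, x).
Proof. by case/andP: sG => _ /forallP/(_ x)/forallP/(_ y)/eqP. Qed.

Lemma graphxx x : G (x, x) = false.
Proof. by case/andP: sG => /forallP/(_ x)/negbTE. Qed.

Lemma cliqueP s :
  reflect {in s &, forall x y, x != y -> G (x, y)} (is_clique G s).
Proof.
apply: (iffP forall_inP) => [H x y xs ys xy|H x xs].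
  by move/forall_inP: (H x xs) => /(_ y ys)/implyP; apply.
by apply/forall_inP => y ys; apply/implyP; apply: H.
Qed.

Lemma clique_sub s t : s \subset t -> is_clique G t -> is_clique G s.
Proof.
by move=> /subsetP st /cliqueP H; apply/cliqueP => x y xs ys; apply: H; apply: st.
Qed.

Definition face A : pred {set 'I_m} := fun s => is_clique G s && (s \subset A).

Lemma faceD1 A s v : face A s -> face A (s :\ v).
Proof.
case/andP=> cs sA; rewrite /face (clique_sub (subD1set s v) cs).
exact: subset_trans (subD1set s v) sA.
Qed.

Definition betti A := (#|face A| - 2 * \rank (bd_mx K (face A)))%N.

(** Makes the truncated subtraction in [betti] exact. *)
Lemma rank_bd_face A : (2 * \rank (bd_mx K (face A)) <= #|face A|)%N.
Proof.
rewrite -(rank_pred_mx K (face A)) mul2n -addnn; apply: rank_exact_le.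
- exact: pred_bd_mx.
- by apply: bd_pred_mx => s v Fs _; apply: faceD1.
- by apply: bd_mx_sq0 => s v Fs _; apply: faceD1.
Qed.

(** The link of [w] in a clique complex is the clique complex on the neighbours of [w]. *)
Lemma face_cone A w s : w \in A -> w \notin s ->
  face A (w |: s) = face [set x in A | G (w, x)] s.
Proof.
move=> wA ws; apply/andP/andP => -[/cliqueP cs /subsetP sA]; split.
- by apply: clique_sub (subsetUr [set w] s) _; apply/cliqueP.
- apply/subsetP => x xs; rewrite inE sA ?inE ?xs ?orbT //=.
  apply: cs; rewrite ?inE ?xs ?orbT ?eqxx //.
  by apply: contraNneq ws => ->.
- apply/cliqueP => x y; rewrite !inE => /orP[/eqP->|xs] /orP[/eqP->|ys];
    rewrite ?eqxx // => xy.
  + by move: (sA _ ys); rewrite inE => /andP[].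
  + by move: (sA _ xs); rewrite inE graphC => /andP[].
  + exact: cs.
- apply/subsetP => x; rewrite in_setU1 => /orP[/eqP->//|/sA].
  by rewrite inE => /andP[].
Qed.

Lemma betti_branch A w : w \in A ->
  (betti A <= betti (A :\ w) + betti [set x in A | G (w, x)])%N.
Proof.
move=> wA; set B := [set x in A | _].
have wB : w \notin B by rewrite inE graphxx andbF.
have facew s : w \notin s -> face A (w |: s) = face B s by apply: face_cone.
have faceN s : w \notin s -> face A s = face (A :\ w) s.
  by move=> ws; rewrite /face subsetD1 ws andbT.
have faceNw s : w \in s -> face (A :\ w) s = false.
  by move=> ws; rewrite /face subsetD1 ws !andbF.
have faceBw s : w \in s -> face B s = false.
  by move=> ws; apply/negbTE; rewrite /face negb_and orbC;
     apply/orP; left; apply: contraNN wB => /subsetP; apply.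
have cardA : #|face A| = (#|face (A :\ w)| + #|face B|)%N.
  rewrite (@card_predU _ _ (face (A :\ w)) (fun s => (w \in s) && face A s)).
  - congr addn; rewrite -[RHS](card_in_imset (f := fun s => w |: s)).
      apply: eq_card => s; rewrite [LHS]/in_mem /=.
      apply/andP/imsetP => [[ws Fs]|[t Ft ->]].
        exists (s :\ w); last by rewrite setD1K.
        by move: Fs; rewrite -{1}(setD1K ws) facew // !inE eqxx.
      rewrite setU11; split=> //; rewrite facew //.
      by apply: contraL Ft => /faceBw; rewrite /in_mem /= => ->.
    move=> s t Fs Ft /= st; have ws : w \notin s.
      by apply: contraL Fs => /faceBw; rewrite /in_mem /= => ->.
    have wt : w \notin t by apply: contraL Ft => /faceBw; rewrite /in_mem /= => ->.
    by rewrite -(setU1K ws) st setU1K.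
  - move=> s; case: (boolP (w \in s)) => ws /=; first by rewrite faceNw.
    by rewrite faceN // addbF.
  - by move=> s Fs; apply/negP => /andP[ws]; rewrite faceNw in Fs.
(* [J] adds [w] to a face of the link; [Q] keeps the faces containing [w] and strips [w] off. With D
   the boundary on [A], the product J D Q is minus the boundary of the link, while the boundary on
   [A :\ w] lies in the row space of D and in the kernel of [Q]. Rank-nullity for D and [Q] then
   adds the two ranks. *)
pose J := fun_mx (fun s t => if face B s && (t == w |: s)
                             then face_sign K t w else 0).
pose Q := fun_mx (fun s t : {set 'I_m} => if (w \in s) && (t == s :\ w)
                             then face_sign K s w else 0).
have DQ : bd_mx K (face (A :\ w)) *m Q = 0.
  rewrite fun_mxM -fun_mx0; apply: eq_fun_mx => s t; rewrite sum_bd_l.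
  case: ifP => // Fs; rewrite big1 // => v vs; case: ifP => [|_]; last by rewrite mulr0.
  case/andP; rewrite !inE => /andP[_ ws]; by rewrite faceNw in Fs.
have DD : (bd_mx K (face (A :\ w)) <= bd_mx K (face A))%MS.
  have -> : bd_mx K (face (A :\ w)) =
      pred_mx K (face (A :\ w)) *m bd_mx K (face A).
    rewrite fun_mxM; apply: eq_fun_mx => s t; rewrite sum_pred_l /bd.
    case: (boolP (w \in s)) => ws; first by rewrite faceNw // mul0r.
    by rewrite faceN //; case: ifP; rewrite ?mul1r ?mul0r.
  exact: submxMl.
have JDQ : J *m (bd_mx K (face A) *m Q) = - bd_mx K (face B).
  rewrite !fun_mxM fun_mxN; apply: eq_fun_mx => s t.
  rewrite (bigD1 (w |: s)) //= eqxx andbT [X in _ + X]big1 ?addr0; last first.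
    by move=> u /negbTE->; rewrite andbF mul0r.
  rewrite [in RHS]/bd; case: ifP => Fs; last by rewrite mul0r oppr0.
  have ws : w \notin s by apply: contraL Fs => /faceBw->.
  rewrite sum_bd_l facew // Fs big_setU1 //= setU1K // (negbTE ws) /= mulr0 add0r.
  rewrite mulr_sumr -sumrN; apply: eq_bigr => v vs.
  have wv : w != v by apply: contraNneq ws => ->.
  rewrite !inE wv eqxx /=.
  have -> : (w |: s) :\ v :\ w = s :\ v.
    apply/setP => x; rewrite !inE; case: (eqVneq x w) => //= ->.
    by rewrite (negbTE ws) andbF.
  case: ifP => _; last by rewrite !mulr0 oppr0.
  rewrite (@face_signC _ _ _ v w) ?inE ?vs ?eqxx ?orbT // 1?eq_sym //.
  by rewrite setU1K // mulrN mulrA face_sign_sqr mul1r.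
have rle : (\rank (bd_mx K (face (A :\ w))) + \rank (bd_mx K (face B))
            <= \rank (bd_mx K (face A)))%N.
  rewrite -(mxrank_mul_ker (bd_mx K (face A)) Q) addnC leq_add //.
    by rewrite -mxrank_opp -JDQ mxrankM_maxr.
  by apply: mxrankS; rewrite sub_capmx DD; apply/sub_kermxP.
rewrite /betti; have := rank_bd_face A; have := rank_bd_face B.
have := rank_bd_face (A :\ w); lia.
Qed.

(** Adding [v] is a contracting homotopy [h]: D h + h D is the projection onto the faces, so the
    number of faces is at most 2 rank D. *)
Lemma betti_cone A v : v \in A -> {in A, forall x, x != v -> G (v, x)} ->
  betti A = 0%N.
Proof.
move=> vA vG; apply/eqP; rewrite subn_eq0.
have facev s : face A s -> face A (v |: s).
  case/andP => /cliqueP cs /subsetP sA; apply/andP; split; last first.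
    by apply/subsetP => x; rewrite in_setU1 => /orP[/eqP->|/sA].
  apply/cliqueP => x y; rewrite !inE => /orP[/eqP->|xs] /orP[/eqP->|ys];
      rewrite ?eqxx // => xy; last exact: cs.
    by apply: vG; [exact: sA | rewrite eq_sym].
  by rewrite graphC; apply: vG => //; apply: sA.
pose h := fun_mx (fun s t : {set 'I_m} =>
  if [&& face A s, v \notin s & t == v |: s] then face_sign K t v else 0).
suff E : bd_mx K (face A) *m h + h *m bd_mx K (face A) = pred_mx K (face A).
  rewrite -(rank_pred_mx K (face A)) -E; apply: leq_trans (mxrank_add _ _) _.
  by rewrite mul2n -addnn leq_add // ?mxrankM_maxl ?mxrankM_maxr.
rewrite !fun_mxM fun_mxD; apply: eq_fun_mx => s t; rewrite sum_bd_l.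
case: (boolP (face A s)) => Fs; last first.
  by rewrite add0r big1 // => u _; rewrite mul0r.
case: (boolP (v \in s)) => vs /=.
  rewrite [X in _ + X]big1 ?addr0; last by move=> u _; rewrite mul0r.
  rewrite (bigD1 v) //= big1 ?addr0; last first.
    by move=> u /andP[us uv]; rewrite !inE vs eq_sym uv andbF mulr0.
  rewrite faceD1 // !inE eqxx /= setD1K // eq_sym.
  by case: eqP => [->|_]; rewrite ?mulr0 // face_sign_sqr.
rewrite [X in _ + X](bigD1 (v |: s)) //= eqxx.
rewrite [X in _ + (_ + X)]big1 ?addr0; last by move=> u /negbTE->; rewrite mul0r.
rewrite /bd facev // big_setU1 //= setU1K // mulrDr addrCA.
rewrite (_ : (if t == s then _ else _) = (s == t)%:R * face_sign K (v |: s) v).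
  rewrite mulrCA face_sign_sqr mulr1 mulr_sumr -big_split big1 /= ?addr0 //.
  move=> u us; have vu : v != u by apply: contraNneq vs => ->.
  rewrite faceD1 // !inE (negbTE vs) andbF /=.
  have -> : v |: s :\ u = (v |: s) :\ u.
    by apply/setP => x; rewrite !inE; case: eqP => // ->; rewrite vu.
  case: ifP => [/eqP->|_]; last by rewrite !mulr0 addr0.
  set X := face_sign K (_ :\ u) v.
  have -> : X = face_sign K (v |: s) u * (face_sign K (v |: s) u * X).
    by rewrite mulrA face_sign_sqr mul1r.
  rewrite face_signC ?inE ?us ?eqxx ?orbT // 1?eq_sym // setU1K //.
  rewrite !mulrN [face_sign K (v |: s) v * face_sign K s u]mulrC.
  rewrite (mulrCA (face_sign K (v |: s) u)) (mulrA (face_sign K s u)) face_sign_sqr mul1r.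
  by rewrite [face_sign K (v |: s) u * _]mulrC addNr.
by rewrite eq_sym; case: ifP => _; rewrite ?mul1r ?mul0r.
Qed.

Lemma betti_set0 : betti set0 = 1%N.
Proof.
rewrite /betti.
have -> : #|face set0| = 1%N.
  rewrite (eq_card1 (x := set0)) // => s; rewrite unfold_in inE /face subset0.
  by case: eqP => [->|_]; rewrite ?andbF // andbT; apply/cliqueP => x y; rewrite inE.
suff -> : bd_mx K (face set0) = 0 by rewrite mxrank0.
rewrite -fun_mx0; apply: eq_fun_mx => s t; rewrite /bd; case: ifP => //.
by rewrite /face subset0 => /andP[_ /eqP->]; rewrite big_set0.
Qed.

End CliqueBetti.

(** * From the graded homology of the statement to the total differential *)

Section BettiSum.
Variables (K : fieldType) (m : nat) (G : graph m).
Local Open Scope ring_scope.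

Let dface d : pred {set 'I_m} := fun s => is_clique G s && (#|s| == d).

Lemma boundary_mxE d : boundary_mx K G d = bd_mx K (dface d).
Proof. by apply/matrixP => i j; rewrite !mxE. Qed.

Lemma nfacesE d : nfaces G d = #|dface d|.
Proof. by rewrite /nfaces cardsE. Qed.

Lemma dfaceD1 d s v : dface d.+1 s -> v \in s -> dface d (s :\ v).
Proof.
case/andP => cs; rewrite (cardsD1 v) => + vs; rewrite vs eqSS /dface => ->.
by rewrite (clique_sub (subD1set s v) cs).
Qed.

Lemma rank_boundary_le d :
  (\rank (boundary_mx K G d) + \rank (boundary_mx K G d.+1) <= nfaces G d)%N.
Proof.
rewrite !boundary_mxE nfacesE -(rank_pred_mx K (dface d)).
apply: rank_exact_le.
- exact: pred_bd_mx.
- by apply: bd_pred_mx => s v; apply: dfaceD1.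
- by apply: bd_mx_sq0 => s v; apply: dfaceD1.
Qed.

Let lface k : pred {set 'I_m} := fun s => is_clique G s && (#|s| < k)%N.

Lemma lfaceS k : lface k.+1 =1 predU (lface k) (dface k).
Proof. by move=> s; rewrite /= /lface /dface -andb_orr ltnS leq_eqVlt orbC. Qed.

Lemma lface_dface k s : lface k s -> ~~ dface k s.
Proof.
by case/andP => _ sk; apply/negP => /andP[_ /eqP sk']; rewrite sk' ltnn in sk.
Qed.

Lemma rank_lface k :
  \rank (bd_mx K (lface k)) = (\sum_(0 <= d < k) \rank (boundary_mx K G d))%N.
Proof.
elim: k => [|k IH].
  rewrite big_nil -[RHS](mxrank0 K #|{set 'I_m}| #|{set 'I_m}|) -fun_mx0.
  by congr mxrank; apply: eq_fun_mx => s t; rewrite /bd /lface ltn0 andbF.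
rewrite big_nat_recr //= -IH boundary_mxE (eq_bd_mx K (lfaceS k)).
rewrite bd_mxU; last exact: lface_dface.
(* The old rows reach only sets of fewer than k - 1 vertices, the new block only sets of exactly k -
   1; this separates the columns. *)
apply: (@rank_add_split _ _ (pred_mx K (lface k))
  (pred_mx K (fun s : {set 'I_m} => (#|s|.+1 < k)%N))).
- exact: pred_bd_mx.
- exact/pred_bd_mx0/lface_dface.
- by apply: bd_pred_mx => s v /andP[_]; rewrite (cardsD1 v) => + vs; rewrite vs.
- apply: bd_pred_mx0 => s v /andP[_]; rewrite (cardsD1 v) => + vs; rewrite vs.
  by move=> /eqP<-; rewrite add1n ltnn.
Qed.

Lemma card_lface k : #|lface k| = (\sum_(0 <= d < k) nfaces G d)%N.
Proof.
elim: k => [|k IH].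
  by rewrite big_nil eq_card0 // => s; rewrite /in_mem /= /lface ltn0 andbF.
rewrite big_nat_recr //= -IH nfacesE (@card_predU _ _ (lface k) (dface k)) //.
  move=> s; rewrite lfaceS /=; have := @lface_dface k s.
  by case: (lface k s); case: (dface k s) => //= /(_ isT).
exact: lface_dface.
Qed.

Lemma lface_setT : lface m.+1 =1 face G setT.
Proof.
move=> s; rewrite /lface /face subsetT; congr (_ && _).
by rewrite ltnS -[X in (_ <= X)%N]card_ord max_card.
Qed.

Lemma betti_sumE : betti_sum K G = betti K G setT.
Proof.
rewrite /betti -(eq_bd_mx K lface_setT) -(eq_card lface_setT).
rewrite rank_lface card_lface /betti_sum.
set r := fun d => \rank (boundary_mx K G d).
have r0 : r 0%N = 0%N.
  apply/eqP; rewrite mxrank_eq0 boundary_mxE -fun_mx0; apply/eqP.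
  apply: eq_fun_mx => s t; rewrite /bd; case: ifP => // /andP[_].
  by rewrite cards_eq0 => /eqP->; rewrite big_set0.
have rm : r m.+1 = 0%N.
  apply/eqP; rewrite mxrank_eq0 boundary_mxE -fun_mx0; apply/eqP.
  apply: eq_fun_mx => s t; rewrite /bd; case: ifP => // /andP[_ /eqP sm].
  by have := max_card (mem s); rewrite sm card_ord ltnn.
(* Written additively to avoid truncated subtraction. Each rank is subtracted in two consecutive
   degrees; the leftover [r k] of the partial sum vanishes at [k = m.+1]. *)
have E k : (\sum_(0 <= d < k) reduced_betti K G d + \sum_(0 <= d < k) r d
   + \sum_(0 <= d < k) r d + r k = \sum_(0 <= d < k) nfaces G d)%N.
  elim: k => [|k IH]; first by rewrite !big_nil r0.
  rewrite !big_nat_recr //= -IH /reduced_betti.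
  by have := rank_boundary_le k; rewrite -/(r k) -/(r k.+1); lia.
have := E m.+1; rewrite rm -[X in (2 * X)%N]/(\sum_(0 <= d < m.+1) r d)%N; lia.
Qed.

End BettiSum.

(** * Parity bound for the total Betti number *)

Section Euler.
Variables (K : fieldType) (m : nat) (G : graph m).
Local Open Scope ring_scope.

(** The total boundary is the sum of its two parity blocks, and their composite through parity [p]
    vanishes, so the two ranks add up to at most the number of faces of parity [p]. Used for both
    parities, this bounds the Euler characteristic over any field. *)
Lemma face_card_parity_le (A : {set 'I_m}) (p : bool) :
  (#|face G A| <= betti K G A
     + 2 * #|fun s : {set 'I_m} => face G A s && (odd #|s| == p)|)%N.
Proof.
pose F q : pred {set 'I_m} := fun s => face G A s && (odd #|s| == q).
have FD (s : {set 'I_m}) v : v \in s -> F p s -> F (~~ p) (s :\ v).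
  move=> vs /andP[Fs]; rewrite /F faceD1 // (cardsD1 v) vs /=.
  by case: (odd _); case: (p).
have FD' (s : {set 'I_m}) v : v \in s -> F (~~ p) s -> F p (s :\ v).
  move=> vs /andP[Fs]; rewrite /F faceD1 // (cardsD1 v) vs /=.
  by case: (odd _); case: (p).
have Fdisj s : F p s -> ~~ F (~~ p) s.
  by rewrite /F => /andP[-> /eqP->]; case: (p).
have rle : (\rank (bd_mx K (face G A)) <= #|F p|)%N.
  rewrite (@eq_bd_mx K _ _ (predU (F p) (F (~~ p)))); last first.
    by move=> s; rewrite /= /F; case: (face _ _ _) => //=; case: (p); case: (odd _).
  rewrite bd_mxU // -(rank_pred_mx K (F p)).
  apply: leq_trans (mxrank_add _ _) _; apply: rank_exact_le.
  - exact: pred_bd_mx.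
  - by apply: bd_pred_mx => s v; move=> Fs vs; apply: FD'.
  - by apply: bd_mx_sq0 => s v Fs vs; apply: FD'.
rewrite /betti -[X in (_ + 2 * X)%N]/#|F p|; lia.
Qed.

End Euler.

(** * Monotone renumbering of vertices *)

Section Relabel.
Variables (K : fieldType) (a m : nat) (G : graph m) (G' : graph a).
Variable f : 'I_a -> 'I_m.
Hypothesis f_mono : forall x y, (f x < f y)%N = (x < y)%N.
Hypothesis GG' : forall x y, G' (x, y) = G (f x, f y).
Local Open Scope ring_scope.

(** A monotone [f] preserves the orientation signs, so the boundary of [G'] is a submatrix of the
    boundary of [G]. *)
Lemma betti_relabel : (betti K G (f @: setT) <= betti K G' setT)%N.
Proof.
have f_inj : injective f.
  move=> x y fxy; apply/val_inj/eqP; rewrite eqn_leq.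
  by rewrite [(x <= y)%N]leqNgt [(y <= x)%N]leqNgt -!f_mono fxy ltnn.
have mem_f (s : {set 'I_a}) x : (f x \in f @: s) = (x \in s) by rewrite mem_imset.
have cliqueE (s : {set 'I_a}) : is_clique G (f @: s) = is_clique G' s.
  apply/cliqueP/cliqueP => [H x y xs ys xy|H ? ?].
    by rewrite GG'; apply: H; rewrite ?imset_f // inj_eq.
  move=> /imsetP[x xs ->] /imsetP[y ys ->]; rewrite inj_eq // -GG'; exact: H.
have faceE (s : {set 'I_a}) : face G (f @: setT) (f @: s) = face G' setT s.
  by rewrite /face cliqueE imsetS ?subsetT.
have signE (s : {set 'I_a}) x : face_sign K (f @: s) (f x) = face_sign K s x.
  rewrite /face_sign; congr (_ ^+ _); rewrite -[RHS](card_imset _ f_inj); apply: eq_card => y.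
  rewrite !inE; apply/andP/imsetP => [[/imsetP[u us ->] uv]|[u]].
    by exists u; rewrite // inE us -f_mono.
  by rewrite inE => /andP[us uv] ->; rewrite mem_f us f_mono.
have D1E (s : {set 'I_a}) x : f @: s :\ f x = f @: (s :\ x).
  apply/setP => y; rewrite !inE; apply/andP/imsetP => [[yx /imsetP[u us yu]]|[u]].
    by exists u; rewrite // !inE us andbT; apply: contraNneq yx => <-; rewrite yu.
  by rewrite !inE => /andP[ux us] ->; rewrite inj_eq // mem_f.
have bdE (s t : {set 'I_a}) : bd K (face G (f @: setT)) (f @: s) (f @: t)
             = bd K (face G' setT) s t.
  rewrite /bd faceE; case: ifP => // _.
  rewrite big_imset /=; last by move=> x y _ _; apply: f_inj.
  by apply: eq_bigr => x xs; rewrite D1E signE (inj_eq (imset_inj f_inj)).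
pose E := fun_mx (fun (s : {set 'I_a}) (t : {set 'I_m}) => (t == f @: s)%:R : K).
pose E' := fun_mx (fun (t : {set 'I_m}) (s : {set 'I_a}) => (t == f @: s)%:R : K).
have DE : bd_mx K (face G' setT) = E *m bd_mx K (face G (f @: setT)) *m E'.
  rewrite !fun_mxM; apply: eq_fun_mx => s t.
  rewrite (bigD1 (f @: t)) //= eqxx mulr1 [X in _ + X]big1 ?addr0; last first.
    by move=> u /negbTE->; rewrite mulr0.
  rewrite (bigD1 (f @: s)) //= eqxx mul1r [X in _ + X]big1 ?addr0; last first.
    by move=> u /negbTE->; rewrite mul0r.
  by rewrite bdE.
have rle : (\rank (bd_mx K (face G' setT)) <= \rank (bd_mx K (face G (f @: setT))))%N.
  by rewrite DE; apply: leq_trans (mxrankM_maxl _ _) (mxrankM_maxr _ _).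
have cle : (#|face G (f @: setT)| <= #|face G' setT|)%N.
  rewrite -(card_imset (face G' setT) (imset_inj f_inj)).
  apply/subset_leq_card/subsetP => s Fs; apply/imsetP.
  exists (f @^-1: s); last first.
    apply/setP => y; apply/idP/imsetP => [ys|[x]]; last by rewrite inE => xs ->.
    case/andP: Fs => _ /subsetP/(_ y ys)/imsetP[x _ yx].
    by exists x => //; rewrite inE -yx.
  rewrite /in_mem /= /face subsetT andbT -cliqueE.
  case/andP: Fs => cs _; apply: clique_sub cs.
  by apply/subsetP => ? /imsetP[x + ->]; rewrite inE.
by rewrite /betti; lia.
Qed.

End Relabel.

(** * Euler characteristics *)

Section EulerCharacteristic.
Variables (K : fieldType) (m : nat) (G : graph m).
Hypothesis sG : simple_graph G.
Local Open Scope ring_scope.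

(** The sign counts vertices rather than dimension, so this is minus the reduced Euler
    characteristic; it is an integer, independent of [K]. *)
Definition euler (A : {set 'I_m}) : int :=
  (\sum_(s : {set 'I_m} | face G A s) (-1) ^+ #|s|).

Lemma euler_betti A : (absz (euler A) <= betti K G A)%N.
Proof.
pose N p := #|fun s : {set 'I_m} => face G A s && (odd #|s| == p)|.
have faceN : #|face G A| = (N false + N true)%N.
  apply: card_predU => [s|s /andP[_ /eqP->]]; last by rewrite andbF.
  by case: (face G A s); case: (odd _).
have sumN p (F : {set 'I_m} -> int) : (forall s : {set 'I_m}, odd #|s| == p -> F s = (-1) ^+ p) ->
    (\sum_(s : {set 'I_m} | face G A s && (odd #|s| == p)) F s = (-1) ^+ p *+ N p).
  move=> FE; rewrite (eq_bigr (fun=> (-1) ^+ p)); last by move=> s /andP[_ /FE].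
  by rewrite sumr_const.
have eE : euler A = ((N false)%:Z - (N true)%:Z).
  rewrite /euler (bigID (fun s : {set 'I_m} => odd #|s| == false)) /= (sumN false) //; last first.
    by move=> s /eqP sp; rewrite -signr_odd sp.
  rewrite (eq_bigl (fun s : {set 'I_m} => face G A s && (odd #|s| == true))); last first.
    by move=> s; case: (odd _); rewrite ?andbF.
  rewrite (sumN true); last by move=> s /eqP sp; rewrite -signr_odd sp.
  by rewrite expr0 expr1 mulNrn !natz.
have := face_card_parity_le K G A true; have := face_card_parity_le K G A false.
by rewrite -/(N true) -/(N false) faceN eE; lia.
Qed.

Lemma euler_branch (A : {set 'I_m}) w : w \in A ->
  euler A = (euler (A :\ w) - euler [set x in A | G (w, x)]).
Proof.
move=> wA; set B := [set x in A | _].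
rewrite /euler (bigID (fun s : {set 'I_m} => w \in s)) /= addrC; congr (_ + _).
  apply: eq_bigl => s; rewrite /face subsetD1 andbA; congr (_ && _).
rewrite -sumrN (reindex_onto (fun s => w |: s) (fun s => s :\ w)) /=; last first.
  by move=> s /andP[_ ws]; rewrite setD1K.
have wB : w \notin B by rewrite inE (graphxx sG) andbF.
apply: eq_big => s.
  have [ws|ws] := boolP (w \in s).
    have -> : ((w |: s) :\ w == s) = false.
      by apply/eqP => E; move: ws; rewrite -E !inE eqxx.
    rewrite andbF; apply/esym/negbTE; rewrite /face negb_and orbC.
    by apply/orP; left; apply: contraNN wB => /subsetP; apply.
  by rewrite setU1K // eqxx andbT setU11 andbT (face_cone sG).
case/andP=> _ /eqP E; rewrite cardsU1 (_ : w \notin s) ?exprS ?mulN1r //.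
by rewrite -E !inE eqxx.
Qed.

Lemma euler0 : euler set0 = 1.
Proof.
rewrite /euler (big_pred1 set0) ?cards0 // => s; rewrite /face subset0 andbC.
rewrite /=; have [->|//] := eqVneq s set0.
by apply/cliqueP => x y; rewrite inE.
Qed.

(** The recursion of [euler_branch] on lists of numbers, made for evaluation. [n] is fuel: for lists
    of length at most [n] the value 1 is returned only at the empty list, whose complex consists of
    the empty face. *)
Fixpoint euler_seq (r : rel nat) (n : nat) (s : seq nat) : int :=
  match n, s with
  | n'.+1, w :: s' => (euler_seq r n' s' - euler_seq r n' [seq x <- s' | r w x])
  | _, _ => 1
  end.

Lemma euler_seqE (r : rel nat) n (s : seq 'I_m) :
  (forall x y : 'I_m, G (x, y) = r x y) -> uniq s -> (size s <= n)%N ->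
  euler [set x in s] = euler_seq r n (map val s).
Proof.
move=> Gr; elim: n s => [|n IH] [|w s] //=; rewrite ?ltnS.
- by move=> _ _; rewrite (_ : [set x in [::]] = set0) ?euler0 //; apply/setP => x; rewrite !inE.
- by move=> _ _; rewrite (_ : [set x in [::]] = set0) ?euler0 //; apply/setP => x; rewrite !inE.
case/andP=> ws us sn; rewrite (@euler_branch _ w) ?inE ?eqxx //; congr (_ - _).
  rewrite -IH //; congr euler; apply/setP => x; rewrite !inE.
  by have [->|] := eqVneq x w; rewrite ?(negbTE ws).
rewrite filter_map -IH ?filter_uniq //; last first.
  by rewrite size_filter; apply: leq_trans (count_size _ _) sn.
congr euler; apply/setP => x; rewrite !inE mem_filter /= Gr.
have [->|] := eqVneq x w; last by rewrite andbC.
by rewrite -Gr (graphxx sG) andbF.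
Qed.

Lemma euler_le_betti_sum (r : rel nat) : (forall x y : 'I_m, G (x, y) = r x y) ->
  (absz (euler_seq r m (iota 0 m)) <= betti_sum K G)%N.
Proof.
move=> Gr; rewrite betti_sumE -val_enum_ord -(euler_seqE Gr) ?enum_uniq ?size_enum_ord //.
rewrite (_ : [set x in enum 'I_m] = setT); first exact: euler_betti.
by apply/setP => x; rewrite !inE mem_enum.
Qed.

End EulerCharacteristic.

(** * Joins *)

Section Join.
Variables (m1 m2 : nat) (G1 : graph m1) (G2 : graph m2).

Definition join_graph : graph (m1 + m2) :=
  [ffun p => match split p.1, split p.2 with
             | inl x, inl y => G1 (x, y)
             | inr x, inr y => G2 (x, y)
             | _, _ => true
             end].

Lemma join_ll x y : join_graph (lshift m2 x, lshift m2 y) = G1 (x, y).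
Proof.
by rewrite ffunE /= -[lshift m2 x]/(unsplit (inl x)) unsplitK
           -[lshift m2 y]/(unsplit (inl y)) unsplitK.
Qed.

Lemma join_rr x y : join_graph (rshift m1 x, rshift m1 y) = G2 (x, y).
Proof.
by rewrite ffunE /= -[rshift m1 x]/(unsplit (inr x)) unsplitK
           -[rshift m1 y]/(unsplit (inr y)) unsplitK.
Qed.

Lemma join_lr x y : join_graph (lshift m2 x, rshift m1 y).
Proof.
by rewrite ffunE /= -[lshift m2 x]/(unsplit (inl x)) unsplitK
           -[rshift m1 y]/(unsplit (inr y)) unsplitK.
Qed.

Lemma join_rl x y : join_graph (rshift m1 x, lshift m2 y).
Proof.
by rewrite ffunE /= -[lshift m2 y]/(unsplit (inl y)) unsplitK
           -[rshift m1 x]/(unsplit (inr x)) unsplitK.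
Qed.

Lemma join_simple : simple_graph G1 -> simple_graph G2 -> simple_graph join_graph.
Proof.
move=> s1 s2; apply/andP; split.
  apply/forallP => x; case: (split_ordP x) => y ->.
    by rewrite join_ll graphxx.
  by rewrite join_rr graphxx.
apply/forallP => x; apply/forallP => y; apply/eqP.
case: (split_ordP x) => x' ->; case: (split_ordP y) => y' ->.
- by rewrite !join_ll graphC.
- by rewrite join_lr join_rl.
- by rewrite join_lr join_rl.
- by rewrite !join_rr graphC.
Qed.

End Join.

Section Kunneth.
Variables (K : fieldType) (m1 m2 : nat) (G1 : graph m1) (G2 : graph m2).
Local Open Scope ring_scope.
Local Notation J := (join_graph G1 G2).

(** Entrywise form of [homology_dual_bases], indexed by vertex sets so that products over the two
    factors of a join can be written down. *)
Lemma betti_dual_bases m (G : graph m) (A : {set 'I_m}) :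
  exists (z : 'I_(betti K G A) -> {set 'I_m} -> K)
         (c : {set 'I_m} -> 'I_(betti K G A) -> K),
  [/\ forall i s, z i s * (face G A s)%:R = z i s,
      forall i t, \sum_s z i s * bd K (face G A) s t = 0,
      forall s j, \sum_t bd K (face G A) s t * c t j = 0
    & forall i j, \sum_s z i s * c s j = (i == j)%:R].
Proof.
have FD (s : {set 'I_m}) v : face G A s -> v \in s -> face G A (s :\ v).
  by move=> Fs _; apply: faceD1.
have [Z [C [ZP ZD DC ZC]]] := homology_dual_bases (pred_bd_mx K (face G A))
  (bd_pred_mx K FD) (bd_mx_sq0 K FD).
move: Z C ZP ZD DC ZC; rewrite rank_pred_mx -/(betti K G A) => Z C ZP ZD DC ZC.
have sumE (g : {set 'I_m} -> K) :
    \sum_s g s = \sum_(k < #|{set 'I_m}|) g (enum_val k).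
  rewrite (reindex (@enum_val {set 'I_m} {set 'I_m})) /=; last exact/onW_bij/enum_val_bij.
  exact: eq_bigr.
exists (fun i s => Z i (enum_rank s)), (fun s j => C (enum_rank s) j); split.
- move=> i s; have /submxP[W ZE] := ZP.
  have ZPZ : Z *m pred_mx K (face G A) = Z.
    rewrite ZE -mulmxA; congr (_ *m _); rewrite fun_mxM; apply: eq_fun_mx => u t.
    by rewrite sum_pred_l; case: (face G A u); rewrite ?mul1r ?mul0r.
  rewrite -[in RHS]ZPZ mxE.
  rewrite (eq_bigr (fun k => Z i k * (face G A (enum_val k) && (enum_val k == s))%:R)).
    rewrite -(sum_pred_r _ _ (fun t => Z i (enum_rank t))) sumE.
    by apply: eq_bigr => k _; rewrite enum_valK.
  by move=> k _; rewrite !mxE enum_rankK.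
- move=> i t; have := congr1 (fun M : 'M_(_, _) => M i (enum_rank t)) ZD.
  rewrite !mxE => E; rewrite -[RHS]E sumE; apply: eq_bigr => k _.
  by rewrite enum_valK !mxE enum_rankK.
- move=> s j; have := congr1 (fun M : 'M_(_, _) => M (enum_rank s) j) DC.
  rewrite !mxE => E; rewrite -[RHS]E sumE; apply: eq_bigr => k _.
  by rewrite enum_valK !mxE enum_rankK.
- move=> i j; have := congr1 (fun M : 'M_(_, _) => M i j) ZC.
  rewrite !mxE => E; rewrite -[RHS]E sumE; apply: eq_bigr => k _.
  by rewrite enum_valK.
Qed.

Definition join_set (p : {set 'I_m1} * {set 'I_m2}) : {set 'I_(m1 + m2)} :=
  lshift m2 @: p.1 :|: @rshift m1 m2 @: p.2.

Lemma lshift_join p x : (lshift m2 x \in join_set p) = (x \in p.1).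
Proof.
rewrite inE mem_imset ?orb_idr //; last exact: lshift_inj.
by case/imsetP => y _ /eqP; rewrite eq_lrshift.
Qed.

Lemma rshift_join p x : (rshift m1 x \in join_set p) = (x \in p.2).
Proof.
rewrite inE orbC mem_imset ?orb_idr //; last exact: rshift_inj.
by case/imsetP => y _ /eqP; rewrite eq_rlshift.
Qed.

Lemma join_set_bij : bijective join_set.
Proof.
exists (fun s : {set 'I_(m1 + m2)} => (lshift m2 @^-1: s, @rshift m1 m2 @^-1: s)).
  move=> [s1 s2]; congr pair; apply/setP => x; rewrite inE.
    by rewrite lshift_join.
  by rewrite rshift_join.
move=> s; apply/setP => x; case: (split_ordP x) => y ->.
  by rewrite lshift_join inE.
by rewrite rshift_join inE.
Qed.

Lemma face_join p :
  face J setT (join_set p) = face G1 setT p.1 && face G2 setT p.2.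
Proof.
rewrite /face !subsetT !andbT; apply/cliqueP/andP => [H|[/cliqueP H1 /cliqueP H2]].
  split; apply/cliqueP => x y xs ys xy.
    by rewrite -(join_ll G1 G2); apply: H; rewrite ?lshift_join // eq_lshift.
  by rewrite -(join_rr G1 G2); apply: H; rewrite ?rshift_join // eq_rshift.
move=> x y; case: (split_ordP x) => x' ->; case: (split_ordP y) => y' ->.
- by rewrite !lshift_join join_ll eq_lshift; apply: H1.
- by rewrite join_lr.
- by rewrite join_rl.
- by rewrite !rshift_join join_rr eq_rshift; apply: H2.
Qed.

Lemma face_sign_joinl p x : face_sign K (join_set p) (lshift m2 x) = face_sign K p.1 x.
Proof.
rewrite /face_sign -[in RHS](card_imset _ (@lshift_inj m1 m2)).
congr (_ ^+ _); apply: eq_card => y; rewrite inE.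
case: (split_ordP y) => z ->.
  by rewrite lshift_join mem_imset ?inE //; apply: lshift_inj.
rewrite rshift_join /=; apply/andP/imsetP => [[_]|[u _ /eqP]].
  by have := ltn_ord x; lia.
by rewrite eq_rlshift.
Qed.

(** All left vertices precede the right ones, whence the Koszul sign. *)
Lemma face_sign_joinr p x : face_sign K (join_set p) (rshift m1 x) =
  (-1) ^+ #|p.1| * face_sign K p.2 x.
Proof.
rewrite /face_sign -exprD -(card_imset p.1 (@lshift_inj m1 m2)).
rewrite -(card_imset [set u in p.2 | (u < x)%N] (@rshift_inj m1 m2)).
congr (_ ^+ _); rewrite -cardsUI [X in (_ = _ + X)%N](_ : _ = 0%N) ?addn0; last first.
  apply/eqP; rewrite cards_eq0; apply/eqP/setP => y; rewrite !inE.
  by apply/negP => /andP[/imsetP[u _ ->] /imsetP[w _ /eqP]]; rewrite eq_lrshift.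
apply: eq_card => y; rewrite inE [in RHS]inE.
case: (split_ordP y) => z ->.
  rewrite lshift_join mem_imset; last exact: lshift_inj.
  rewrite (_ : (lshift m2 z < rshift m1 x)%N); last by rewrite /= ltn_addr.
  rewrite andbT orb_idr // => /imsetP[u _ /eqP]; by rewrite eq_lrshift.
rewrite rshift_join orbC mem_imset ?inE /=; last exact: rshift_inj.
rewrite ltn_add2l orb_idr // => /imsetP[u _ /eqP]; by rewrite eq_rlshift.
Qed.

Lemma join_setD1l p x : join_set p :\ lshift m2 x = join_set (p.1 :\ x, p.2).
Proof.
apply/setP => y; rewrite in_setD1; case: (split_ordP y) => z ->.
  by rewrite !lshift_join in_setD1 eq_lshift.
by rewrite !rshift_join eq_rlshift.
Qed.

Lemma join_setD1r p x : join_set p :\ rshift m1 x = join_set (p.1, p.2 :\ x).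
Proof.
apply/setP => y; rewrite in_setD1; case: (split_ordP y) => z ->.
  by rewrite !lshift_join eq_lrshift.
by rewrite !rshift_join in_setD1 eq_rshift.
Qed.

(** Leibniz rule: the boundary is that of the left factor tensor 1 plus, with the Koszul sign, 1
    tensor that of the right factor. *)
Lemma bd_join p q :
  bd K (face J setT) (join_set p) (join_set q) =
  bd K (face G1 setT) p.1 q.1 * (face G2 setT p.2 && (p.2 == q.2))%:R
  + (face G1 setT p.1 && (p.1 == q.1))%:R * (-1) ^+ #|p.1|
    * bd K (face G2 setT) p.2 q.2.
Proof.
rewrite /bd face_join.
case: (face G1 setT p.1); last by rewrite !mul0r addr0.
case: (face G2 setT p.2); last by rewrite !mulr0 addr0.
rewrite /= (eq_bigl [predU lshift m2 @: p.1 & @rshift m1 m2 @: p.2]); last first.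
  by move=> y; rewrite !inE.
rewrite bigU /=; last first.
  rewrite disjoint_subset; apply/subsetP => ? /imsetP[u _ ->]; rewrite inE.
  by apply/imsetP => -[w _ /eqP]; rewrite eq_lrshift.
rewrite !big_imset /=; try by move=> ? ? _ _; (apply: lshift_inj || apply: rshift_inj).
have inj := bij_inj join_set_bij.
congr (_ + _).
  rewrite mulr_suml; apply: eq_bigr => x _.
  rewrite face_sign_joinl join_setD1l (inj_eq inj) [q]surjective_pairing xpair_eqE /=.
  rewrite [q.2 == _]eq_sym.
  by do 2!case: eqP; rewrite ?mulr1 ?mulr0.
rewrite mulr_sumr; apply: eq_bigr => x _.
rewrite face_sign_joinr join_setD1r (inj_eq inj) [q]surjective_pairing xpair_eqE /=.
rewrite [q.1 == _]eq_sym.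
by do 2!case: eqP; rewrite /= ?mul1r ?mul0r ?mulr0.
Qed.

(* Products of cycles and of cocycles dual to each other are again dual to each
   other; the sign twisting the second differential is harmless. *)
Lemma betti_join_ge :
  (betti K G1 setT * betti K G2 setT <= betti K J setT)%N.
Proof.
have [z1 [c1 [zF1 zD1 Dc1 zc1]]] := betti_dual_bases G1 setT.
have [z2 [c2 [zF2 zD2 Dc2 zc2]]] := betti_dual_bases G2 setT.
pose I := ('I_(betti K G1 setT) * 'I_(betti K G2 setT))%type.
have [unj uK Ku] := join_set_bij.
have sumE (g : {set 'I_(m1 + m2)} -> K) :
    \sum_s g s = \sum_s1 \sum_s2 g (join_set (s1, s2)).
  rewrite (reindex join_set) /=; last exact/onW_bij/join_set_bij.
  by rewrite pair_bigA; apply: eq_bigr => -[].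
pose Z := fun_mx (fun (i : I) s => z1 i.1 (unj s).1 * z2 i.2 (unj s).2).
pose C := fun_mx (fun s (i : I) => c1 (unj s).1 i.1 * c2 (unj s).2 i.2).
have FD (s : {set 'I_(m1 + m2)}) v : face J setT s -> v \in s -> face J setT (s :\ v).
  by move=> Fs _; apply: faceD1.
have -> : (betti K G1 setT * betti K G2 setT)%N = #|{: I}| by rewrite card_prod !card_ord.
rewrite /betti -(rank_pred_mx K (face J setT)).
apply: (@dual_bases_le_homology _ _ _ _ _ Z C).
- exact: pred_bd_mx.
- exact: bd_pred_mx.
- exact: bd_mx_sq0.
- apply/submxP; exists Z; rewrite fun_mxM; apply: eq_fun_mx => i s.
  rewrite sum_pred_r -[in face _ _ s](Ku s) face_join -mulnb natrM mulrACA.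
  by rewrite zF1 zF2.
- rewrite fun_mxM -fun_mx0; apply: eq_fun_mx => i t.
  rewrite sumE -[t]Ku; set q := unj t.
  under eq_bigr do under eq_bigr do rewrite uK bd_join /= mulrDr.
  under eq_bigr do rewrite big_split /=.
  rewrite big_split /= exchange_big /= !big1 ?addr0 //.
    move=> s1 _; rewrite (eq_bigr (fun s2 => (z1 i.1 s1 * ((face G1 setT s1 && (s1 == q.1))%:R
         * (-1) ^+ #|s1|)) * (z2 i.2 s2 * bd K (face G2 setT) s2 q.2))).
      by rewrite -mulr_sumr zD2 mulr0.
    by move=> s2 _; rewrite mulrACA !mulrA.
  move=> s2 _; rewrite (eq_bigr (fun s1 => (z1 i.1 s1 * bd K (face G1 setT) s1 q.1) * 
      (z2 i.2 s2 * (face G2 setT s2 && (s2 == q.2))%:R))).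
    by rewrite -mulr_suml zD1 mul0r.
  by move=> s1 _; rewrite mulrACA.
- rewrite fun_mxM -fun_mx0; apply: eq_fun_mx => s i.
  rewrite sumE -[s]Ku; set p := unj s.
  under eq_bigr do under eq_bigr do rewrite uK bd_join /= mulrDl.
  under eq_bigr do rewrite big_split /=.
  rewrite big_split /= exchange_big /= !big1 ?addr0 //.
    move=> s1 _; rewrite (eq_bigr (fun s2 => (((face G1 setT p.1 && (p.1 == s1))%:R
         * (-1) ^+ #|p.1|) * c1 s1 i.1) * (bd K (face G2 setT) p.2 s2 * c2 s2 i.2))).
      by rewrite -mulr_sumr Dc2 mulr0.
    by move=> s2 _; rewrite mulrACA.
  move=> s2 _; rewrite (eq_bigr (fun s1 => (bd K (face G1 setT) p.1 s1 * c1 s1 i.1) * 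
      ((face G2 setT p.2 && (p.2 == s2))%:R * c2 s2 i.2))).
    by rewrite -mulr_suml Dc1 mul0r.
  by move=> s1 _; rewrite mulrACA.
- rewrite fun_mxM -fun_mx1; apply: eq_fun_mx => i j.
  rewrite sumE; under eq_bigr do under eq_bigr do rewrite uK /= mulrACA.
  under eq_bigr do rewrite -mulr_sumr zc2.
  by rewrite -mulr_suml zc1 -natrM mulnb [i]surjective_pairing [j]surjective_pairing xpair_eqE.
Qed.

End Kunneth.

From Stdlib Require Import Reals Lra Classical.

(** * Branching bounds *)

Ltac keep_nat := repeat match goal with H : ?T |- _ =>
  lazymatch T with
  | is_true (leq _ _) => fail
  | @eq _ _ _ => fail
  | _ => clear H
  end end.
Ltac nlia := keep_nat; lia.

Lemma pow_between n (lo hi u : R) : (0 <= lo)%R -> (0 <= u)%R -> (0 <= hi)%R ->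
  (lo ^ n < u ^ n)%R -> (u ^ n < hi ^ n)%R -> (lo < u < hi)%R.
Proof.
move=> lo0 u0 hi0 lou uhi; split; apply: Rnot_le_lt => le.
  by have := pow_incr u lo n (conj u0 le); lra.
by have := pow_incr hi u n (conj hi0 le); lra.
Qed.

(* [e] is adjacency in the complement of the graph, [b A] the total Betti number
   of the clique complex of the subgraph induced on [A]. *)
Record branching (V : finType) (e : rel V) (b : {set V} -> nat) : Prop := Branching {
  branching_sym : symmetric e;
  branching_irr : irreflexive e;
  branching_step : forall (A : {set V}) w, w \in A ->
    b A <= b (A :\ w) + b [set x in A | (x != w) && ~~ e w x];
  branching_isolated : forall (A : {set V}) v, v \in A ->
    {in A, forall x, ~~ e v x} -> b A = 0;
  branching_empty : b set0 <= 1 }.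

Section Branching.
Variables (V : finType) (e : rel V) (b : {set V} -> nat).
Hypothesis bb : branching e b.
Let e_sym := branching_sym bb.
Let e_irr := branching_irr bb.
Implicit Types (A B : {set V}) (v w x y : V) (ps ws : seq V).

Definition deg A w := #|[set x in A | e w x]|.

Definition rest A ps w := [set x in A | [&& x \notin ps, x != w & ~~ e w x]].

(** A branch loses [w], its neighbours, and those earlier deleted vertices that are not neighbours
    of [w]. The last group is where the order of deletion pays off. *)
Lemma card_rest A ps w : uniq (w :: ps) -> {subset w :: ps <= A} ->
  #|rest A ps w| + (deg A w + 1 + count (fun p => ~~ e w p) ps) = #|A|.
Proof.
move=> U S; pose N := [set x in A | e w x]; pose Q := [set x in ps | ~~ e w x].
have cQ : #|Q| = count (fun p => ~~ e w p) ps.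
  have Uf : uniq [seq p <- ps | ~~ e w p] by case/andP: U => _ /filter_uniq.
  rewrite -size_filter -(card_uniqP Uf).
  by apply/eq_card => x; rewrite inE mem_filter andbC.
have wA : w \in A by apply: S; rewrite inE eqxx.
have -> : rest A ps w = A :\: (w |: N) :\: Q.
  apply/setP => x; rewrite !inE; case: (x \in A); rewrite ?andbF //=.
  by case: (x == w); case: (e w x); case: (x \in ps).
rewrite -cQ (_ : deg A w = #|N|) //.
have QA : Q \subset A :\: (w |: N).
  apply/subsetP => x; rewrite !inE => /andP[xs wx].
  rewrite S ?inE ?xs ?orbT // (negbTE wx) andbF orbF andbT.
  by apply/negP => /eqP E; move: U; rewrite /= -E xs.
have NA : w |: N \subset A.
  by apply/subsetP => x; rewrite !inE => /orP[/eqP->//|/andP[]].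
have := cardsID Q (A :\: (w |: N)); rewrite (setIidPr QA).
have := cardsID (w |: N) A; rewrite (setIidPr NA) cardsU1.
have -> : w \notin N by rewrite !inE e_irr andbF.
by nlia.
Qed.

Fixpoint star_sum A ps ws : nat :=
  if ws is w :: ws' then b (rest A ps w) + star_sum A (w :: ps) ws' else 0.

Lemma b_star_sum A v ps ws : v \in A -> uniq (ps ++ ws) -> v \notin ps ++ ws ->
  {subset ws <= A} ->
  {in A, forall x, e v x -> x \in ps ++ ws} ->
  b [set x in A | x \notin ps] <= star_sum A ps ws.
Proof.
move=> vA; elim: ws ps => [|w ws IH] ps U vN S C /=.
  (* All neighbours of [v] are deleted by now, so [v] is isolated and no remainder is left. *)
  rewrite (branching_isolated bb (v := v)) //.
    by rewrite inE vA -[ps]cats0.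
  move=> x; rewrite inE => /andP[xA xps]; apply/negP => /(C _ xA).
  by rewrite cats0 (negbTE xps).
set B := [set x in A | _].
have wps : w \notin ps by move: U; rewrite cat_uniq /= negb_or => /and3P[_ /andP[]].
have wB : w \in B by rewrite inE S ?inE ?eqxx.
apply: leq_trans (branching_step bb wB) _; rewrite addnC leq_add //.
  rewrite (_ : [set x in B | _] = rest A ps w) //.
  by apply/setP => x; rewrite !inE -!andbA.
rewrite (_ : B :\ w = [set x in A | x \notin w :: ps]); last first.
  by apply/setP => x; rewrite !inE negb_or; case: (x == w); rewrite ?andbF.
have P : perm_eq (ps ++ w :: ws) ((w :: ps) ++ ws).
  by rewrite -cat_rcons perm_cat2r perm_rcons.
apply: IH.
- by rewrite -(perm_uniq P).
- by rewrite -(perm_mem P).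
- by move=> x xs; apply: S; rewrite inE xs orbT.
- by move=> x xA vx; rewrite -(perm_mem P); apply: C.
Qed.

(** The order of the list is the order of deletion in [star_sum]; [star_perm] is the freedom to
    choose it. *)
Definition star A v ws :=
  [/\ v \in A, uniq ws & forall x, (x \in ws) = (x \in A) && e v x].

Lemma star_perm A v ws ws' : perm_eq ws ws' -> star A v ws -> star A v ws'.
Proof.
move=> P [vA U S]; split=> //; first by rewrite -(perm_uniq P).
by move=> x; rewrite -(perm_mem P).
Qed.

Lemma star_enum A v : v \in A -> star A v (enum [set x in A | e v x]).
Proof.
by move=> vA; split; rewrite ?enum_uniq // => x; rewrite mem_enum inE.
Qed.

Lemma star_deg A v ws : star A v ws -> deg A v = size ws.
Proof.
case=> _ U S; rewrite -(card_uniqP U); apply: eq_card => x.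
by rewrite inE S.
Qed.

Lemma star_intro A v ws : v \in A -> uniq ws ->
  {in ws, forall x, (x \in A) && e v x} -> deg A v <= size ws -> star A v ws.
Proof.
move=> vA U S; rewrite -(card_uniqP U) => d; split=> // x.
have sub : ws \subset [set x in A | e v x].
  by apply/subsetP => y /S; rewrite inE.
have /subset_cardP/(_ sub) E : #|ws| = #|[set x in A | e v x]|.
  by apply/eqP; rewrite eqn_leq d subset_leq_card.
by rewrite E inE.
Qed.

Lemma star_mem A v ws w : star A v ws -> w \in ws -> w \in A.
Proof. by case=> _ _ S; rewrite S => /andP[]. Qed.

Lemma star_edge A v ws w : star A v ws -> w \in ws -> e v w.
Proof. by case=> _ _ S; rewrite S => /andP[]. Qed.

Lemma star_notin A v ws : star A v ws -> v \notin ws.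
Proof. by case=> _ _ S; rewrite S e_irr andbF. Qed.

Lemma b_star A v ws : star A v ws -> b A <= star_sum A [::] ws.
Proof.
move=> st; have := st => -[vA U S].
have := @b_star_sum A v [::] ws vA U (star_notin st).
rewrite (_ : [set x in A | _] = A); last by apply/setP => x; rewrite inE andbT.
by apply=> [x|x xA vx]; rewrite /= S ?xA ?vx // => /andP[].
Qed.

(** * Weights of single branches *)

Section Weights.
Variables (A : {set V}) (M u : R).
Hypotheses (M0 : (0 <= M)%R) (u0 : (0 < u)%R).

(** In use, [M] is t^|A| up to a constant factor and [u] is 1/t: the induction hypothesis normalised
    so that only the number of lost vertices enters. *)
Hypothesis IH : forall B k, B \subset A -> 0 < k -> #|B| + k <= #|A| ->
  (INR (b B) <= M * u ^ k)%R.

Lemma rest_sub_bound B ps w k j : B \subset A -> #|B| + k <= #|A| ->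
  uniq (w :: ps) -> {subset w :: ps <= B} ->
  j <= deg B w + count (fun p => ~~ e w p) ps ->
  (INR (b (rest B ps w)) <= M * u ^ (k + j.+1))%R.
Proof.
move=> BA Bk U S jd; apply: IH; last 2 first.
- by rewrite addnS.
- by have := card_rest U S; nlia.
by apply: subset_trans BA; apply/subsetP => x; rewrite inE => /andP[].
Qed.

Lemma rest_bound ps w j : uniq (w :: ps) -> {subset w :: ps <= A} ->
  j <= deg A w + count (fun p => ~~ e w p) ps ->
  (INR (b (rest A ps w)) <= M * u ^ j.+1)%R.
Proof. by apply: (@rest_sub_bound A ps w 0) => //; rewrite addn0. Qed.

(** [ls] collects neighbours of [y] that the branch destroys, as deleted earlier or as members of
    the closed neighbourhood of [w]. *)
Lemma deg_rest ps w y ls : uniq ls ->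
  {in ls, forall z, [&& z \in A, e y z & (z \in ps) || (z == w) || e w z]} ->
  deg (rest A ps w) y + size ls <= deg A y.
Proof.
move=> U L; rewrite -(card_uniqP U) /deg.
set N := [set x in rest A ps w | _].
have D : [disjoint N & ls].
  rewrite disjoint_subset; apply/subsetP => x; rewrite !inE => /andP[/and4P[_ xp xw wx] _].
  apply/negP => /L /and3P[_ _]; by rewrite (negbTE xp) (negbTE xw) (negbTE wx).
have := cardUI (mem N) (mem ls); rewrite [X in _ + X = _](eqP D) addn0 => <-.
apply/subset_leq_card/subsetP => x; rewrite !inE => /orP[|/L/and3P[-> ->]//].
by case/andP=> /and4P[-> _ _ _] ->.
Qed.

(** An isolated [y] gives 0. If [z] is its only neighbour, the single branch at [z] remains, and it
    loses at least [y] and [z]: two extra factors [u]. *)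
Lemma deg1_bound B y k : B \subset A -> y \in B -> deg B y <= 1 ->
  #|B| + k <= #|A| -> (INR (b B) <= M * u ^ k.+2)%R.
Proof.
move=> BA yB; have st := star_enum yB; rewrite (star_deg st).
have M0' : (0 <= M * u ^ k.+2)%R by apply: Rmult_le_pos => //; apply: pow_le; lra.
case: (enum _) st => [|z [|z' ws]] st // _ Bk; have /= le := b_star st.
  suff -> : b B = 0 by rewrite /=; exact: M0'.
  by nlia.
have z1 : z \in [:: z] by rewrite inE.
have sub : {subset [:: z] <= B} by move=> x; apply: (star_mem st).
have /= cr := @card_rest B [::] z isT sub.
have dz : 0 < deg B z.
  by apply/card_gt0P; exists y; rewrite inE yB e_sym (star_edge st z1).
apply: Rle_trans (_ : INR (b (rest B [::] z)) <= _)%R.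
  by apply: le_INR; nlia.
apply: (IH (k := k.+2)); [|by nlia|by nlia].
by apply: subset_trans BA; apply/subsetP => x; rewrite inE => /andP[].
Qed.

(** The branches at the two neighbours lose 3 and 4 vertices if these are not adjacent, or if one of
    them, taken second, has degree at least 3. Otherwise they form a triangle component with [y].
    The assumption on [u] absorbs the weight u^2 of a vertex of degree at most one. *)
Lemma deg2_bound B y k : (u ^ 2 <= u ^ 3 + u ^ 4)%R ->
  B \subset A -> y \in B -> deg B y <= 2 -> #|B| + k <= #|A| ->
  (INR (b B) <= M * (u ^ k * (u ^ 3 + u ^ 4)))%R \/
  exists p q, [/\ star B y [:: p; q], e p q, star B p [:: y; q] & star B q [:: y; p]].
Proof.
move=> u234 BA yB dy Bk.
have uk : (0 <= M * u ^ k)%R by apply: Rmult_le_pos => //; apply: pow_le; lra.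
have two : (M * u ^ k.+2 <= M * (u ^ k * (u ^ 3 + u ^ 4)))%R.
  have := Rmult_le_compat_l _ _ _ uk u234; rewrite !Rmult_assoc.
  by rewrite -[k.+2]addn2 Rdef_pow_add.
have d1 z : z \in B -> deg B z <= 1 ->
    (INR (b B) <= M * (u ^ k * (u ^ 3 + u ^ 4)))%R.
  by move=> zB dz; apply: Rle_trans two; apply: deg1_bound dz _.
have [dy1|dy2] := leqP (deg B y) 1; first by left; apply: d1 dy1.
have st := star_enum yB; have := star_deg st.
case: (enum _) st => [|p [|q [|z ws]]] st /= sz; try by nlia.
have pB : p \in B by apply: star_mem st _; rewrite !inE eqxx.
have qB : q \in B by apply: star_mem st _; rewrite !inE eqxx orbT.
have yp : e y p by apply: star_edge st _; rewrite !inE eqxx.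
have yq : e y q by apply: star_edge st _; rewrite !inE eqxx orbT.
have pq : p != q by case: st => _ /=; rewrite inE andbT.
have [dp1|dp2] := leqP (deg B p) 1; first by left; apply: d1 dp1.
have [dq1|dq2] := leqP (deg B q) 1; first by left; apply: d1 dq1.
have key s t : s != t -> star B y [:: s; t] ->
    4 <= deg B t + 1 + ~~ e t s ->
    1 < deg B s -> (INR (b B) <= M * (u ^ k * (u ^ 3 + u ^ 4)))%R.
  move=> st' sty dt ds; have := b_star sty; rewrite /= addn0 => le.
  have U : uniq [:: t; s] by rewrite /= inE eq_sym st'.
  have S1 : {subset [:: s] <= B}.
    by move=> x xs; apply: star_mem sty _; rewrite inE in xs; rewrite !inE xs.
  have S2 : {subset [:: t; s] <= B}.
    by move=> x; rewrite !inE orbC => xs; apply: star_mem sty _; rewrite !inE.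
  have b1 : (INR (b (rest B [::] s)) <= M * u ^ (k + 3))%R.
    by apply: rest_sub_bound => //=; nlia.
  have b2 : (INR (b (rest B [:: s] t)) <= M * u ^ (k + 4))%R.
    by apply: rest_sub_bound => //=; nlia.
  apply: Rle_trans (le_INR _ _ (elimT leP le)) _; rewrite plus_INR.
  apply: Rle_trans (Rplus_le_compat _ _ _ _ b1 b2) _.
  by rewrite !Rdef_pow_add; right; ring.
have swap : star B y [:: q; p].
  by apply: star_perm st; apply/permP => z /=; nlia.
have [epq|epq] := boolP (e p q); last first.
  left; apply: (key p q) => //; rewrite e_sym epq /=; nlia.
have [dq3|dq3] := leqP 3 (deg B q).
  by left; apply: (key p q) => //; nlia.
have [dp3|dp3] := leqP 3 (deg B p).
  by left; apply: (key q p) => //; [rewrite eq_sym|nlia].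
right; exists p, q; split=> //.
  apply: star_intro => //.
    by rewrite /= inE; case: eqP yq => // ->; rewrite e_irr.
  by move=> x; rewrite !inE => /orP[]/eqP->; rewrite ?yB ?qB ?epq // e_sym yp.
apply: star_intro => //.
  by rewrite /= inE; case: eqP yp => // ->; rewrite e_irr.
by move=> x; rewrite !inE => /orP[]/eqP->; rewrite ?yB ?pB ?[e q p]e_sym ?epq // e_sym yq.
Qed.
(** One weight per branch in the order of deletion. Distinctness and containment in [A] are handed
    to each branch, so that each can be weighed on its own. *)
Fixpoint star_ok ps ws (rs : seq R) : Prop :=
  match ws, rs with
  | w :: ws', r :: rs' =>
      (uniq (w :: ps) -> {subset w :: ps <= A} ->
       (INR (b (rest A ps w)) <= M * r)%R) /\ star_ok (w :: ps) ws' rs'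
  | [::], [::] => True
  | _, _ => False
  end.

Lemma star_final v ws rs : star A v ws -> star_ok [::] ws rs ->
  (foldr Rplus 0 rs <= 1)%R -> (INR (b A) <= M)%R.
Proof.
move=> st ok rs1; apply: Rle_trans (le_INR _ _ (elimT leP (b_star st))) _.
apply: Rle_trans (_ : M * foldr Rplus 0 rs <= _)%R; last first.
  by rewrite -[X in (_ <= X)%R]Rmult_1_r; apply: Rmult_le_compat_l.
have [_ U S] := st.
have {U} : uniq ([::] ++ ws) by [].
have {S} : {subset [::] ++ ws <= A} by move=> x; rewrite S => /andP[].
clear st rs1; elim: ws [::] rs ok => [|w ws IHw] ps [|r rs] //=.
  by move=> _ _ _; rewrite Rmult_0_r; right.
case=> ok1 ok2 S U; rewrite plus_INR Rmult_plus_distr_l.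
have P : perm_eq (ps ++ w :: ws) ((w :: ps) ++ ws).
  by rewrite -cat_rcons perm_cat2r perm_rcons.
apply: Rplus_le_compat.
  apply: ok1.
    by move: U; rewrite (perm_uniq P) cat_uniq => /andP[].
  by move=> x xs; apply: S; rewrite (perm_mem P) mem_cat xs.
apply: IHw => //; last by rewrite -(perm_uniq P).
by move=> x; rewrite -(perm_mem P); apply: S.
Qed.

Lemma deg1_rest_bound ps w y ls j : uniq (w :: ps) -> {subset w :: ps <= A} ->
  [&& y \in A, y \notin ps, y != w & ~~ e w y] ->
  uniq ls ->
  {in ls, forall z, [&& z \in A, e y z & (z \in ps) || (z == w) || e w z]} ->
  deg A y <= (size ls).+1 ->
  j <= deg A w + count (fun p => ~~ e w p) ps ->
  (INR (b (rest A ps w)) <= M * u ^ j.+3)%R.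
Proof.
move=> U S yr Ul L dy jd; apply: (@deg1_bound _ y j.+1).
- by apply/subsetP => x; rewrite inE => /andP[].
- by rewrite inE.
- by have := deg_rest Ul L; nlia.
- by have := card_rest U S; nlia.
Qed.

Lemma deg2_rest_bound ps w y ls j : (u ^ 2 <= u ^ 3 + u ^ 4)%R ->
  uniq (w :: ps) -> {subset w :: ps <= A} ->
  [&& y \in A, y \notin ps, y != w & ~~ e w y] ->
  uniq ls ->
  {in ls, forall z, [&& z \in A, e y z & (z \in ps) || (z == w) || e w z]} ->
  deg A y <= (size ls).+2 ->
  j <= deg A w + count (fun p => ~~ e w p) ps ->
  (INR (b (rest A ps w)) <= M * (u ^ j.+1 * (u ^ 3 + u ^ 4)))%R \/
  exists p q, let B := rest A ps w in
    [/\ star B y [:: p; q], e p q, star B p [:: y; q] & star B q [:: y; p]].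
Proof.
move=> u234 U S yr Ul L dy jd; apply: deg2_bound => //.
- by apply/subsetP => x; rewrite inE => /andP[].
- by rewrite inE.
- by have := deg_rest Ul L; nlia.
- by have := card_rest U S; nlia.
Qed.

(** Only two branches here: deleting [w] loses one vertex, the other branch loses at least D + 1. *)
Lemma high_deg_bound w D : w \in A -> D <= deg A w -> (u + u ^ D.+1 <= 1)%R ->
  (INR (b A) <= M)%R.
Proof.
move=> wA dw uD; have := branching_step bb wA.
rewrite (_ : [set x in A | _] = rest A [::] w) // => le.
have b2 : (INR (b (rest A [::] w)) <= M * u ^ D.+1)%R.
  by apply: rest_bound => //=; [move=> x; rewrite inE => /eqP->|nlia].
have b1 : (INR (b (A :\ w)) <= M * u ^ 1)%R.
  by apply: IH; rewrite ?subD1set // [X in _ <= X](cardsD1 w) wA addnC.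
rewrite pow_1 in b1.
apply: Rle_trans (le_INR _ _ (elimT leP le)) _; rewrite plus_INR.
have := Rmult_le_compat_l _ _ _ M0 uD; lra.
Qed.

Lemma star_base_bound v ws d : star A v ws -> {in A, forall x, d <= deg A x} ->
  (INR (size ws) * u ^ d.+1 <= 1)%R -> (INR (b A) <= M)%R.
Proof.
move=> st dA le; apply: (star_final (rs := nseq (size ws) (u ^ d.+1)%R) st).
  elim: (ws) [::] => [//|w ws' IHw] ps; split; last exact: IHw.
  move=> U S; apply: rest_bound => //.
  by apply: leq_trans (leq_addr _ _); apply: dA; apply: S; rewrite inE eqxx.
apply: Rle_trans le; right; elim: (size ws) => [|k IHk]; first by rewrite /= Rmult_0_l.
by rewrite S_INR Rmult_plus_distr_r -IHk Rmult_1_l Rplus_comm.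
Qed.

End Weights.

(** Strong induction on the size, with t^|B| rewritten as t^(|B| + k) u^k; a hereditary [P] carries
    clique-freeness into the branches. *)
Lemma branching_ind (P : {set V} -> Prop) (t : R) : (1 <= t)%R ->
  (forall A B, B \subset A -> P A -> P B) ->
  (forall A, P A -> A != set0 ->
    (forall B k, B \subset A -> 0 < k -> #|B| + k <= #|A| ->
       (INR (b B) <= t ^ #|A| * (/ t) ^ k)%R) ->
    (INR (b A) <= t ^ #|A|)%R) ->
  forall A, P A -> (INR (b A) <= t ^ #|A|)%R.
Proof.
move=> t1 Pher step A; have [n] := ubnP #|A|; elim: n A => // n IHn A An PA.
have [->|A0] := eqVneq A set0.
  by rewrite cards0 /=; have := le_INR _ _ (elimT leP (branching_empty bb)).
apply: step => // B k BA k0 Bk.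
apply: Rle_trans (_ : t ^ #|B| <= _)%R.
  by apply: IHn; [nlia|exact: Pher BA PA].
have -> : (t ^ #|B| = t ^ (#|B| + k) * (/ t) ^ k)%R.
  by rewrite Rdef_pow_add pow_inv; field; apply: pow_nonzero; lra.
apply: Rmult_le_compat_r.
  by apply: pow_le; apply/Rlt_le/Rinv_0_lt_compat; lra.
by apply: Rle_pow => //; apply/leP.
Qed.

Lemma min_degP A : A != set0 -> exists v ws, star A v ws /\
  {in A, forall x, size ws <= deg A x}.
Proof.
case/set0Pn => v0 v0A; have [v vA vmin] := arg_minnP (deg A) v0A.
exists v, (enum [set x in A | e v x]); have st := star_enum vA; split=> //.
by rewrite -(star_deg st).
Qed.

Lemma b_le_4 (t : R) : (1 <= t)%R -> (t ^ 5 = 4)%R ->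
  forall A, (INR (b A) <= t ^ #|A|)%R.
Proof.
move=> t1 t5 A; apply: (branching_ind (P := fun _ => True)) => // {}A _ A0 IH.
have t0 : (0 <= t ^ #|A|)%R by apply: pow_le; lra.
set u := (/ t)%R in IH *.
have u0 : (0 < u)%R by apply: Rinv_0_lt_compat; lra.
have u5 : (u ^ 5 = / 4)%R by rewrite /u pow_inv t5.
have [ulo uhi] : (757/1000 < u < 758/1000)%R.
  by apply: (@pow_between 5); rewrite ?u5; lra.
have le1 : (u <= 1)%R by lra.
have upow n := pow_incr u (758/1000) n (conj (Rlt_le _ _ u0) (Rlt_le _ _ uhi)).
have [/exists_inP[w wA dw]|/exists_inPn small] := boolP [exists w in A, 5 <= deg A w].
  by apply: (high_deg_bound t0 IH wA dw); have := upow 6; lra.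
have [v [ws [st dmin]]] := min_degP A0.
have sz : size ws <= 4.
  by rewrite -(star_deg st) -ltnS ltnNge; apply: small; case: st.
(* For d <= 4 the sum d u^(d+1) is at most 1, with equality at d = 4, the case of disjoint 5-cliques
   in the complement. *)
apply: (star_base_bound t0 IH st dmin).
have := upow 2; have := upow 3; have := upow 4.
by case: ws {st dmin} sz => [|? [|? [|? [|? [|//]]]]] _;
  rewrite [INR _]INR_IZR_INZ /=; lra.
Qed.

Definition clique_free k A := forall ws,
  size ws = k -> {subset ws <= A} -> pairwise e ws -> False.

Lemma clique_freeS k A B : B \subset A -> clique_free k A -> clique_free k B.
Proof.
by move=> /subsetP BA KA ws sz S; apply: KA sz _ => x /S; apply: BA.
Qed.

(** Minimum degree 4 is critical, as 4 u^5 = 4u/3 is slightly above 1. Two non-adjacent neighbours,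
    deleted first, improve one weight to u^6; if there are none, [v] and its neighbours form a
    K_5. *)
Lemma b_le_3 (t : R) : (1 <= t)%R -> (t ^ 4 = 3)%R ->
  forall A, clique_free 5 A -> (INR (b A) <= t ^ #|A|)%R.
Proof.
move=> t1 t4; apply: branching_ind => // [A B|A KA A0 IH]; first exact: clique_freeS.
have t0 : (0 <= t ^ #|A|)%R by apply: pow_le; lra.
set u := (/ t)%R in IH *.
have u0 : (0 < u)%R by apply: Rinv_0_lt_compat; lra.
have u4 : (u ^ 4 = / 3)%R by rewrite /u pow_inv t4.
have [ulo uhi] : (759/1000 < u < 76/100)%R.
  by apply: (@pow_between 4); rewrite ?u4; lra.
have upow n := pow_incr u (76/100) n (conj (Rlt_le _ _ u0) (Rlt_le _ _ uhi)).
have [/exists_inP[w wA dw]|/exists_inPn small] := boolP [exists w in A, 5 <= deg A w].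
  by apply: (high_deg_bound t0 IH wA dw); have := upow 6; lra.
have [v [ws [st dmin]]] := min_degP A0.
have sz : size ws <= 4.
  by rewrite -(star_deg st) -ltnS ltnNge; apply: small; case: st.
have [d4|d4] := eqVneq (size ws) 4; last first.
  apply: (star_base_bound t0 IH st dmin); have := upow 2; have := upow 3.
  by case: ws {st dmin} sz d4 => [|? [|? [|? [|? [|//]]]]] // _ _;
    rewrite [INR _]INR_IZR_INZ /=; lra.
have sub : {subset v :: ws <= A}.
  by move=> x; rewrite inE => /orP[/eqP->|]; [case: st|exact: (star_mem st)].
have base x y z w : star A v [:: x; y; z; w] -> ~~ e y x -> (INR (b A) <= t ^ #|A|)%R.
  move=> sx yx; have d w' := star_mem sx (w := w').
  have {}dmin : {in A, forall x, 4 <= deg A x} by move=> a; rewrite -d4; apply: dmin.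
  apply: (star_final (rs := [:: u ^ 5; u ^ 6; u ^ 5; u ^ 5]%R) t0 sx).
    do !split; move=> U S; apply: (rest_bound IH) => //=; rewrite ?yx;
      have := dmin _ (S _ (mem_head _ _)); nlia.
  by have := upow 5; have := upow 6; rewrite /=; lra.
case: ws st d4 {sz} => [|a [|b' [|c [|d [|//]]]]] // st d4 in dmin sub base *.
have perm ws' : perm_eq [:: a; b'; c; d] ws' -> star A v ws'.
  by move=> P; apply: star_perm st.
have [ab|ab] := boolP (e a b'); last first.
  by apply: (base b' a c d) => //; apply: perm; apply/permP => z /=; nlia.
have [ac|ac] := boolP (e a c); last first.
  by apply: (base c a b' d) => //; apply: perm; apply/permP => z /=; nlia.
have [ad|ad] := boolP (e a d); last first.
  by apply: (base d a b' c) => //; apply: perm; apply/permP => z /=; nlia.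
have [bc|bc] := boolP (e b' c); last first.
  by apply: (base c b' a d) => //; apply: perm; apply/permP => z /=; nlia.
have [bd|bd] := boolP (e b' d); last first.
  by apply: (base d b' a c) => //; apply: perm; apply/permP => z /=; nlia.
have [cd|cd] := boolP (e c d); last first.
  by apply: (base d c a b') => //; apply: perm; apply/permP => z /=; nlia.
case: (KA [:: v; a; b'; c; d]) => //=.
by rewrite ab ac ad bc bd cd !(star_edge st) ?inE ?eqxx ?orbT.
Qed.

(** Non-adjacency makes every earlier deleted vertex an additional loss. *)
Lemma star_indep_bound A (M u : R) v ws d : (0 <= M)%R ->
  (forall B k, B \subset A -> 0 < k -> #|B| + k <= #|A| ->
     (INR (b B) <= M * u ^ k)%R) ->
  star A v ws -> {in ws, forall x, d <= deg A x} ->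
  {in ws &, forall x y, ~~ e x y} ->
  (foldr Rplus 0 [seq (u ^ (d + j).+1)%R | j <- iota 0 (size ws)] <= 1)%R ->
  (INR (b A) <= M)%R.
Proof.
move=> M0 IH st dws ind; apply: (star_final M0 st).
suff ok ps ws' : {subset ps ++ ws' <= ws} -> star_ok A M ps ws'
    [seq (u ^ (d + j).+1)%R | j <- iota (size ps) (size ws')].
  exact: (ok [::] ws).
elim: ws' ps => [//|w ws' IHw] ps sub; split; last first.
  by apply: (IHw (w :: ps)) => x xs; apply: sub; move: xs; rewrite !mem_cat !inE orbCA orbA.
move=> U S; apply: (rest_bound IH) => //; rewrite leq_add //.
  by apply: dws; apply: sub; rewrite mem_cat mem_head orbT.
suff : all (fun p => ~~ e w p) ps by rewrite all_count => /eqP->.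
by apply/allP => x xs; apply: ind; apply: sub; rewrite mem_cat ?mem_head ?xs ?orbT.
Qed.

(** Neighbourhoods are independent, so minimum degree d gives u^(d+1) + ... + u^(2d). By the
    equation for [t] this is exactly 1 at d = 4; among d <= 6 it exceeds 1 only at d = 3. *)
Lemma b_le_root (t : R) : (1 <= t <= 2)%R ->
  (t ^ 8 - t ^ 3 - t ^ 2 - t - 1 = 0)%R ->
  forall A, clique_free 3 A -> (INR (b A) <= t ^ #|A|)%R.
Proof.
move=> [t1 _] tr; apply: branching_ind => // [A B|A KA A0 IH].
  exact: clique_freeS.
have t0 : (0 <= t ^ #|A|)%R by apply: pow_le; lra.
set u := (/ t)%R in IH *.
have u0 : (0 < u)%R by apply: Rinv_0_lt_compat; lra.
have ur : (u ^ 5 + u ^ 6 + u ^ 7 + u ^ 8 = 1)%R.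
  rewrite /u; apply: (Rmult_eq_reg_r (t ^ 8)); last by apply: pow_nonzero; lra.
  have E : (t ^ 8 = t ^ 3 + t ^ 2 + t + 1)%R by lra.
  by rewrite Rmult_1_l [RHS]E; field; lra.
have uhi : (u < 81/100)%R.
  apply: Rnot_le_lt => le; have p81 : (0 <= 81/100)%R by lra.
  have h n := pow_incr (81/100) u n (conj p81 le).
  by have := h 5; have := h 6; have := h 7; have := h 8; lra.
have ulo : (80/100 < u)%R.
  apply: Rnot_le_lt => le.
  have h n := pow_incr u (80/100) n (conj (Rlt_le _ _ u0) le).
  by have := h 5; have := h 6; have := h 7; have := h 8; lra.
have upow n := pow_incr u (81/100) n (conj (Rlt_le _ _ u0) (Rlt_le _ _ uhi)).
have [/exists_inP[w wA dw]|/exists_inPn small] := boolP [exists w in A, 7 <= deg A w].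
  by apply: (high_deg_bound t0 IH wA dw); have := upow 8; lra.
have [v [ws [st dmin]]] := min_degP A0.
have sz : size ws <= 6.
  by rewrite -(star_deg st) -ltnS ltnNge; apply: small; case: st.
have vA : v \in A by case: st.
have ind : {in ws &, forall x y, ~~ e x y}.
  move=> x y xs ys; apply/negP => xy; case: (KA [:: v; x; y]) => //=.
    by move=> z; rewrite !inE => /or3P[]/eqP-> //; apply: star_mem st _.
  by rewrite xy !(star_edge st).
have dws : {in ws, forall x, size ws <= deg A x}.
  by move=> x xs; apply: dmin; apply: star_mem st xs.
have [d3|d3] := eqVneq (size ws) 3; last first.
  apply: (star_indep_bound t0 IH st dws ind).
  have := upow 2; have := upow 3; have := upow 4; have := upow 9; have := upow 10.
  have := upow 11; have := upow 12; have := upow 7; have := upow 8; have := upow 6.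
  case: (size ws) d3 sz => [|[|[|[|[|[|[|//]]]]]]] //= _ _; lra.
(* If all three neighbours have degree at least 4, the weights u^5, u^6, u^7 fall short of 1 by
   u^8. *)
have [/hasP[y ys yd]|/hasPn big] := boolP (has (fun y => deg A y <= 3) ws); last first.
  apply: (@star_indep_bound A _ u v ws 4 t0 IH st _ ind).
    by move=> x /big; rewrite -ltnNge.
  by rewrite d3 /=; have := pow_lt u 8 u0; rewrite /= in ur *; lra.
have [a [c st']] : exists a c, star A v [:: a; y; c].
  case/path.splitPr: ys st d3 => p1 p2 st; rewrite size_cat /= addnS => -[].
  case: p1 st => [|x1 [|x2 [|x3 p1]]] st; case: p2 st => [|z1 [|z2 [|z3 p2]]] st;
    rewrite /= ?addnS ?addSn // => _.
  - by exists z1, z2; apply: star_perm st; apply/permP => z /=; nlia.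
  - by exists x1, z1.
  - by exists x1, x2; apply: star_perm st; apply/permP => z /=; nlia.
have mem' z : z \in [:: a; y; c] -> z \in ws.
  by case: st' => _ _ ->; case: st => _ _ ->.
have [aw yw cw] : [/\ a \in ws, y \in ws & c \in ws].
  by split; apply: mem'; rewrite !inE eqxx ?orbT.
have inA := star_mem st.
(* The branch at [a] loses [v], so [y] keeps degree at most 2 and the weight u^4 improves to u^7 +
   u^8, the triangle being excluded. The total is exactly 1 again. *)
apply: (star_final (rs := [:: u ^ 4 * (u ^ 3 + u ^ 4); u ^ 5; u ^ 6]%R) t0 st').
  do !split; move=> U S.
  - have u234 : (u ^ 2 <= u ^ 3 + u ^ 4)%R by nra.
    have [|||||//|[p [q [sy epq sp sq]]]] :=
      @deg2_rest_bound A _ u t0 u0 IH [::] a y [:: v] 3 u234 U S.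
    + by rewrite inA //= ind // andbT; case: st' => _ /=;
         rewrite !inE eq_sym negb_or => /andP[/andP[]].
    + by [].
    + by move=> z; rewrite inE => /eqP->;
         rewrite vA [e y v]e_sym [e a v]e_sym !(star_edge st) ?orbT.
    + by [].
    + by rewrite addn0 -d3; apply: dws.
    case: (KA [:: y; p; q]) => //.
      move=> z; rewrite !inE => /or3P[]/eqP->; first exact: inA.
        by have := star_mem sy (mem_head _ _); rewrite inE => /andP[].
      by have := star_mem sp (_ : q \in [:: y; q]); rewrite !inE eqxx orbT => /(_ isT)/andP[].
    by rewrite /= epq !(star_edge sy) ?inE ?eqxx ?orbT.
  - apply: (rest_bound IH) => //=; rewrite ind //=; have := dws _ yw; nlia.
  - apply: (rest_bound IH) => //=; rewrite !ind //=; have := dws _ cw; nlia.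
by rewrite /=; rewrite /= in ur; lra.
Qed.

End Branching.

(** * Shapes of small neighbourhoods *)

Fixpoint bit_seqs k : seq (seq bool) :=
  if k is k'.+1 then
    [seq true :: s | s <- bit_seqs k'] ++ [seq false :: s | s <- bit_seqs k']
  else [:: [::]].

Lemma mem_bit_seqs k s : size s = k -> s \in bit_seqs k.
Proof.
elim: k s => [|k IH] [|c s] //= [sk]; rewrite mem_cat.
by case: c; apply/orP; [left|right]; apply: map_f; apply: IH.
Qed.

Definition lt_pairs n : seq (nat * nat) :=
  [seq p <- [seq (i, j) | i <- iota 0 n, j <- iota 0 n] | p.1 < p.2].

Definition table_rel (ps : seq (nat * nat)) (bits : seq bool) (i j : nat) : bool :=
  if i < j then nth false bits (index (i, j) ps)
  else if j < i then nth false bits (index (j, i) ps) else false.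

Definition shape_check (shape : forall T : eqType, rel T -> seq T -> bool) n : bool :=
  let ps := lt_pairs n in
  let orders := permutations (iota 0 n) in
  all (fun bits =>
         let rows := mkseq (fun i => mkseq (table_rel ps bits i) n) n in
         has (shape _ (fun i j => nth false (nth [::] rows i) j)) orders)
      (bit_seqs (size ps)).

(** The adjacency bits of [ws] select one of the graphs tested exhaustively; naturality of the
    polymorphic [shape] carries the ordering found for indices back to vertices. *)
Lemma shape_checkP (shape : forall T : eqType, rel T -> seq T -> bool)
    (T : eqType) (e : rel T) (w0 : T) (ws : seq T) :
  symmetric e -> irreflexive e ->
  (forall (T U : eqType) (r : rel T) (r' : rel U) (f : T -> U) s,
     {in s &, forall x y, r x y = r' (f x) (f y)} ->
     shape T r s = shape U r' (map f s)) ->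
  shape_check shape (size ws) ->
  exists2 ws', perm_eq ws ws' & shape T e ws'.
Proof.
move=> es ei nat_shape.
set n := size ws => /allP chk.
pose bits := [seq e (nth w0 ws p.1) (nth w0 ws p.2) | p <- lt_pairs n].
have /chk/hasP[s ps sh] : bits \in bit_seqs (size (lt_pairs n)).
  by apply: mem_bit_seqs; rewrite size_map.
rewrite mem_permutations in ps.
have lookup i j : i < n -> j < n -> i < j ->
    nth false bits (index (i, j) (lt_pairs n)) = e (nth w0 ws i) (nth w0 ws j).
  move=> iN jN ij; have ijP : (i, j) \in lt_pairs n.
    by rewrite mem_filter ij; apply/allpairsP; exists (i, j); rewrite !mem_iota.
  by rewrite (nth_map (0, 0)) ?index_mem // nth_index.
exists (map (nth w0 ws) s).
  have := perm_map (nth w0 ws) ps; rewrite perm_sym => /(perm_trans _); apply.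
  by rewrite -/(mkseq _ n) mkseq_nth.
rewrite -(nat_shape _ _ (fun i j => nth false (nth [::]
  (mkseq (fun i => mkseq (table_rel (lt_pairs n) bits i) n) n) i) j)) // => i j.
rewrite !(perm_mem ps) !mem_iota /= !add0n => iN jN; rewrite !nth_mkseq // /table_rel.
case: ltngtP => [ij|ij|->]; first exact: lookup.
  by rewrite lookup // es.
by rewrite ei.
Qed.

(** Triangle; [c] isolated; path. *)
Definition shape3 (T : eqType) (r : rel T) (s : seq T) : bool :=
  if s is [:: a; b; c] then
    [|| [&& r a b, r b c & r a c],
        [&& ~~ r a c & ~~ r b c]
      | [&& r a b, r b c & ~~ r a c]]
  else false.

Lemma shape3_check : shape_check shape3 3.
Proof. by vm_compute. Qed.

(** A triangle, or a triangle-free graph: at most the edge [a b], a path on three vertices and a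
    point, a path, a 4-cycle, a perfect matching, a claw with centre [d]. *)
Definition shape4 (T : eqType) (r : rel T) (s : seq T) : bool :=
  if s is [:: a; b; c; d] then
    [|| [&& r a b, r b c & r a c],
        [&& ~~ r a c, ~~ r a d, ~~ r b c, ~~ r b d & ~~ r c d],
        [&& r a b, r b c, ~~ r a c, ~~ r a d, ~~ r b d & ~~ r c d],
        [&& r a b, r b c, r c d, ~~ r a c, ~~ r a d & ~~ r b d],
        [&& r a b, r b c, r c d, r a d, ~~ r a c & ~~ r b d],
        [&& r a b, r c d, ~~ r a c, ~~ r a d, ~~ r b c & ~~ r b d]
      | [&& r a d, r b d, r c d, ~~ r a b, ~~ r a c & ~~ r b c]]
  else false.

Lemma shape4_check : shape_check shape4 4.
Proof. by vm_compute. Qed.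

(** A triangle; the star with centre [f]; three independent neighbours of [f] and a non-neighbour;
    [f] isolated beside a subgraph of the 4-cycle a b c d; a subgraph of the path a b c d f; the
    pentagon. Some edges are left open, since the weights depend on non-edges. *)
Definition shape5 (T : eqType) (r : rel T) (s : seq T) : bool :=
  if s is [:: a; b; c; d; f] then
    [|| [&& r a b, r b c & r a c],
        [&& r a f, r b f, r c f, r d f, ~~ r a b, ~~ r a c, ~~ r a d, ~~ r b c,
            ~~ r b d & ~~ r c d],
        [&& r a f, r b f, r c f, ~~ r d f, ~~ r a b, ~~ r a c & ~~ r b c],
        [&& ~~ r a c, ~~ r b d, ~~ r a f, ~~ r b f, ~~ r c f & ~~ r d f],
        [&& ~~ r a c, ~~ r a f, ~~ r c f, ~~ r b f, ~~ r a d & ~~ r b d]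
      | [&& r a b, r b c, r c d, r d f, r a f, ~~ r a c, ~~ r a d, ~~ r b d,
            ~~ r b f & ~~ r c f]]
  else false.

Lemma shape5_check : shape_check shape5 5.
Proof. by vm_compute. Qed.

Lemma shape3_map (T U : eqType) (r : rel T) (r' : rel U) (f : T -> U) s :
  {in s &, forall x y, r x y = r' (f x) (f y)} -> shape3 r s = shape3 r' (map f s).
Proof.
case: s => [|a [|b [|c [|d s]]]] //= E.
by rewrite !E ?inE ?eqxx ?orbT.
Qed.

Lemma shape4_map (T U : eqType) (r : rel T) (r' : rel U) (f : T -> U) s :
  {in s &, forall x y, r x y = r' (f x) (f y)} -> shape4 r s = shape4 r' (map f s).
Proof.
case: s => [|a [|b [|c [|d [|x s]]]]] //= E.
by rewrite !E ?inE ?eqxx ?orbT.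
Qed.

Lemma shape5_map (T U : eqType) (r : rel T) (r' : rel U) (f : T -> U) s :
  {in s &, forall x y, r x y = r' (f x) (f y)} -> shape5 r s = shape5 r' (map f s).
Proof.
case: s => [|a [|b [|c [|d [|x [|y s]]]]]] //= E.
by rewrite !E ?inE ?eqxx ?orbT.
Qed.

(** * Complements without four pairwise adjacent vertices *)

Section K4Free.
Variables (V : finType) (e : rel V) (b : {set V} -> nat).
Hypothesis bb : branching e b.
Let e_sym := branching_sym bb.
Let e_irr := branching_irr bb.
Variables (A : {set V}) (M u : R).
Hypotheses (M0 : (0 <= M)%R) (u0 : (0 < u)%R) (u3 : (u ^ 3 = / 2)%R).
Hypothesis IH : forall (B : {set V}) k, B \subset A -> 0 < k -> #|B| + k <= #|A| ->
  (INR (b B) <= M * u ^ k)%R.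
Hypothesis KA : clique_free e 4 A.
Local Notation bounded := (INR (b A) <= M)%R.
Local Notation starA := (star e A).
Local Notation deg := (deg e A).

Lemma u_bounds : (7937/10000 < u < 7938/10000)%R.
Proof. by apply: (@pow_between 3); rewrite ?u3; lra. Qed.

(** Reducing every power to a multiple of 1, u or u^2 makes the comparisons of weights linear. *)
Lemma u_powers : [/\ u ^ 4 = u / 2, u ^ 5 = u ^ 2 / 2, u ^ 6 = / 4, u ^ 7 = u / 4
  & [/\ u ^ 8 = u ^ 2 / 4, u ^ 9 = / 8, u ^ 10 = u / 8
  & (6299/10000 < u ^ 2 < 6302/10000)]]%R.
Proof.
have E k : (u ^ (k + 3) = u ^ k / 2)%R by rewrite Rdef_pow_add u3.
have := E 1; have := E 2; have := E 3; have := E 4; have := E 5; have := E 6.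
have := E 7; rewrite u3 /= => ? ? ? ? ? ? ?; have := u_bounds.
by move=> [? ?]; do !split; nra.
Qed.

Lemma edge_neq x y : e x y -> x != y.
Proof. by apply: contraTneq => ->; rewrite e_irr. Qed.

Lemma K4_free x y z w : x \in A -> y \in A -> z \in A -> w \in A ->
  e x y -> e x z -> e x w -> e y z -> e y w -> e z w -> False.
Proof.
move=> xA yA zA wA xy xz xw yz yw zw; apply: (KA (ws := [:: x; y; z; w])) => //=.
  by move=> t; rewrite !inE => /or4P[]/eqP->.
by rewrite xy xz xw yz yw zw.
Qed.

Lemma star_triangle_free v ws x y z : starA v ws ->
  x \in ws -> y \in ws -> z \in ws -> e x y -> e y z -> e x z -> False.
Proof.
move=> st xs ys zs xy yz xz; have [vA _ _] := st.
apply: (@K4_free v x y z) => //; solve [exact: star_mem st _|exact: star_edge st _].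
Qed.

Ltac num := cbn [foldr]; have := u_bounds; have [? ? ? ? [? ? ? [? ?]]] := u_powers;
  have := u3; lra.

Ltac add_sym := repeat match goal with
  | H : is_true (e ?x ?y) |- _ => lazymatch goal with
      | _ : is_true (e y x) |- _ => fail
      | _ => have ? : e y x by rewrite e_sym
      end
  | H : is_true (~~ e ?x ?y) |- _ => lazymatch goal with
      | _ : is_true (~~ e y x) |- _ => fail
      | _ => have ? : ~~ e y x by rewrite e_sym
      end
  | H : is_true (?x != ?y) |- _ => lazymatch goal with
      | _ : is_true (y != x) |- _ => fail
      | _ => have ? : y != x by rewrite eq_sym
      end
  end.

Ltac bsimp := repeat match goal with
  | |- context [?x == ?x] => rewrite eqxx
  | H : is_true (~~ _) |- _ => rewrite (negbTE H)
  | H : is_true _ |- _ => rewrite H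
  end.

Lemma star3_facts v x y z : starA v [:: x; y; z] ->
  [/\ [/\ v \in A, x \in A, y \in A & z \in A], [/\ x != y, x != z & y != z],
      [/\ e v x, e v y & e v z] & [/\ v != x, v != y & v != z]].
Proof.
move=> st; have [vA + _] := st.
rewrite /= !inE negb_or andbT => /andP[/andP[xy xz] yz].
have vx : e v x by apply: star_edge st _; rewrite !inE eqxx ?orbT.
have vy : e v y by apply: star_edge st _; rewrite !inE eqxx ?orbT.
have vz : e v z by apply: star_edge st _; rewrite !inE eqxx ?orbT.
by split; split=> //; try exact: edge_neq; apply: star_mem st _;
  rewrite !inE eqxx ?orbT.
Qed.

(** [term] weighs a branch by the vertices it loses; [look y ls] adds two more factors [u] because
    [y] keeps at most one neighbour once [ls] is gone. *)
Ltac term := let U := fresh in let S := fresh in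
  move=> U S; apply: (rest_bound bb IH) => //; rewrite /=; clear U S; bsimp; nlia.

Ltac look y ls := let U := fresh in let S := fresh in
  move=> U S; apply: (deg1_rest_bound bb M0 u0 IH (y := y) (ls := ls) U S);
  clear U S;
  [ by rewrite ?inE; bsimp | by rewrite /= ?inE; bsimp
  | by apply/allP; rewrite /= ?inE; bsimp | by rewrite /=; nlia
  | by rewrite /=; bsimp; nlia ].

Ltac reorder st := apply: star_perm st; apply/permP => ? /=; nlia.

(** Deleting [x] and then branching at [z] strips [x] and [v] from [y], whose degree drops to at
    most one. *)
Lemma star3_edge v x y z : {in A, forall x, 3 <= deg x} ->
  starA v [:: x; y; z] -> e x y -> ~~ e x z -> ~~ e y z -> deg y <= 3 -> bounded.
Proof.
move=> dmin st xy xz yz dy; have [[vA xA yA zA] [? ? ?] [? ? ?] [? ? ?]] := star3_facts st.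
have {}st : starA v [:: x; z; y] by reorder st.
have [dx dy' dz] := And3 (dmin _ xA) (dmin _ yA) (dmin _ zA); add_sym.
apply: (star_final (rs := [:: u ^ 4; u ^ 7; u ^ 5]%R) bb M0 st); last by num.
by do !split; [term|look y [:: v; x]|term].
Qed.

(** With the middle vertex deleted first, the branch at [x] strips [y] and [v] from [z]. *)
Lemma star3_path v x y z : {in A, forall x, 3 <= deg x} ->
  starA v [:: x; y; z] -> e x y -> e y z -> ~~ e x z -> deg z <= 3 -> bounded.
Proof.
move=> dmin st xy yz xz dz; have [[vA xA yA zA] [? ? ?] [? ? ?] [? ? ?]] := star3_facts st.
have {}st : starA v [:: y; x; z] by reorder st.
have [dx dy dz'] := And3 (dmin _ xA) (dmin _ yA) (dmin _ zA); add_sym.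
apply: (star_final (rs := [:: u ^ 4; u ^ 6; u ^ 5]%R) bb M0 st); last by num.
by do !split; [term|look z [:: v; y]|term].
Qed.

(** Where the two preceding lemmas do not apply, both ends of the edge or path have degree at least
    4 and counting suffices. *)
Lemma min_deg3_bound v ws : {in A, forall x, 3 <= deg x} ->
  starA v ws -> size ws = 3 -> bounded.
Proof.
move=> dmin st sz.
have := shape3_check; rewrite -sz => /(shape_checkP v e_sym e_irr shape3_map)[ws' P sh].
have {}st := star_perm P st; move: sz sh; rewrite (perm_size P).
case: ws' {P} st => [|x [|y [|z [|? ?]]]] // st _.
have [[vA xA yA zA] [? ? ?] [? ? ?] [? ? ?]] := star3_facts st.
have [dx dy dz] := And3 (dmin _ xA) (dmin _ yA) (dmin _ zA).
case/or3P.
- case/and3P => xy yz xz; exfalso.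
  by apply: (star_triangle_free st _ _ _ xy yz xz); rewrite !inE eqxx ?orbT.
- case/andP => xz yz; have [xy|xy] := boolP (e x y); last first.
    add_sym; apply: (star_final (rs := [:: u ^ 4; u ^ 5; u ^ 6]%R) bb M0 st).
      by do !split; term.
    by num.
  have [dy3|dy4] := leqP (deg y) 3; first exact: star3_edge st xy xz yz dy3.
  have [dx3|dx4] := leqP (deg x) 3.
    have {}st : starA v [:: y; x; z] by reorder st.
    by rewrite e_sym in xy; apply: star3_edge st xy yz xz dx3.
  have {}st : starA v [:: x; z; y] by reorder st.
  add_sym; apply: (star_final (rs := [:: u ^ 5; u ^ 5; u ^ 6]%R) bb M0 st).
    by do !split; term.
  by num.
- case/and3P => xy yz xz.
  have [dz3|dz4] := leqP (deg z) 3; first exact: star3_path st xy yz xz dz3.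
  have [dx3|dx4] := leqP (deg x) 3.
    have {}st : starA v [:: z; y; x] by reorder st.
    by rewrite e_sym in xy; rewrite e_sym in yz; rewrite e_sym in xz;
       apply: star3_path st yz xy xz dx3.
  have {}st : starA v [:: x; z; y] by reorder st.
  add_sym; apply: (star_final (rs := [:: u ^ 5; u ^ 6; u ^ 4]%R) bb M0 st).
    by do !split; term.
  by num.
Qed.

Lemma star4_facts v x y z w : starA v [:: x; y; z; w] ->
  [/\ [/\ v \in A, x \in A, y \in A, z \in A & w \in A],
      [/\ x != y, x != z & x != w] /\ [/\ y != z, y != w & z != w],
      [/\ e v x, e v y, e v z & e v w] & [/\ v != x, v != y, v != z & v != w]].
Proof.
move=> st; have [vA + _] := st.
rewrite /= !inE !negb_or andbT -!andbA => /and5P[xy xz xw yz /andP[yw zw]].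
have vx : e v x by apply: star_edge st _; rewrite !inE eqxx ?orbT.
have vy : e v y by apply: star_edge st _; rewrite !inE eqxx ?orbT.
have vz : e v z by apply: star_edge st _; rewrite !inE eqxx ?orbT.
have vw : e v w by apply: star_edge st _; rewrite !inE eqxx ?orbT.
by split; split=> //; try exact: edge_neq; apply: star_mem st _;
  rewrite !inE eqxx ?orbT.
Qed.

(** * Minimum degree four, by the shape of the neighbourhood *)

Section MinDeg4.
Hypothesis dmin : {in A, forall x, 4 <= deg x}.

Ltac facts4 st := have [[? xA yA zA wA] [[? ? ?] [? ? ?]] [? ? ? ?] [? ? ? ?]] :=
  star4_facts st;
  have [dx dy dz dw] := And4 (dmin xA) (dmin yA) (dmin zA) (dmin wA).

Lemma star4_edge v x y z w : starA v [:: x; y; z; w] ->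
  ~~ e x z -> ~~ e x w -> ~~ e y z -> ~~ e y w -> ~~ e z w -> bounded.
Proof.
move=> st xz xw yz yw zw; facts4 st.
have {}st : starA v [:: x; z; w; y] by reorder st.
add_sym; apply: (star_final (rs := [:: u ^ 5; u ^ 6; u ^ 7; u ^ 7]%R) bb M0 st).
  by do !split; term.
by num.
Qed.

(** If [y] has degree 4, the branch at [w] has stripped it of [v], [x] and [z]; a larger degree of
    [y] pays by itself. *)
Lemma star4_path3 v x y z w : starA v [:: x; y; z; w] ->
  e x y -> e y z -> ~~ e x z -> ~~ e x w -> ~~ e y w -> ~~ e z w -> bounded.
Proof.
move=> st xy yz xz xw yw zw; facts4 st.
have {}st : starA v [:: x; z; w; y] by reorder st.
add_sym; have [dy4|dy5] := leqP (deg y) 4.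
  apply: (star_final (rs := [:: u ^ 5; u ^ 6; u ^ 9; u ^ 6]%R) bb M0 st).
    by do !split; [term|term|look y [:: v; x; z]|term].
  by num.
apply: (star_final (rs := [:: u ^ 5; u ^ 6; u ^ 7; u ^ 7]%R) bb M0 st).
  by do !split; term.
by num.
Qed.

Lemma star4_path4 v x y z w : starA v [:: x; y; z; w] ->
  e x y -> e y z -> e z w -> ~~ e x z -> ~~ e x w -> ~~ e y w -> bounded.
Proof.
have low v' x' y' z' w' : starA v' [:: x'; y'; z'; w'] -> e x' y' -> e y' z' -> e z' w' ->
    ~~ e x' z' -> ~~ e x' w' -> ~~ e y' w' -> deg y' <= 4 -> bounded.
  move=> {v x y z w} st xy yz zw xz xw yw dy4; facts4 st.
  have {}st : starA v' [:: x'; w'; y'; z'] by reorder st.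
  add_sym; apply: (star_final (rs := [:: u ^ 5; u ^ 8; u ^ 6; u ^ 6]%R) bb M0 st).
    by do !split; [term|look y' [:: v'; x'; z']|term|term].
  by num.
move=> st xy yz zw xz xw yw; facts4 st.
have [dy4|dy5] := leqP (deg y) 4; first exact: low st xy yz zw xz xw yw dy4.
have [dz4|dz5] := leqP (deg z) 4.
  have {}st : starA v [:: w; z; y; x] by reorder st.
  by apply: low st _ _ _ _ _ _ dz4; rewrite e_sym.
have {}st : starA v [:: x; w; y; z] by reorder st.
add_sym; apply: (star_final (rs := [:: u ^ 5; u ^ 6; u ^ 7; u ^ 7]%R) bb M0 st).
  by do !split; term.
by num.
Qed.

(** Each diagonal contributes u^6 + u^7: either an end of degree at most 4 is left with at most one
    neighbour by the branch at the other end, or both ends have degree at least 5. The symmetries of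
    the cycle reduce to [main]. *)
Lemma star4_cycle v x y z w : starA v [:: x; y; z; w] ->
  e x y -> e y z -> e z w -> e x w -> ~~ e x z -> ~~ e y w -> bounded.
Proof.
have main v' x' y' z' w' : starA v' [:: x'; y'; z'; w'] ->
    e x' y' -> e y' z' -> e z' w' -> e x' w' -> ~~ e x' z' -> ~~ e y' w' ->
    (deg z' <= 4) || ((4 < deg x') && (4 < deg z')) ->
    (deg w' <= 4) || ((4 < deg y') && (4 < deg w')) -> bounded.
  move=> {v x y z w} st xy yz zw xw xz yw; facts4 st.
  have {}st : starA v' [:: x'; z'; y'; w'] by reorder st.
  add_sym; case/orP=> [dz4|/andP[dx5 dz5]]; case/orP=> [dw4|/andP[dy5 dw5]].
  - apply: (star_final (rs := [:: u ^ 7; u ^ 6; u ^ 7; u ^ 6]%R) bb M0 st).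
      by do !split; [look z' [:: v'; y'; w']|term|look w' [:: v'; x'; z']|term].
    by num.
  - apply: (star_final (rs := [:: u ^ 7; u ^ 6; u ^ 6; u ^ 7]%R) bb M0 st).
      by do !split; [look z' [:: v'; y'; w']|term|term|term].
    by num.
  - apply: (star_final (rs := [:: u ^ 6; u ^ 7; u ^ 7; u ^ 6]%R) bb M0 st).
      by do !split; [term|term|look w' [:: v'; x'; z']|term].
    by num.
  - apply: (star_final (rs := [:: u ^ 6; u ^ 7; u ^ 6; u ^ 7]%R) bb M0 st).
      by do !split; term.
    by num.
move=> st xy yz zw xw xz yw.
wlog dz : x z st xy yz zw xw xz yw / (deg z <= 4) || ((4 < deg x) && (4 < deg z)).
  move=> W; have [|dz5] := boolP (deg z <= 4).
    by move=> ?; apply: (W x z) => //; apply/orP; left.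
  have [dx4|dx5] := boolP (deg x <= 4).
    apply: (W z x) => //; rewrite 1?e_sym //; last by rewrite dx4.
    by reorder st.
  by apply: (W x z) => //; rewrite !ltnNge dx5 dz5 orbT.
have [dw4|dw5] := boolP (deg w <= 4).
  by apply: main st xy yz zw xw xz yw dz _; rewrite dw4.
have [dy4|dy5] := boolP (deg y <= 4); last first.
  by apply: main st xy yz zw xw xz yw dz _; rewrite !ltnNge dy5 dw5 orbT.
have {}st : starA v [:: x; w; z; y] by reorder st.
by apply: main st _ _ _ _ _ _ dz _; rewrite ?dy4 // e_sym.
Qed.

(** With all degrees 4, the weights u^5 + 2 u^6 + u^7 are barely above 1. A fifth neighbour of [w],
    deleted last, turns u^7 into u^8. *)
Lemma star4_high v x y z w : starA v [:: x; y; z; w] ->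
  e x y -> e z w -> ~~ e x z -> ~~ e x w -> ~~ e y z -> ~~ e y w ->
  4 < deg w -> bounded.
Proof.
move=> st xy zw xz xw yz yw; facts4 st => dw5.
have {}st : starA v [:: x; z; y; w] by reorder st.
add_sym; apply: (star_final (rs := [:: u ^ 5; u ^ 6; u ^ 6; u ^ 8]%R) bb M0 st).
  by do !split; term.
by num.
Qed.

Lemma u234 : (u ^ 2 <= u ^ 3 + u ^ 4)%R.
Proof. by num. Qed.

Lemma deg_le_seq p ls : {in A, forall x, e p x -> x \in ls} -> deg p <= size ls.
Proof.
move=> sub; apply: leq_trans (card_size ls); apply/subset_leq_card/subsetP => x.
by rewrite inE => /andP[xA px]; apply: sub.
Qed.

Lemma deg_ge_seq p ls : uniq ls -> {in ls, forall x, (x \in A) && e p x} ->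
  size ls <= deg p.
Proof.
move=> U sub; rewrite -(card_uniqP U); apply/subset_leq_card/subsetP => x /sub.
by rewrite inE.
Qed.

Lemma star_extend p ks : p \in A -> uniq ks -> {in ks, forall x, (x \in A) && e p x} ->
  exists2 ls, starA p (ks ++ ls) & size ls = deg p - size ks.
Proof.
move=> pA U sub; pose ls := enum [set x in A | e p x && (x \notin ks)].
have st : starA p (ks ++ ls).
  split=> // [|x].
    rewrite cat_uniq U enum_uniq andbT /=; apply/hasPn => x.
    by rewrite mem_enum inE => /and3P[].
  rewrite mem_cat mem_enum inE; have := sub x.
  by case: (x \in ks) => [/(_ isT)->|_] //=; rewrite andbT.
by exists ls => //; rewrite (star_deg st) size_cat addKn.
Qed.

(* Deleting [x] and the closed neighbourhood of [z] leaves [y] with two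
   neighbours; unless these form a triangle component with [y] the branch
   gains enough. *)
Lemma star4_matching_triangle v x y z w : starA v [:: x; y; z; w] ->
  e x y -> e z w -> ~~ e x z -> ~~ e x w -> ~~ e y z -> ~~ e y w -> deg y <= 4 ->
  bounded \/ exists p q,
    [/\ starA y [:: v; x; p; q], e p q, ~~ e z p /\ ~~ e z q,
        {in A, forall t, e p t -> (t \in [:: y; q; x]) || e z t}
      & {in A, forall t, e q t -> (t \in [:: y; p; x]) || e z t}].
Proof.
move=> st xy zw xz xw yz yw dy4; facts4 st.
have {}st : starA v [:: x; z; y; w] by reorder st.
add_sym.
have U : uniq [:: z; x] by rewrite /= inE; bsimp.
have S : {subset [:: z; x] <= A} by apply/allP; rewrite /=; bsimp.
have := @deg2_rest_bound _ _ _ bb A M u M0 u0 IH [:: x] z y [:: v; x] 5 u234 U S.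
case=> [||||||].
- by rewrite ?inE; bsimp.
- by rewrite /= ?inE; bsimp.
- by apply/allP; rewrite /= ?inE; bsimp.
- by rewrite /=; nlia.
- by rewrite /=; bsimp; nlia.
- move=> bnd; left.
  apply: (star_final (rs := [:: u ^ 5; u ^ 6 * (u ^ 3 + u ^ 4); u ^ 6; u ^ 7]%R) bb M0 st).
    by do !split=> //; term.
  rewrite (_ : u ^ 6 * (u ^ 3 + u ^ 4) = u ^ 9 + u ^ 10)%R; first by num.
  by ring.
case=> p [q [sy pq sp sq]]; right; exists p, q.
have memB t : t \in rest e A [:: x] z -> [/\ t \in A, t != x, t != z & ~~ e z t].
  by rewrite inE => /and4P[tA]; rewrite inE.
have [pm qm] : p \in [:: p; q] /\ q \in [:: p; q] by rewrite !inE !eqxx orbT.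
have [pA px pz zp] := memB _ (star_mem sy pm).
have [qA qx qz zq] := memB _ (star_mem sy qm).
have [yp yq] := (star_edge sy pm, star_edge sy qm).
have nbr c d t : star e (rest e A [:: x] z) c [:: y; d] -> ~~ e z c -> t \in A ->
    e c t -> (t \in [:: y; d; x]) || e z t.
  move=> [_ _ E] zc tA ct; have := E t; rewrite ct andbT !inE tA /=.
  have -> : (t != z) by apply: contraNneq zc => <-; rewrite e_sym.
  by case: (t == y); case: (t == d); case: (t == x); case: (e z t).
split=> //; last 2 first.
- by move=> t; apply: nbr.
- by move=> t; apply: nbr.
have vp : v != p by apply: contraNneq zp => <-.
have vq : v != q by apply: contraNneq zq => <-.
have pq' := edge_neq pq; add_sym.
apply: star_intro => //; first by rewrite /= !inE; bsimp.
by apply/allP; rewrite /=; bsimp.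
Qed.

(** By [star4_high] all four neighbours have degree 4. Let [p], [q] be the further neighbours of
    [y], and [r], [s] those of [z]; both pairs are edges. The triangle component confines the
    neighbours of [p] to [y], [q], [x] and the neighbours of [z]; [v], [w] and [x] being excluded,
    degree 4 forces [r] and [s], and likewise for [q]. Then [p], [q], [r], [s] form a K_4. *)
Lemma star4_matching v x y z w : starA v [:: x; y; z; w] ->
  e x y -> e z w -> ~~ e x z -> ~~ e x w -> ~~ e y z -> ~~ e y w -> bounded.
Proof.
move=> st xy zw xz xw yz yw; facts4 st.
have st1 : starA v [:: x; y; w; z] by reorder st.
have st2 : starA v [:: z; w; x; y] by reorder st.
have st3 : starA v [:: z; w; y; x] by reorder st.
have st4 : starA v [:: w; z; x; y] by reorder st.
have [wz yx] : e w z /\ e y x by rewrite ![e _ z]e_sym ![e _ x]e_sym.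
have [zx wx zy wy] : [/\ ~~ e z x, ~~ e w x, ~~ e z y & ~~ e w y].
  by rewrite ![e _ x]e_sym ![e _ y]e_sym.
have [dw4|dw5] := leqP (deg w) 4; last exact: (star4_high st).
have [dz4|dz5] := leqP (deg z) 4; last exact: (star4_high st1).
have [dy4|dy5] := leqP (deg y) 4; last exact: (star4_high st2).
have [dx4|dx5] := leqP (deg x) 4; last exact: (star4_high st3).
have [//|[p [q [sy pq [zp zq] Np Nq]]]] :=
  star4_matching_triangle st xy zw xz xw yz yw dy4.
have [//|[p' [q' [sy' _ [wp' wq'] _ _]]]] :=
  star4_matching_triangle st1 xy wz xw xz yw yz dy4.
have [//|[r [s [sz rs _ _ _]]]] :=
  star4_matching_triangle st4 wz xy wx wy zx zy dz4.
have [[_ _ _ pA qA] [[_ vp vq] [xp xq _]] [yv _ yp yq] _] := star4_facts sy.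
have [[_ _ _ rA sA] [[_ vr vs] [wr ws _]] [zv _ zr zs] _] := star4_facts sz.
have nv t : t \in A -> e y t -> x != t -> ~~ e v t.
  move=> tA yt xt; apply/negP => vt; have [_ _ S] := st.
  have := S t; rewrite tA vt !inE eq_sym (negbTE xt) /=.
  case/or3P => /eqP tE; move: yt; rewrite tE ?e_irr ?(negbTE yz) ?(negbTE yw) //.
have nw t : t \in A -> e y t -> v != t -> x != t -> ~~ e w t.
  move=> tA yt vt xt; have [_ _ S] := sy'.
  have := S t; rewrite tA yt !inE ![t == _]eq_sym (negbTE vt) (negbTE xt) /=.
  by case/orP => /eqP<-.
have [vp' vq'] : ~~ e v p /\ ~~ e v q by split; apply: nv.
have [wp wq] : ~~ e w p /\ ~~ e w q by split; apply: nw.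
(* If [x] sees [p], the neighbourhood of [y] is the path v, x, p, q, a shape already settled. *)
have [xp'|xp'] := boolP (e x p).
  apply: (star4_path4 sy) => //; apply/negP => xq'.
  by apply: (star_triangle_free sy _ _ _ xp' pq xq'); rewrite !inE eqxx ?orbT.
have [xq'|xq'] := boolP (e x q).
  have {}sy : starA y [:: v; x; q; p] by reorder sy.
  by apply: (star4_path4 sy) => //; rewrite e_sym.
have full c d : c \in A -> ~~ e v c -> ~~ e w c -> ~~ e x c ->
    {in A, forall t, e c t -> (t \in [:: y; d; x]) || e z t} -> e c r /\ e c s.
  move=> cA vc wc xc Nc; have [_ _ S] := sz.
  have {Nc}Nc t : t \in A -> e c t -> t \in [:: y; d; r; s].
    move=> tA ct; have := Nc t tA ct; have := S t; rewrite tA !inE.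
    have [tE|_] := eqVneq t v; first by rewrite tE e_sym (negbTE vc) in ct.
    have [tE|_] := eqVneq t w; first by rewrite tE e_sym (negbTE wc) in ct.
    have [tE|_] := eqVneq t x; first by rewrite tE e_sym (negbTE xc) in ct.
    by rewrite orbF /= => <-; rewrite -!orbA.
  have dc := dmin cA.
  split; apply: contraTT dc => cr; rewrite -ltnNge ltnS.
    apply: (@deg_le_seq c [:: y; d; s]) => t tA ct; have := Nc t tA ct.
    by rewrite !inE; case: (eqVneq t r) => [tr|_] //; rewrite -tr ct in cr.
  apply: (@deg_le_seq c [:: y; d; r]) => t tA ct; have := Nc t tA ct.
  by rewrite !inE; case: (eqVneq t s) => [tr|_]; rewrite ?orbF // -tr ct in cr *.
have [pr ps] := full p q pA vp' wp xp' Np.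
have [qr qs] := full q p qA vq' wq xq' Nq.
by case: (@K4_free p q r s).
Qed.

(** A centre of degree 6, or three leaves of degree 5, pay by themselves. Otherwise the argument
    moves to a leaf of degree 4: its two new neighbours do not see [v] and cannot both see the
    centre, whose degree would be 6, so its neighbourhood has a shape already settled. *)
Lemma star4_claw v x y z c : starA v [:: x; y; z; c] ->
  e x c -> e y c -> e z c -> ~~ e x y -> ~~ e x z -> ~~ e y z -> bounded.
Proof.
have rebase v' x' y' z' c' : starA v' [:: x'; y'; z'; c'] -> e x' c' -> e y' c' ->
    e z' c' -> ~~ e x' y' -> ~~ e x' z' -> ~~ e y' z' ->
    deg x' <= 4 -> deg c' <= 5 -> bounded.
  move=> {v x y z c} st xc yc zc xy xz yz dx4 dc5; facts4 st.
  have [_ _ S] := st.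
  have [a [d sx]] : exists a d, starA x' [:: v'; c'; a; d].
    have := @star_extend x' [:: v'; c'] xA; case=> [||ls sx].
    - by rewrite /= inE; bsimp.
    - by apply/allP; add_sym; rewrite /=; bsimp.
    have -> : deg x' - size [:: v'; c'] = 2 by rewrite /=; nlia.
    by case: ls sx => [|a [|d [|? ?]]] // sx _; exists a, d.
  have [[_ _ _ aA dA] [[_ va vd] [ca cd ad]] [xv _ xa xd] _] := star4_facts sx.
  have nv t : t \in A -> e x' t -> c' != t -> ~~ e v' t.
    move=> tA xt ct; apply/negP => vt; have := S t; rewrite tA vt !inE.
    rewrite [t == c']eq_sym (negbTE ct) orbF.
    by case/or3P => /eqP tE; move: xt; rewrite tE ?e_irr ?(negbTE xy) ?(negbTE xz).
  have [va' vd'] : ~~ e v' a /\ ~~ e v' d by split; apply: nv.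
  have cad : ~~ (e c' a && e c' d).
    apply/negP => /andP[ca' cd'].
    suff : 6 <= deg c' by nlia.
    have na t : t \in A -> ~~ e v' t -> e x' t -> [&& t != x', t != y' & t != z'].
      move=> tA vt xt; rewrite -!negb_or; apply/negP => tE; move: vt xt.
      by case/or3P: tE => /eqP->; rewrite ?e_irr ?(negbTE xy) ?(negbTE xz).
    have /and3P[? ? ?] := na a aA va' xa; have /and3P[? ? ?] := na d dA vd' xd.
    apply: (@deg_ge_seq c' [:: v'; x'; y'; z'; a; d]); add_sym.
      by rewrite /= !inE; bsimp.
    by apply/allP; rewrite /=; bsimp.
  have [ca'|ca'] := boolP (e c' a).
    have cd' : ~~ e c' d by rewrite ca' in cad.
    have [ad'|ad'] := boolP (e a d); first exact: (star4_path4 sx).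
    exact: (star4_path3 sx).
  have [cd'|cd'] := boolP (e c' d).
    have {}sx : starA x' [:: v'; c'; d; a] by reorder sx.
    have [ad'|ad'] := boolP (e d a); first exact: (star4_path4 sx).
    exact: (star4_path3 sx).
  have [ad'|ad'] := boolP (e a d); first exact: (star4_matching sx).
  exact: (star4_edge sx).
move=> st xc yc zc xy xz yz; facts4 st.
have [dc5|dc6] := leqP (deg c) 5; last first.
  add_sym; apply: (star_final (rs := [:: u ^ 5; u ^ 6; u ^ 7; u ^ 7]%R) bb M0 st).
    by do !split; term.
  by num.
have [dx4|dx5] := leqP (deg x) 4; first exact: rebase st xc yc zc xy xz yz dx4 dc5.
have [dy4|dy5] := leqP (deg y) 4.
  have {}st : starA v [:: y; x; z; c] by reorder st.
  by apply: (rebase _ _ _ _ _ st) => //; rewrite e_sym.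
have [dz4|dz5] := leqP (deg z) 4.
  have {}st : starA v [:: z; x; y; c] by reorder st.
  by apply: (rebase _ _ _ _ _ st) => //; rewrite e_sym.
add_sym; apply: (star_final (rs := [:: u ^ 6; u ^ 7; u ^ 8; u ^ 5]%R) bb M0 st).
  by do !split; term.
by num.
Qed.

Lemma min_deg4_bound v ws : starA v ws -> size ws = 4 -> bounded.
Proof.
move=> st sz.
have := shape4_check; rewrite -sz => /(shape_checkP v e_sym e_irr shape4_map)[ws' P sh].
have {}st := star_perm P st; move: sz sh; rewrite (perm_size P).
case: ws' {P} st => [|x [|y [|z [|w [|? ?]]]]] // st _.
case/or4P => [/and3P[xy yz xz]|/and5P[*]|/and5P[xy yz xz xw /andP[yw zw]]|].
- by case: (star_triangle_free st _ _ _ xy yz xz); rewrite !inE eqxx ?orbT.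
- exact: (star4_edge st).
- exact: (star4_path3 st).
case/or4P => /and5P[? ? ? ? /andP[? ?]].
- exact: (star4_path4 st).
- exact: (star4_cycle st).
- exact: (star4_matching st).
- exact: (star4_claw st).
Qed.

End MinDeg4.

Lemma star5_facts v x y z w t : starA v [:: x; y; z; w; t] ->
  [/\ [/\ v \in A, x \in A, y \in A, z \in A & w \in A] /\ t \in A,
      [/\ x != y, x != z, x != w, x != t & y != z]
        /\ [/\ y != w, y != t, z != w, z != t & w != t],
      [/\ e v x, e v y, e v z, e v w & e v t]
    & [/\ v != x, v != y, v != z, v != w & v != t]].
Proof.
move=> st; have [vA + _] := st.
rewrite /= !inE !negb_or andbT -!andbA.
case/and5P=> xy xz xw xt /and5P[yz yw yt zw /andP[zt wt]].
have vx : e v x by apply: star_edge st _; rewrite !inE eqxx ?orbT.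
have vy : e v y by apply: star_edge st _; rewrite !inE eqxx ?orbT.
have vz : e v z by apply: star_edge st _; rewrite !inE eqxx ?orbT.
have vw : e v w by apply: star_edge st _; rewrite !inE eqxx ?orbT.
have vt : e v t by apply: star_edge st _; rewrite !inE eqxx ?orbT.
by split; repeat split=> //; try exact: edge_neq; apply: star_mem st _;
  rewrite !inE eqxx ?orbT.
Qed.

(** * The 5-regular case *)

Section Regular5.
Hypothesis dreg : {in A, forall x, deg x = 5}.

Ltac facts5 st := have [[[vA xA yA zA wA] tA] [[? ? ? ? ?] [? ? ? ? ?]]
    [? ? ? ? ?] [? ? ? ? ?]] := star5_facts st;
  have [dx dy dz dw dt] := And5 (dreg xA) (dreg yA) (dreg zA) (dreg wA) (dreg tA).

Lemma star5_claw v x y z w t : starA v [:: x; y; z; w; t] ->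
  ~~ e x y -> ~~ e x z -> ~~ e x w -> ~~ e y z -> ~~ e y w -> ~~ e z w -> bounded.
Proof.
move=> st *; facts5 st; add_sym.
apply: (star_final (rs := [:: u ^ 6; u ^ 7; u ^ 8; u ^ 9; u ^ 6]%R) bb M0 st).
  by do !split; term.
by num.
Qed.

(** The branch at [w], after the deletion of [x], [y], [z], also loses [v], so [t] keeps at most one
    of its five neighbours. *)
Lemma star5_deg3 v x y z w t : starA v [:: x; y; z; w; t] ->
  e x t -> e y t -> e z t -> ~~ e w t -> ~~ e x y -> ~~ e x z -> ~~ e y z -> bounded.
Proof.
move=> st *; facts5 st; add_sym.
apply: (star_final (rs := [:: u ^ 6; u ^ 7; u ^ 8; u ^ 8; u ^ 7]%R) bb M0 st).
  by do !split; [term|term|term|look t [:: v; x; y; z]|term].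
by num.
Qed.

Lemma star5_isolated v x y z w t : starA v [:: x; y; z; w; t] ->
  ~~ e x z -> ~~ e y w -> ~~ e x t -> ~~ e y t -> ~~ e z t -> ~~ e w t -> bounded.
Proof.
move=> st *; facts5 st.
have {}st : starA v [:: x; z; y; w; t] by reorder st.
add_sym; apply: (star_final (rs := [:: u ^ 6; u ^ 7; u ^ 6; u ^ 7; u ^ 10]%R) bb M0 st).
  by do !split; term.
by num.
Qed.

Lemma star5_path v x y z w t : starA v [:: x; y; z; w; t] ->
  ~~ e x z -> ~~ e x t -> ~~ e z t -> ~~ e y t -> ~~ e x w -> ~~ e y w -> bounded.
Proof.
move=> st *; facts5 st.
have {}st : starA v [:: x; z; t; y; w] by reorder st.
add_sym; apply: (star_final (rs := [:: u ^ 6; u ^ 7; u ^ 8; u ^ 7; u ^ 8]%R) bb M0 st).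
  by do !split; term.
by num.
Qed.

Definition pentagon v x y z w t := starA v [:: x; y; z; w; t] /\
  [/\ e x y, e y z, e z w, e w t & e x t] /\
  [/\ ~~ e x z, ~~ e x w, ~~ e y w, ~~ e y t & ~~ e z t].

Lemma star5_pentagon v ws : starA v ws -> size ws = 5 ->
  bounded \/ exists x y z w t, pentagon v x y z w t.
Proof.
move=> st sz.
have := shape5_check; rewrite -sz => /(shape_checkP v e_sym e_irr shape5_map)[ws' P sh].
have {}st := star_perm P st; move: sz sh; rewrite (perm_size P).
case: ws' {P} st => [|x [|y [|z [|w [|t [|? ?]]]]]] // st _.
case/or4P => [/and3P[xy yz xz]|/and5P[? ? ? ? /and5P[? ? ? ? /andP[? ?]]]
             |/and5P[? ? ? ? /and3P[? ? ?]]|].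
- by case: (star_triangle_free st _ _ _ xy yz xz); rewrite !inE eqxx ?orbT.
- by left; apply: (star5_claw st).
- by left; apply: (star5_deg3 st).
case/or3P => /and5P[? ? ? ?].
- by case/andP=> ? ?; left; apply: (star5_isolated st).
- by case/andP=> ? ?; left; apply: (star5_path st).
- case/andP=> ? /and5P[? ? ? ? ?]; right; exists x, y, z, w, t.
  by split.
Qed.

(** Deleting [x] and branching at [z] strips [v], [x] and [w] from [t]. As for the matching, either
    the two remaining neighbours improve the weight enough, or they form a triangle component with
    [t]. *)
Lemma pentagon_triangle v x y z w t : pentagon v x y z w t ->
  bounded \/ exists p q,
    [/\ starA t [:: v; x; w; p; q], e p q, ~~ e z p /\ ~~ e z q,
        {in A, forall s, e p s -> (s \in [:: t; q; x]) || e z s}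
      & {in A, forall s, e q s -> (s \in [:: t; p; x]) || e z s}].
Proof.
move=> [st [[xy yz zw wt xt] [xz xw yw yt zt]]]; facts5 st.
have {}st : starA v [:: x; z; w; y; t] by reorder st.
add_sym.
have U : uniq [:: z; x] by rewrite /= inE; bsimp.
have S : {subset [:: z; x] <= A} by apply/allP; rewrite /=; bsimp.
have := @deg2_rest_bound _ _ _ bb A M u M0 u0 IH [:: x] z t [:: v; x; w] 6 u234 U S.
case=> [||||||].
- by rewrite ?inE; bsimp.
- by rewrite /= ?inE; bsimp.
- by apply/allP; rewrite /= ?inE; bsimp.
- by rewrite /=; nlia.
- by rewrite /=; bsimp; nlia.
- move=> bnd; left.
  apply: (star_final (rs := [:: u ^ 6; u ^ 7 * (u ^ 3 + u ^ 4); u ^ 7; u ^ 7; u ^ 8]%R) bb M0 st).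
    by do !split=> //; term.
  rewrite (_ : u ^ 7 * (u ^ 3 + u ^ 4) = u ^ 10 + u ^ 8 * u ^ 3)%R; last by ring.
  by rewrite u3; num.
case=> p [q [sy pq sp sq]]; right; exists p, q.
have memB s : s \in rest e A [:: x] z -> [/\ s \in A, s != x, s != z & ~~ e z s].
  by rewrite inE => /and4P[sA]; rewrite inE.
have [pm qm] : p \in [:: p; q] /\ q \in [:: p; q] by rewrite !inE !eqxx orbT.
have [pA px pz zp] := memB _ (star_mem sy pm).
have [qA qx qz zq] := memB _ (star_mem sy qm).
have [yp yq] := (star_edge sy pm, star_edge sy qm).
have nbr c d s : star e (rest e A [:: x] z) c [:: t; d] -> ~~ e z c -> s \in A ->
    e c s -> (s \in [:: t; d; x]) || e z s.
  move=> [_ _ E] zc sA cs; have := E s; rewrite cs andbT !inE sA /=.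
  have -> : (s != z) by apply: contraNneq zc => <-; rewrite e_sym.
  by case: (s == t); case: (s == d); case: (s == x); case: (e z s).
split=> //; last 2 first.
- by move=> s; apply: nbr.
- by move=> s; apply: nbr.
have vp : v != p by apply: contraNneq zp => <-.
have vq : v != q by apply: contraNneq zq => <-.
have wp : w != p by apply: contraNneq zp => <-.
have wq : w != q by apply: contraNneq zq => <-.
have pq' := edge_neq pq; add_sym.
apply: star_intro => //; [by rewrite /= !inE; bsimp | | by rewrite dt].
by apply/allP; rewrite /=; bsimp.
Qed.

(** Every vertex of a pentagon has two neighbours on it, so an edge at [v] lies in only two
    triangles. *)
Lemma pentagon_common v x y z w t s : pentagon v x y z w t -> s \in A -> e v s ->
  exists i j, {in A, forall r, e v r -> e s r -> r \in [:: i; j]}.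
Proof.
move=> [[_ _ S] [[xy yz zw wt xt] [xz xw yw yt zt]]] sA vs.
have {}S r : r \in A -> e v r -> r \in [:: x; y; z; w; t] by rewrite S => -> ->.
suff [i [j H]] : exists i j, forall r, r \in [:: x; y; z; w; t] -> e s r ->
    r \in [:: i; j].
  by exists i, j => r rA vr; apply: H; apply: S.
have split5 r : r \in [:: x; y; z; w; t] -> [\/ r = x, r = y, r = z | r = w \/ r = t].
  rewrite !inE => /or4P[/eqP|/eqP|/eqP|/orP[/eqP|/eqP]];
    by [constructor 1|constructor 2|constructor 3|constructor 4; left|constructor 4; right].
add_sym; case: (split5 s (S s sA vs)) => [->|->|->|[->|->]];
  [exists y, t|exists x, z|exists y, w|exists z, t|exists x, w] => r /split5;
  by case=> [->|->|->|[->|->]]; rewrite ?e_irr ?inE; bsimp; rewrite ?orbT.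
Qed.

(** Let [p], [q] be the neighbours of [t] beyond [v], [x], [w]. The triangle lemma, applied to the
    pentagon and to its mirror image fixing [t], puts every neighbour of [p] other than [t], [q],
    [x], [w] among the common neighbours of [y] and [z]. There are at most two, one being [v], which
    [p] does not see; so degree 5 makes [p] adjacent to [x]. The same holds for [q], and [t], [x],
    [p], [q] form a K_4. *)
Lemma regular5_bound : A != set0 -> bounded.
Proof.
case/set0Pn => v vA.
have pent s : s \in A -> bounded \/ exists x y z w t, pentagon s x y z w t.
  move=> sA; have st := star_enum e sA; apply: (star5_pentagon st).
  by rewrite -(star_deg st) dreg.
have [//|[x [y [z [w [t P]]]]]] := pent v vA.
have [st [[xy yz zw wt xt] [xz xw yw yt zt]]] := P.
have P' : pentagon v w z y x t.
  by split; [reorder st|do !split; rewrite // e_sym].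
have [//|[p [q [sp pq [zp zq] Np Nq]]]] := pentagon_triangle P.
have [//|[p' [q' [sp' _ [yp' yq'] Np' Nq']]]] := pentagon_triangle P'.
have [[[_ xA yA zA wA] tA] _ [vx vy vz vw vt] _] := star5_facts st.
have [[_ qA] [[vx' vw' vp vq xw'] [xp xq wp wq pq']] [tv tx tw tp tq] _] := star5_facts sp.
have pA : p \in A by apply: star_mem sp _; rewrite !inE eqxx !orbT.
have [_ _ S'] := sp'; have [_ _ S] := st.
have [N2p N2q] : {in A, forall s, e p s -> (s \in [:: t; q; w]) || e y s} /\
    {in A, forall s, e q s -> (s \in [:: t; p; w]) || e y s}.
  have := S' p; rewrite pA tp !inE ![p == _]eq_sym (negbTE vp) (negbTE wp) (negbTE xp) /=.
  have := S' q; rewrite qA tq !inE ![q == _]eq_sym (negbTE vq) (negbTE wq) (negbTE xq) /=.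
  move=> /orP[]/eqP q'E /orP[]/eqP p'E.
  - by move: pq'; rewrite -p'E -q'E eqxx.
  - by rewrite -p'E -q'E in Np' Nq' *.
  - by rewrite -p'E -q'E in Np' Nq' *.
  - by move: pq'; rewrite -p'E -q'E eqxx.
have nv c : c \in A -> x != c -> w != c -> e t c -> ~~ e c v.
  move=> cA xc wc tc; apply/negP => cv; have := S c; rewrite cA e_sym cv !inE.
  rewrite ![c == _]eq_sym (negbTE xc) (negbTE wc) /=.
  case/or3P => /eqP cE; move: tc; rewrite -cE ?e_irr //.
    by rewrite e_sym (negbTE yt).
  by rewrite e_sym (negbTE zt).
have [//|[a1 [a2 [a3 [a4 [a5 Py]]]]]] := pent y yA.
have [i [j common]] := pentagon_common Py zA yz.
have [s0 {}common] : exists s0, {in A, forall r, e y r -> e z r -> r \in [:: v; s0]}.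
  have := common v vA; rewrite ![e _ v]e_sym vy vz !inE => /(_ isT isT).
  case/orP=> /eqP vE; [exists j|exists i] => r rA yr zr;
    by have := common r rA yr zr; rewrite !inE vE // orbC.
have adj c d : c \in A -> ~~ e c v ->
    {in A, forall s, e c s -> (s \in [:: t; d; x]) || e z s} ->
    {in A, forall s, e c s -> (s \in [:: t; d; w]) || e y s} -> e c x.
  move=> cA cv N1 N2; apply: contraT => cx.
  suff : deg c <= 4 by rewrite dreg.
  apply: (@deg_le_seq c [:: t; d; w; s0]) => s sA cs.
  have := N1 s sA cs; have := N2 s sA cs; rewrite !inE.
  have [//|_] := eqVneq s t; have [//|_] := eqVneq s d; have [//|_] := eqVneq s w.
  have [sx|_] := eqVneq s x; first by rewrite -sx cs in cx.
  move=> /= ys zs; have := common s sA ys zs; rewrite !inE => /orP[/eqP sv|//].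
  by rewrite -sv cs in cv.
have px := adj p q pA (nv p pA xp wp tp) Np N2p.
have qx := adj q p qA (nv q qA xq wq tq) Nq N2q.
rewrite e_sym in px; rewrite e_sym in qx.
by case: (star_triangle_free sp _ _ _ px pq qx); rewrite !inE eqxx ?orbT.
Qed.

End Regular5.
End K4Free.

Lemma b_le_2 (V : finType) (e : rel V) (b : {set V} -> nat) (t : R) :
  branching e b -> (1 <= t)%R -> (t ^ 3 = 2)%R ->
  forall A, clique_free e 4 A -> (INR (b A) <= t ^ #|A|)%R.
Proof.
move=> bb t1 t3; apply: (branching_ind bb) => // [A B|A KA A0 IH].
  exact: clique_freeS.
have t0 : (0 <= t ^ #|A|)%R by apply: pow_le; lra.
set u := (/ t)%R in IH *.
have u0 : (0 < u)%R by apply: Rinv_0_lt_compat; lra.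
have u3 : (u ^ 3 = / 2)%R by rewrite /u pow_inv t3.
have [ulo uhi] := u_bounds u0 u3.
have upow n := pow_incr u (7938/10000) n (conj (Rlt_le _ _ u0) (Rlt_le _ _ uhi)).
(* u + u^7 < 1 disposes of degree 6, so minimum degree 5 means 5-regular. *)
have [/exists_inP[w wA dw]|/exists_inPn small] := boolP [exists w in A, 6 <= deg e A w].
  by apply: (high_deg_bound bb t0 IH wA dw); have := upow 7; lra.
have [v [ws [st dmin]]] := min_degP e A0.
have sz : size ws <= 5.
  by rewrite -(star_deg st) -ltnS ltnNge; apply: small; case: st.
have [d3|d3] := eqVneq (size ws) 3.
  by rewrite d3 in dmin; exact: (min_deg3_bound bb t0 u0 u3 IH KA dmin st d3).
have [d4|d4] := eqVneq (size ws) 4.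
  by rewrite d4 in dmin; exact: (min_deg4_bound bb t0 u0 u3 IH KA dmin st d4).
have [d5|d5] := eqVneq (size ws) 5.
  apply: (regular5_bound bb t0 u0 u3 IH KA) => // x xA.
  by apply/eqP; rewrite eqn_leq -{2}d5 dmin // andbT -ltnS ltnNge small.
apply: (star_base_bound bb t0 IH st dmin); have := upow 2.
case: ws {st dmin} sz d3 d4 d5 => [|? [|? [|? [|? [|? [|//]]]]]] // _ _ _ _;
  rewrite [INR _]INR_IZR_INZ /=; rewrite /= in u3; lra.
Qed.

(** * Forbidden induced subgraphs *)

Definition edgeless i : graph i := [ffun => false].

Definition coedge m (G : graph m) : rel 'I_m := fun x y => (x != y) && ~~ G (x, y).

Lemma coedge_sym m (G : graph m) : simple_graph G -> symmetric (coedge G).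
Proof. by move=> sG x y; rewrite /coedge eq_sym (graphC sG). Qed.

Lemma coedge_irr m (G : graph m) : irreflexive (coedge G).
Proof. by move=> x; rewrite /coedge eqxx. Qed.

Lemma betti_branching (K : fieldType) m (G : graph m) :
  simple_graph G -> branching (coedge G) (betti K G).
Proof.
move=> sG; split.
- exact: coedge_sym.
- exact: coedge_irr.
- move=> A w wA; apply: leq_trans (betti_branch K sG wA) _; rewrite leq_add2l.
  rewrite (_ : [set x in A | G (w, x)] = [set x in A | (x != w) && ~~ coedge G w x]) //.
  apply/setP => x; rewrite !inE /coedge [w == x]eq_sym.
  by have [->|_] := eqVneq x w; rewrite ?(graphxx sG) //= negbK.
- move=> A v vA iso; apply: (betti_cone K sG vA) => x xA xv.
  by have := iso x xA; rewrite /coedge eq_sym xv /= negbK.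
- by rewrite betti_set0.
Qed.

(** * Elementary properties of b_H *)

Section BH.
Variables (K : fieldType) (k : nat) (H : graph k).

Lemma bH_ind (P : nat -> Prop) n : P 0 ->
  (forall m (G : graph m), m <= n -> simple_graph G -> ~~ has_induced H G ->
     P (betti_sum K G)) -> P (bH K H n).
Proof.
move=> P0 PG; have Pmax a c : P a -> P c -> P (maxn a c).
  by move=> Pa Pc; rewrite /maxn; case: ifP.
apply: big_ind => // m _; apply: big_ind => // G /andP[sG nH].
by apply: PG; rewrite // -ltnS.
Qed.

Lemma bH_ge m n (G : graph m) : m <= n -> simple_graph G -> ~~ has_induced H G ->
  betti_sum K G <= bH K H n.
Proof.
move=> mn sG nH; rewrite -ltnS in mn.
apply: leq_trans (leq_bigmax (F := fun m : 'I_n.+1 =>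
  \max_(G : graph m | simple_graph G && ~~ has_induced H G) betti_sum K G) (Ordinal mn)).
by apply: (leq_bigmax_cond (F := fun G : graph m => betti_sum K G)); rewrite sG.
Qed.

Lemma bH_gt0 n : 0 < k -> 0 < bH K H n.
Proof.
move=> k0; pose G : graph 0 := [ffun => false].
apply: leq_trans (bH_ge (G := G) (leq0n n) _ _).
- rewrite betti_sumE (_ : setT = set0) ?betti_set0 //.
  by apply/setP => -[].
- by apply/andP; split; apply/forallP => -[].
- by apply/existsP => -[f _]; case: (f (Ordinal k0)).
Qed.

End BH.

Lemma bH_sub (K : fieldType) k l (H : graph k) (H' : graph l) n :
  (forall m (G : graph m), has_induced H G -> has_induced H' G) ->
  bH K H' n <= bH K H n.
Proof.
move=> HH; apply: (bH_ind (P := fun x => x <= _)) => // m G mn sG nH'.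
by apply: bH_ge => //; apply: contra nH'; apply: HH.
Qed.

Lemma has_inducedP k (H : graph k) m (G : graph m) :
  reflect (exists f : 'I_k -> 'I_m, injective f /\
             forall x y, H (x, y) = G (f x, f y)) (has_induced H G).
Proof.
apply: (iffP existsP) => [[f /andP[/injectiveP fi /forallP E]]|[f [fi E]]].
  by exists f; split=> // x y; apply/eqP; move/forallP: (E x); apply.
exists (finfun f); apply/andP; split.
  by apply/injectiveP => x y; rewrite !ffunE; apply: fi.
by apply/forallP => x; apply/forallP => y; rewrite !ffunE E.
Qed.

Lemma edgeless_free m (G : graph m) i : simple_graph G ->
  ~~ has_induced (edgeless i) G -> clique_free (coedge G) i setT.
Proof.
move=> sG /has_inducedP nI ws sz _ pw; apply: nI.
have U : uniq ws by apply: pairwise_uniq pw => x; rewrite coedge_irr.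
case: i sz => [|i] sz.
  by exists (fun x : 'I_0 => let: Ordinal _ h := x in False_rect _ (notF h)); split; case.
have x0 : 'I_m by case: ws sz {pw U}.
exists (fun x : 'I_i.+1 => nth x0 ws x); split=> [x y /eqP|x y].
  by rewrite nth_uniq ?sz // => /eqP/val_inj.
rewrite ffunE; apply/esym/negbTE; have [xy|yx|xy] := ltngtP x y.
- have := pairwiseP x0 pw; rewrite sz => /(_ x y (ltn_ord x) (ltn_ord y) xy).
  by case/andP.
- have := pairwiseP x0 pw; rewrite sz => /(_ y x (ltn_ord y) (ltn_ord x) yx).
  by rewrite (coedge_sym sG) => /andP[].
- by rewrite (val_inj xy) (graphxx sG).
Qed.

(** The increasing enumeration of [A] turns the induced subgraph into a graph on [#|A|] vertices
    with the same orientations. *)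
Lemma betti_induced (K : fieldType) m (G : graph m) (A : {set 'I_m}) i :
  simple_graph G -> clique_free (coedge G) i A ->
  betti K G A <= bH K (edgeless i) #|A|.
Proof.
move=> sG KA; pose f : 'I_#|A| -> 'I_m := enum_val.
pose G' : graph #|A| := [ffun p => G (f p.1, f p.2)].
have fA : f @: setT = A.
  apply/setP => x; apply/imsetP/idP => [[j _ ->]|xA]; first exact: enum_valP.
  by exists (enum_rank_in xA x); rewrite // /f enum_rankK_in.
have srt : sorted ltn (map val (enum A)).
  have -> : enum A = [seq x <- enum 'I_m | x \in A] by rewrite enumT.
  apply: (subseq_sorted ltn_trans) (map_subseq _ (filter_subseq _ _)) _.
  by rewrite val_enum_ord; apply: iota_ltn_sorted.
have f_homo (x y : 'I_#|A|) : x < y -> f x < f y.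
  move=> xy; have E z : val (f z) = nth 0 (map val (enum A)) z.
    by rewrite (nth_map (f z)) -?(enum_val_nth (f z)) // -cardE.
  by rewrite !E; apply: (sorted_ltn_nth ltn_trans 0 srt) => //;
    rewrite inE size_map -cardE.
have f_mono (x y : 'I_#|A|) : (f x < f y) = (x < y).
  case: (ltngtP x y) => [/f_homo//|/f_homo yx|/val_inj->]; last by rewrite ltnn.
  by apply/negbTE; rewrite -leqNgt ltnW.
rewrite -{1}fA; apply: leq_trans (betti_relabel K f_mono (G' := G') _) _.
  by move=> x y; rewrite ffunE.
rewrite -betti_sumE; apply: bH_ge => //.
  apply/andP; split; apply/forallP => x; first by rewrite ffunE (graphxx sG).
  by apply/forallP => y; rewrite !ffunE (graphC sG).
apply/has_inducedP => -[g [gi E]].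
apply: (KA [seq f (g j) | j <- enum 'I_i]).
- by rewrite size_map size_enum_ord.
- by move=> ? /mapP[j _ ->]; apply: enum_valP.
have : uniq (enum 'I_i) by apply: enum_uniq.
elim: (enum _) => //= j s IH /andP[js us]; rewrite IH // andbT.
apply/allP => ? /mapP[j' j's ->]; rewrite /coedge.
have := E j j'; rewrite !ffunE /= => <-.
rewrite andbT (inj_eq enum_val_inj) (inj_eq gi).
by apply: contraNneq js => ->.
Qed.

(** Vertices of different factors of a join are adjacent, so a nonempty edgeless induced subgraph
    stays within one factor. *)
Lemma bH_edgeless_superadd (K : fieldType) i n1 n2 :
  bH K (edgeless i) n1 * bH K (edgeless i) n2 <= bH K (edgeless i) (n1 + n2).
Proof.
apply: (bH_ind (P := fun x => x * _ <= _)) => // m1 G1 mn1 sG1 nI1.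
apply: (bH_ind (P := fun x => _ * x <= _)) => [|m2 G2 mn2 sG2 nI2].
  by rewrite muln0.
apply: leq_trans (bH_ge (G := join_graph G1 G2) K _ _ _).
- by rewrite !betti_sumE; apply: betti_join_ge.
- exact: leq_add.
- exact: join_simple.
apply/has_inducedP => -[f [fi E]].
have {}E x y : join_graph G1 G2 (f x, f y) = false by rewrite -E ffunE.
case: i f fi E nI1 nI2 => [|i] f fi E nI1 nI2.
  case/has_inducedP: nI1.
  by exists (fun x : 'I_0 => let: Ordinal _ h := x in False_rect _ (notF h)); split; case.
have [x0|x0] := split_ordP (f ord0) => fx0.
  case/has_inducedP: nI1.
  have im x : exists y, f x == lshift m2 y.
    case: (split_ordP (f x)) => y fy; first by exists y; rewrite fy.
    by have := E ord0 x; rewrite fx0 fy join_lr.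
  exists (fun x => xchoose (im x)).
  have fE x : f x = lshift m2 (xchoose (im x)) by apply/eqP; apply: (xchooseP (im x)).
  split=> [x y xy|x y]; first by apply: fi; rewrite !fE xy.
  by rewrite ffunE -(join_ll G1 G2) -!fE E.
case/has_inducedP: nI2.
have im x : exists y, f x == rshift m1 y.
  case: (split_ordP (f x)) => y fy; last by exists y; rewrite fy.
  by have := E ord0 x; rewrite fx0 fy join_rl.
exists (fun x => xchoose (im x)).
have fE x : f x = rshift m1 (xchoose (im x)) by apply/eqP; apply: (xchooseP (im x)).
split=> [x y xy|x y]; first by apply: fi; rewrite !fE xy.
by rewrite ffunE -(join_rr G1 G2) -!fE E.
Qed.

Lemma bH_mono (K : fieldType) k (H : graph k) n1 n2 :
  n1 <= n2 -> bH K H n1 <= bH K H n2.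
Proof.
move=> n12; apply: (bH_ind (P := fun x => x <= _)) => // m G mn sG nH.
by apply: bH_ge => //; apply: leq_trans n12.
Qed.

(** * Complete multipartite subgraphs with equal parts *)

Section Blocks.
Variables (m : nat) (G : graph m).
Hypothesis sG : simple_graph G.
Variable i : nat.

(* [A] contains the complete multipartite graph with [j] parts of size [i]. *)
Fixpoint blocks j (A : {set 'I_m}) : Prop :=
  if j is j'.+1 then
    exists S : {set 'I_m}, [/\ S \subset A, #|S| = i, {in S &, forall x y, ~~ G (x, y)}
      & blocks j' [set x in A | [forall s in S, G (s, x)]]]
  else True.

Lemma blocksS j (A B : {set 'I_m}) : A \subset B -> blocks j A -> blocks j B.
Proof.
elim: j A B => [//|j IH] A B /subsetP AB [S [SA Si ind bl]].
exists S; split=> //; first by apply/subsetP => x /(subsetP SA)/AB.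
by apply: IH bl; apply/subsetP => x; rewrite !inE => /andP[/AB-> ->].
Qed.

Lemma blocks_family j (A : {set 'I_m}) : blocks j A -> exists q : nat -> {set 'I_m},
  [/\ forall l, l < j -> q l \subset A, forall l, l < j -> #|q l| = i,
      forall l, l < j -> {in q l &, forall x y, ~~ G (x, y)}
    & forall l l', l < j -> l' < j -> l != l' -> {in q l & q l', forall x y, G (x, y)}].
Proof.
elim: j A => [|j IH] A; first by exists (fun=> set0).
case=> S [SA Si ind /IH[q [qA qi qind qadj]]].
exists (fun l => if l is l'.+1 then q l' else S); split.
- case=> [//|l] /qA/subsetP qlA; apply/subsetP => x /qlA.
  by rewrite inE => /andP[].
- by case=> [//|l]; apply: qi.
- by case=> [//|l]; apply: qind.
have adjS l x y : l < j -> x \in S -> y \in q l -> G (x, y).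
  move=> /qA/subsetP qlA xS /qlA; rewrite inE => /andP[_ /forall_inP]; exact.
case=> [|l] [|l'] // lj l'j ll x y xq yq.
- exact: adjS yq.
- by rewrite (graphC sG); apply: adjS xq.
- exact: qadj xq yq.
Qed.

(** Each part of [H] is sent into one block, where its at most [i] vertices are placed by their rank
    within the part. *)
Lemma blocks_induced k (H : graph k) (p : 'I_k -> nat) j A : 0 < i ->
  (forall x y, H (x, y) = (p x != p y)) -> (forall x, p x < j) ->
  (forall x, #|[set y | p y == p x]| <= i) -> blocks j A -> has_induced H G.
Proof.
move=> i0 HE pj pi /blocks_family[q [_ qi qind qadj]]; apply/has_inducedP.
have x0 x : exists z, z \in q (p x) by apply/card_gt0P; rewrite qi.
pose rk x := index x (enum [set y | p y == p x]).
have rki x : rk x < #|q (p x)|.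
  rewrite qi //; apply: leq_trans (pi x); rewrite cardE index_mem mem_enum inE //.
pose f x := nth (xchoose (x0 x)) (enum (q (p x))) (rk x).
have fq x : f x \in q (p x) by rewrite -mem_enum mem_nth // -cardE.
have fn x d : f x = nth d (enum (q (p x))) (rk x).
  by apply: set_nth_default; rewrite -cardE.
have fE x y : H (x, y) = G (f x, f y).
  rewrite HE; have [pxy|pxy] := eqVneq (p x) (p y).
    by apply/esym/negbTE; apply: (qind (p x)); rewrite // pxy.
  by apply/esym; apply: (qadj (p x) (p y)).
exists f; split=> // x y fxy.
have pxy : p x = p y.
  by apply/eqP; apply/negPn; rewrite -HE fE fxy (graphxx sG).
have rkxy : rk x = rk y.
  apply/eqP; rewrite -(nth_uniq (f x) _ _ (enum_uniq (q (p x)))) -?cardE //;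
    last by rewrite pxy.
  by rewrite -fn pxy -fn fxy.
move: rkxy; rewrite /rk -pxy => E.
have xm : x \in enum [set z | p z == p x] by rewrite mem_enum inE.
have ym : y \in enum [set z | p z == p x] by rewrite mem_enum inE pxy.
by rewrite -(nth_index x xm) E nth_index.
Qed.

End Blocks.

Lemma edgeless_induced k (H : graph k) (p : 'I_k -> nat) x0 :
  (forall x y, H (x, y) = (p x != p y)) ->
  forall m (G : graph m), has_induced H G ->
  has_induced (edgeless #|[set y | p y == p x0]|) G.
Proof.
move=> HE m G /has_inducedP[f [fi E]]; apply/has_inducedP.
exists (fun j => f (enum_val j)); split=> [j j' /fi/enum_val_inj//|j j'].
rewrite ffunE -E HE.
by move: (enum_valP j) (enum_valP j'); rewrite !inE => /eqP-> /eqP->; rewrite eqxx.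
Qed.

Lemma pairwise_in (T : eqType) (r : rel T) s : symmetric r -> pairwise r s ->
  {in s &, forall x y, x != y -> r x y}.
Proof.
move=> rs; elim: s => //= z s IH /andP[/allP zs pw] x y; rewrite !inE.
move=> /orP[/eqP->|xs] /orP[/eqP->|ys]; rewrite ?eqxx // => xy.
- exact: zs.
- by rewrite rs; apply: zs.
- exact: IH.
Qed.

Lemma card_bigcup_le (T U : finType) (S : {set T}) (F : T -> {set U}) d :
  {in S, forall s, #|F s| <= d} -> #|\bigcup_(s in S) F s| <= #|S| * d.
Proof.
move=> Fd; rewrite -sum_nat_const.
elim/big_ind2: _ => [|A a B c' Aa Bb|s]; [by rewrite cards0| |exact: Fd].
apply: leq_trans (leq_add Aa Bb); exact: leq_card_setU.
Qed.

(** * Graphs without many equal blocks *)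

Section BlockFreeBound.
Variables (K : fieldType) (m : nat) (G : graph m) (i : nat) (c : R).
Hypotheses (sG : simple_graph G) (c1 : (1 <= c)%R).
Hypothesis bc : forall n, (INR (bH K (edgeless i) n) <= c ^ n)%R.
Let bb := betti_branching K sG.
Local Notation deg := (deg (coedge G)).

(** Branching on a vertex of [X] yields two subsets avoiding it, so each such vertex at most doubles
    the bound. *)
Lemma betti_remove (A X : {set 'I_m}) (beta : R) n : #|A :&: X| <= n ->
  (forall B : {set 'I_m}, B \subset A :\: X -> (INR (betti K G B) <= beta)%R) ->
  (INR (betti K G A) <= 2 ^ n * beta)%R.
Proof.
elim: n A => [|n IH] A An hB.
  rewrite Rmult_1_l; apply: hB.
  by rewrite subsetD subxx /= -setI_eq0 -cards_eq0 -leqn0.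
have beta0 : (0 <= beta)%R by apply: Rle_trans (hB set0 (sub0set _)); apply: pos_INR.
have [An'|An'] := leqP #|A :&: X| n.
  apply: Rle_trans (IH A An' hB) _; apply: Rmult_le_compat_r => //.
  by apply: Rle_pow; [lra|apply/leP].
have /card_gt0P[w] : 0 < #|A :&: X| by apply: leq_trans An'.
rewrite inE => /andP[wA wX].
have sub (B : {set 'I_m}) : B \subset A -> w \notin B -> (INR (betti K G B) <= 2 ^ n * beta)%R.
  move=> BA wB; apply: IH => [|B' B'X]; last first.
    by apply: hB; apply: subset_trans B'X (setSD _ BA).
  rewrite -ltnS; apply: leq_trans An; apply: proper_card; apply/properP; split.
    exact: setSI.
  by exists w; rewrite inE ?wA // (negbTE wB).
have /leP/le_INR := branching_step bb wA; rewrite plus_INR.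
have -> : (2 ^ n.+1 * beta = 2 ^ n * beta + 2 ^ n * beta)%R by rewrite /=; ring.
have := sub (A :\ w) (subD1set _ _); rewrite !inE eqxx => /(_ isT).
have := sub [set x in A | (x != w) && ~~ coedge G w x]; rewrite inE eqxx andbF.
have -> : [set x in A | (x != w) && ~~ coedge G w x] \subset A.
  by apply/subsetP => x; rewrite inE => /andP[].
move=> /(_ isT isT) h1 h2 h3; apply: Rle_trans h3 _; exact: Rplus_le_compat h2 h1.
Qed.

Lemma edgeless_free_bound (A : {set 'I_m}) :
  clique_free (coedge G) i A -> (INR (betti K G A) <= c ^ #|A|)%R.
Proof.
by move=> KA; apply: Rle_trans (bc _); apply/le_INR/leP; apply: betti_induced.
Qed.

(** Take an independent set [S] of size [i]. All but i(D + 1) vertices are joined to the whole of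
    [S], and these contain one block fewer; the others are removed at the price of a power of 2. If
    no [S] exists, the edgeless bound applies. *)
Lemma low_deg_bound D j (A : {set 'I_m}) :
  {in A, forall x, deg A x <= D} -> ~ blocks G i j A ->
  (INR (betti K G A) <= 2 ^ (j * (i * D.+1)) * c ^ #|A|)%R.
Proof.
elim: j A => [|j IH] A dA nbl; first by case: nbl.
have [/existsP[S /and3P[SA /eqP Si /forall_inP ind]]|/existsPn noS] := boolP
  [exists S : {set 'I_m}, [&& S \subset A, #|S| == i &
     [forall x in S, forall y in S, ~~ G (x, y)]]]; last first.
  apply: Rle_trans (_ : 1 * c ^ #|A| <= _)%R.
    rewrite Rmult_1_l; apply: edgeless_free_bound => ws sz wA pw.
    have [es ei] := (branching_sym bb, branching_irr bb).
    have U : uniq ws by apply: pairwise_uniq pw => x; rewrite ei.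
    have := noS [set x in ws]; apply/negP; rewrite negbK; apply/and3P; split.
    - by apply/subsetP => x; rewrite inE => /wA.
    - by rewrite cardsE (card_uniqP U) sz.
    apply/forall_inP => x; rewrite inE => xs; apply/forall_inP => y; rewrite inE => ys.
    have [->|xy] := eqVneq x y; first by rewrite (graphxx sG).
    by have := pairwise_in es pw xs ys xy => /andP[].
  apply: Rmult_le_compat_r; first by apply: pow_le; lra.
  by apply: pow_R1_Rle; lra.
set A' := [set x in A | [forall s in S, G (s, x)]].
have nbl' (B : {set 'I_m}) : B \subset A' -> ~ blocks G i j B.
  move=> BA' bl; apply: nbl; exists S; split=> //; last exact: blocksS BA' bl.
  by move=> x y xS yS; move/forall_inP: (ind x xS); apply.
have A'A : A' \subset A by apply/subsetP => x; rewrite inE => /andP[].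
have AX : A :\: (A :\: A') = A' by rewrite setDDr setDv set0U; apply/setIidPr.
have cX : #|A :&: (A :\: A')| <= i * D.+1.
  have sub : A :&: (A :\: A') \subset \bigcup_(s in S) (s |: [set x in A | coedge G s x]).
    apply/subsetP => x; rewrite !inE => /and3P[xA + _]; rewrite xA /= negb_forall.
    case/existsP=> s; rewrite negb_imply => /andP[sS sx]; apply/bigcupP; exists s => //.
    by rewrite !inE xA /= /coedge sx andbT eq_sym orbN.
  apply: leq_trans (subset_leq_card sub) _; rewrite -Si; apply: card_bigcup_le => s sS.
  have := dA s (subsetP SA s sS); rewrite /deg cardsU1 => ds.
  by rewrite -addn1 addnC leq_add // leq_b1.
have beta0 : (0 <= 2 ^ (j * (i * D.+1)) * c ^ #|A|)%R.
  by apply: Rmult_le_pos; apply: pow_le; lra.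
have := @betti_remove A (A :\: A') (2 ^ (j * (i * D.+1)) * c ^ #|A|)%R _ cX.
rewrite AX -Rmult_assoc -Rdef_pow_add plusE -mulSn; apply=> B BA'.
have BA := subset_trans BA' A'A.
have dB : {in B, forall x, deg B x <= D}.
  move=> x xB; apply: leq_trans (dA x (subsetP BA x xB)); apply: subset_leq_card.
  by apply/subsetP => y; rewrite !inE => /andP[/(subsetP BA)-> ->].
apply: Rle_trans (IH B dB (nbl' B BA')) _; apply: Rmult_le_compat_l.
  by apply: pow_le; lra.
by apply: Rle_pow => //; apply/leP/subset_leq_card.
Qed.

(** A degree above [D] gives branches that lose 1 and at least D + 2 vertices, which the condition
    on [x] pays for. Once no such vertex is left, only a constant factor is added. *)
Lemma block_free_bound D j (x : R) : (c <= x)%R -> (/ x + (/ x) ^ D.+2 <= 1)%R ->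
  forall A, ~ blocks G i j A ->
  (INR (betti K G A) <= 2 ^ (j * (i * D.+1)) * x ^ #|A|)%R.
Proof.
move=> cx xD A; have [n] := ubnP #|A|; elim: n A => // n IH A An nbl.
set C := (2 ^ _)%R in IH *.
have C0 : (0 <= C)%R by apply: pow_le; lra.
have x0 : (0 < x)%R by lra.
have [/exists_inP[w wA dw]|/exists_inPn small] :=
  boolP [exists w in A, D < deg A w]; last first.
  apply: Rle_trans (low_deg_bound (D := D) _ nbl) _ => [y yA|].
    by rewrite leqNgt small.
  by apply: Rmult_le_compat_l => //; apply: pow_incr; lra.
have B0 : (0 <= C * x ^ #|A|)%R by apply: Rmult_le_pos => //; apply: pow_le; lra.
apply: (high_deg_bound bb B0 _ wA dw xD) => B k BA k0 Bk.
apply: Rle_trans (IH B _ _) _.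
- rewrite -ltnS; apply: leq_trans An; rewrite ltnS; apply: leq_trans Bk.
  by rewrite -addn1 leq_add2l.
- by move=> bl; apply: nbl; apply: blocksS bl.
rewrite Rmult_assoc; apply: Rmult_le_compat_l => //.
have -> : (x ^ #|B| = x ^ (#|B| + k) * (/ x) ^ k)%R.
  by rewrite Rdef_pow_add pow_inv; field; apply: pow_nonzero; lra.
apply: Rmult_le_compat_r.
  by apply: pow_le; apply/Rlt_le/Rinv_0_lt_compat; lra.
by apply: Rle_pow; [lra|apply/leP].
Qed.

End BlockFreeBound.

Lemma bH_multipartite_le (K : fieldType) k (H : graph k) (p : 'I_k -> nat) i j (c x : R) :
  (1 <= c)%R -> (c < x)%R -> 0 < i ->
  (forall n, (INR (bH K (edgeless i) n) <= c ^ n)%R) ->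
  (forall y z, H (y, z) = (p y != p z)) -> (forall y, p y < j) ->
  (forall y, #|[set z | p z == p y]| <= i) ->
  exists2 C, (0 < C)%R & forall n, (INR (bH K H n) <= C * x ^ n)%R.
Proof.
move=> c1 cx i0 bc HE pj pi.
have x0 : (0 < x)%R by lra.
have ix1 : (0 < / x < 1)%R.
  by split; [apply: Rinv_0_lt_compat|rewrite -Rinv_1; apply: Rinv_lt_contravar]; lra.
(* Since x > 1, a high power of 1/x fits below 1 - 1/x. *)
have [D xD] : exists D, (/ x + (/ x) ^ D.+2 <= 1)%R.
  have abs1 : (Rabs (/ x) < 1)%R by rewrite Rabs_right; lra.
  have pos : (1 - / x > 0)%R by lra.
  have [N HN] := pow_lt_1_zero _ abs1 _ pos.
  exists N; have := HN N.+2; rewrite Rabs_right; last by apply/Rle_ge/pow_le; lra.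
  have NN : (N.+2 >= N)%coq_nat by lia.
  by move=> /(_ NN); lra.
exists (2 ^ (j * (i * D.+1)))%R; first by apply: pow_lt; lra.
move=> n; apply: (bH_ind (P := fun r => (INR r <= _)%R)) => [|m G mn sG nH].
  by apply: Rmult_le_pos; apply: pow_le; lra.
rewrite betti_sumE; apply: Rle_trans (block_free_bound (D := D) (j := j) sG c1 bc _ xD _) _.
- lra.
- by move=> bl; move/negP: nH; apply; apply: blocks_induced bl.
apply: Rmult_le_compat_l; first by apply: pow_le; lra.
by rewrite cardsT card_ord; apply: Rle_pow; [lra|apply/leP].
Qed.

(** * Lower bounds *)

Lemma edgeless_simple i : simple_graph (edgeless i).
Proof.
by apply/andP; split; apply/forallP => x; rewrite ?ffunE //;
  apply/forallP => y; rewrite !ffunE.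
Qed.

Lemma edgeless_betti (K : fieldType) r :
  absz (euler_seq (fun _ _ => false) r (iota 0 r)) <= betti_sum K (edgeless r).
Proof.
by apply: (euler_le_betti_sum K (edgeless_simple r)) => x y; rewrite ffunE.
Qed.

(** The edgeless graph on [r] vertices is too small to contain the forbidden one; for r >= 1 the
    left side is r - 1. *)
Lemma bH_edgelessS_ge (K : fieldType) r :
  absz (euler_seq (fun _ _ => false) r (iota 0 r)) <= bH K (edgeless r.+1) r.
Proof.
apply: leq_trans (edgeless_betti K r) (bH_ge K (leqnn r) (edgeless_simple r) _).
apply/has_inducedP => -[f [fi _]].
by have := leq_card f fi; rewrite !card_ord ltnn.
Qed.

(* The bipartite graph of non-incident point-line pairs of the Fano plane,
   whose lines are the translates of {0, 1, 3} modulo 7. *)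
Definition fano_rel (i j : nat) : bool :=
  [&& i < 7, 7 <= j & (i + 14 - j) %% 7 \notin [:: 0; 1; 3]].

Definition cofano_rel (i j : nat) : bool :=
  [&& i != j, ~~ fano_rel i j & ~~ fano_rel j i].

Definition cofano : graph 14 := [ffun p : 'I_14 * 'I_14 => cofano_rel p.1 p.2].

Lemma cofano_simple : simple_graph cofano.
Proof.
apply/andP; split; apply/forallP => x; first by rewrite ffunE /cofano_rel eqxx.
apply/forallP => y; apply/eqP; rewrite !ffunE /cofano_rel /= eq_sym.
by congr (_ && _); apply: andbC.
Qed.

(** The complement is bipartite, hence without triangles; here this is a finite check of all
    triples. *)
Lemma cofano_free : ~~ has_induced (edgeless 3) cofano.
Proof.
apply/has_inducedP => -[f [fi E]].
have no : all (fun i => all (fun j => all (fun l =>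
    [|| i == j, i == l, j == l, cofano_rel i j, cofano_rel i l | cofano_rel j l])
    (iota 0 14)) (iota 0 14)) (iota 0 14) by vm_compute.
have mem (x : 'I_14) : val x \in iota 0 14 by rewrite mem_iota /= add0n.
pose g j : 'I_14 := f (inord j).
have gE j l : cofano_rel (g j) (g l) = false.
  by have := E (inord j) (inord l); rewrite !ffunE.
have gi j l : j < 3 -> l < 3 -> j != l -> (val (g j) == val (g l)) = false.
  move=> j3 l3 /negbTE jl; rewrite val_eqE (inj_eq fi) -val_eqE /= !inordK //.
move/allP: no => /(_ _ (mem (g 0)))/allP/(_ _ (mem (g 1)))/allP/(_ _ (mem (g 2))).
by rewrite !gE !gi.
Qed.

Lemma bH_edgeless3_ge (K : fieldType) : 8 <= bH K (edgeless 3) 14.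
Proof.
apply: leq_trans (bH_ge K (leqnn 14) cofano_simple cofano_free).
apply: leq_trans (euler_le_betti_sum K cofano_simple (r := cofano_rel) _).
  by vm_compute.
by move=> x y; rewrite ffunE.
Qed.

Lemma multipartite5_exists (K : fieldType) q : exists G : graph (q * 5),
  [/\ simple_graph G, expn 4 q <= betti_sum K G & induced_in_K5inf G].
Proof.
elim: q => [|q [G [sG bG [f [fi fE]]]]].
  exists (edgeless 0); split; first exact: edgeless_simple.
    exact: (leq_trans _ (edgeless_betti K 0)).
  by exists (fun=> (0, ord0)); split=> [] [].
exists (join_graph (edgeless 5) G); split.
- exact: join_simple (edgeless_simple 5) sG.
- rewrite expnS betti_sumE; apply: leq_trans (betti_join_ge K (edgeless 5) G).
  by rewrite -!betti_sumE leq_mul //; apply: (leq_trans _ (edgeless_betti K 5)).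
pose g (x : 'I_(5 + q * 5)) : nat * 'I_5 :=
  match fintype.split x with inl j => (0, j) | inr y => ((f y).1.+1, (f y).2) end.
exists g; split=> [x y|]; rewrite /g.
  case: split_ordP => x' ->; case: split_ordP => y' -> //.
    by move=> [->].
  by move=> [f1 f2]; rewrite (fi x' y') //; apply: injective_projections.
suff E (x y : 'I_(5 + q * 5)) : join_graph (edgeless 5) G (x, y) = ((g x).1 != (g y).1).
  exact: E.
rewrite /g; case: split_ordP => x' ->; case: split_ordP => y' ->.
- by rewrite join_ll ffunE.
- by rewrite join_lr.
- by rewrite join_rl.
- by rewrite join_rr fE eqSS.
Qed.

Lemma bH_not_K5inf_ge (K : fieldType) k (H : graph k) n :
  ~ induced_in_K5inf H -> expn 4 (n %/ 5) <= bH K H n.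
Proof.
move=> nH; have [G [sG bG [f [fi fE]]]] := multipartite5_exists K (n %/ 5).
apply: leq_trans bG (bH_ge K (leq_trunc_div n 5) sG _).
apply/has_inducedP => -[g [gi gE]]; apply: nH; exists (f \o g).
by split=> [|x y]; [apply: inj_comp|rewrite gE fE].
Qed.

(** * Growth rates *)

Lemma Rpower_root (z : R) n : 0 < n -> (0 < z)%R -> Rpower (z ^ n) (/ INR n) = z.
Proof.
move=> n0 z0; rewrite -Rpower_pow // Rpower_mult Rinv_r ?Rpower_1 //.
by apply: not_0_INR; lia.
Qed.

Lemma root_le (a z : R) n : 0 < n -> (0 < a)%R -> (0 < z)%R -> (a <= z ^ n)%R ->
  (Rpower a (/ INR n) <= z)%R.
Proof.
move=> n0 a0 z0 az; rewrite -[X in (_ <= X)%R](Rpower_root n0 z0).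
apply: Rle_Rpower_l => //; apply/Rlt_le/Rinv_0_lt_compat/lt_0_INR; lia.
Qed.

Lemma root_ge (a z : R) n : 0 < n -> (0 < z)%R -> (z ^ n <= a)%R ->
  (z <= Rpower a (/ INR n))%R.
Proof.
move=> n0 z0 za; rewrite -[X in (X <= _)%R](Rpower_root n0 z0).
apply: Rle_Rpower_l; first by apply/Rlt_le/Rinv_0_lt_compat/lt_0_INR; lia.
by split=> //; apply: pow_lt.
Qed.

Lemma Rdiv_gt1 (x z : R) : (0 < x < z)%R -> (1 < z / x)%R.
Proof.
move=> xz; apply: (Rmult_lt_reg_r x); first lra.
by rewrite Rmult_1_l /Rdiv Rmult_assoc Rinv_l; lra.
Qed.

Lemma pow_dominates (C q : R) : (1 < q)%R -> exists N, forall n, N <= n -> (C <= q ^ n)%R.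
Proof.
move=> q1; have aq : (Rabs q > 1)%R by rewrite Rabs_right; lra.
have [N HN] := Pow_x_infinity q aq C; exists N => n Nn.
have := HN n (elimT leP Nn); rewrite Rabs_right; first lra.
by apply/Rle_ge/pow_le; lra.
Qed.

(** Constant factors vanish under the n-th root: moving the base from eps/4 to eps/2 away from [c]
    absorbs them for large n. *)
Lemma root_limit (f : nat -> R) (c : R) : (forall n, (0 < f n)%R) -> (0 < c)%R ->
  (forall x, (c < x)%R -> exists2 C, (0 < C)%R & forall n, (f n <= C * x ^ n)%R) ->
  (forall y, (0 < y < c)%R -> exists2 C, (0 < C)%R & forall n, (C * y ^ n <= f n)%R) ->
  Un_cv (fun n => Rpower (f n) (/ INR n)) c.
Proof.
move=> f0 c0 up low eps eps0.
have [N1 H1] : exists N, forall n, N <= n -> 0 < n ->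
    (Rpower (f n) (/ INR n) <= c + eps / 2)%R.
  have [|C C0 fC] := up (c + eps / 4)%R; first lra.
  have [|N HN] := @pow_dominates C ((c + eps / 2) / (c + eps / 4)).
    by apply: Rdiv_gt1; lra.
  exists N => n Nn n0; apply: root_le => //; first lra.
  apply: Rle_trans (fC n) _.
  have -> : ((c + eps / 2) ^ n = ((c + eps / 2) / (c + eps / 4)) ^ n * (c + eps / 4) ^ n)%R.
    by rewrite -Rpow_mult_distr; congr (_ ^ _)%R; field; lra.
  by apply: Rmult_le_compat_r; [apply: pow_le; lra|apply: HN].
have [N2 H2] : exists N, forall n, N <= n -> 0 < n ->
    (c - eps / 2 <= Rpower (f n) (/ INR n))%R.
  have [neg|pos] := Rle_lt_dec (c - eps / 2) 0.
    by exists 0 => n _ _; apply: Rle_trans neg _; apply/Rlt_le/exp_pos.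
  have [|C C0 fC] := low (c - eps / 4)%R; first lra.
  have [|N HN] := @pow_dominates (/ C) ((c - eps / 4) / (c - eps / 2)).
    by apply: Rdiv_gt1; lra.
  exists N => n Nn n0; apply: root_ge => //.
  apply: Rle_trans (fC n); have := HN n Nn => h.
  have -> : ((c - eps / 4) ^ n = ((c - eps / 4) / (c - eps / 2)) ^ n * (c - eps / 2) ^ n)%R.
    by rewrite -Rpow_mult_distr; congr (_ ^ _)%R; field; lra.
  rewrite -Rmult_assoc -[X in (X <= _)%R]Rmult_1_l; apply: Rmult_le_compat_r.
    by apply: pow_le; lra.
  rewrite -(Rinv_r C); last lra.
  by apply: Rmult_le_compat_l => //; lra.
(* The index 0 is skipped, as it has no root. *)
exists (maxn (maxn N1 N2) 1) => n /leP; rewrite !geq_max => /andP[/andP[n1 n2] n0].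
rewrite /R_dist; apply: Rabs_def1; have := H1 n n1 n0; have := H2 n n2 n0; lra.
Qed.

(** Fekete's argument: a good value at one [p] propagates to its multiples, and rounding n down to a
    multiple costs at most y^p when y > 1. *)
Lemma superadd_lower (g : nat -> nat) p (y : R) : (forall n, 0 < g n) ->
  (forall n1 n2, g n1 * g n2 <= g (n1 + n2)) ->
  (forall n1 n2, n1 <= n2 -> g n1 <= g n2) ->
  0 < p -> (0 < y)%R -> (y ^ p <= INR (g p))%R ->
  exists2 C, (0 < C)%R & forall n, (C * y ^ n <= INR (g n))%R.
Proof.
move=> g0 gM gmono p0 y0 yp.
have g1 n : (1 <= INR (g n))%R by apply: (le_INR 1); apply/leP.
have [y1|y1] := Rle_lt_dec y 1.
  exists 1%R; first lra; move=> n; rewrite Rmult_1_l; apply: Rle_trans (g1 n).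
  by rewrite -(pow1 n); apply: pow_incr; lra.
have gq q : Rle (pow y (p * q)) (INR (g (p * q))).
  elim: q => [|q IH]; first by rewrite muln0.
  apply: Rle_trans (_ : Rle _ (INR (g p * g (p * q)))) _; last first.
    by apply/le_INR/leP; rewrite mulnS; apply: gM.
  rewrite mult_INR mulnS -plusE Rdef_pow_add.
  by apply: Rmult_le_compat => //; apply: pow_le; lra.
exists (/ y ^ p)%R; first by apply/Rinv_0_lt_compat/pow_lt.
move=> n; apply: Rle_trans (_ : Rle _ (INR (g (p * (n %/ p))))) _; last first.
  by apply/le_INR/leP/gmono; rewrite mulnC leq_trunc_div.
apply: Rle_trans (gq _); apply: (Rmult_le_reg_l (y ^ p)); first exact: pow_lt.
rewrite -Rmult_assoc Rinv_r ?Rmult_1_l; last by apply: pow_nonzero; lra.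
rewrite -Rdef_pow_add plusE -mulnS; apply: Rle_pow; first lra.
by apply/leP; rewrite mulnC; apply: ltnW; apply: ltn_ceil.
Qed.

Lemma bH0_le (K : fieldType) k (H : graph k) : bH K H 0 <= 1.
Proof.
apply: (bH_ind (P := fun r => r <= 1)) => // -[|//] G _ sG _.
rewrite betti_sumE (_ : setT = set0); last by apply/setP => -[].
exact: branching_empty (betti_branching K sG).
Qed.

(** Says without roots that [c] is the supremum of the n-th roots; the upper bound carries no
    constant factor. *)
Definition edgeless_growth (K : fieldType) i (c : R) :=
  [/\ (1 <= c)%R, forall n, (INR (bH K (edgeless i) n) <= c ^ n)%R
    & forall y, (0 < y < c)%R ->
        exists2 p, 0 < p & (y ^ p <= INR (bH K (edgeless i) p))%R].

Lemma multipartite_limit (K : fieldType) k (H : graph k) (p : 'I_k -> nat) x0 c :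
  (forall y z, H (y, z) = (p y != p z)) ->
  (forall y, #|[set z | p z == p y]| <= #|[set z | p z == p x0]|) ->
  edgeless_growth K #|[set z | p z == p x0]| c ->
  Un_cv (fun n => Rpower (INR (bH K H n)) (/ INR n)) c.
Proof.
move=> HE pmax [c1 bc low].
have k0 : 0 < k by apply: leq_ltn_trans (ltn_ord x0).
have i0 : 0 < #|[set z | p z == p x0]| by apply/card_gt0P; exists x0; rewrite inE.
apply: root_limit; last 1 first.
- move=> y [y0 yc]; have [q q0 yq] := low y (conj y0 yc).
  have [C C0 HC] := superadd_lower (fun n => bH_gt0 K (edgeless _) n i0)
     (bH_edgeless_superadd K _) (fun n1 n2 => @bH_mono K _ (edgeless _) n1 n2) q0 y0 yq.
  exists C => // n; apply: Rle_trans (HC n) _; apply/le_INR/leP/bH_sub.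
  exact: edgeless_induced.
- by move=> n; apply: lt_0_INR; apply/ltP; apply: bH_gt0.
- lra.
move=> x cx.
have pj y : p y < (\max_z p z).+1 by rewrite ltnS; apply: leq_bigmax.
exact: (bH_multipartite_le c1 cx i0 bc HE pj pmax).
Qed.

Lemma not_K5inf_limit (K : fieldType) k (H : graph k) : ~ induced_in_K5inf H ->
  Un_cv (fun n => Rpower (INR (bH K H n)) (/ INR n)) (Rpower 4 (/ 5)).
Proof.
move=> nH; set t := Rpower 4 (/ 5).
have t5 : (t ^ 5 = 4)%R.
  rewrite -Rpower_pow ?Rpower_mult; last exact: exp_pos.
  by rewrite (_ : (/ 5 * INR 5 = 1)%R) ?Rpower_1 /=; lra.
have t1 : (1 <= t)%R.
  by rewrite -(Rpower_O 4); [apply: Rle_Rpower; lra|lra].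
have low n : (/ 4 * t ^ n <= INR (expn 4 (n %/ 5)))%R.
  have -> : INR (expn 4 (n %/ 5)) = (t ^ (5 * (n %/ 5)))%R.
    rewrite -multE pow_mult t5; elim: (n %/ 5) => [//|q IH].
    by rewrite expnS mult_INR IH /=; lra.
  suff : (t ^ n <= t ^ (5 * (n %/ 5).+1))%R.
    by rewrite mulnS -plusE Rdef_pow_add t5; lra.
  apply: Rle_pow => //; apply/leP; rewrite mulnC; apply: ltnW; exact: ltn_ceil.
have pos n : (0 < INR (bH K H n))%R.
  apply: lt_0_INR; apply/ltP; apply: leq_trans (bH_not_K5inf_ge K n nH).
  by rewrite expn_gt0.
apply: root_limit => //; first lra.
- move=> x tx; exists 1%R; first lra; move=> n; rewrite Rmult_1_l.
  apply: (bH_ind (P := fun r => (INR r <= _)%R)) => [|m G mn sG _].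
    by apply: pow_le; lra.
  rewrite betti_sumE; apply: Rle_trans (b_le_4 (betti_branching K sG) t1 t5 _) _.
  rewrite cardsT card_ord; apply: Rle_trans (_ : t ^ n <= _)%R.
    by apply: Rle_pow => //; apply/leP.
  by apply: pow_incr; lra.
- move=> y [y0 yt]; exists (/ 4)%R; first lra; move=> n.
  apply: Rle_trans (le_INR _ _ (elimT leP (bH_not_K5inf_ge K n nH))).
  apply: Rle_trans (low n); apply: Rmult_le_compat_l; first lra.
  by apply: pow_incr; lra.
Qed.

Lemma bH_edgeless_le (K : fieldType) i (c : R) n : (1 <= c)%R ->
  (forall m (G : graph m), simple_graph G -> clique_free (coedge G) i setT ->
     (INR (betti K G setT) <= c ^ m)%R) ->
  (INR (bH K (edgeless i) n) <= c ^ n)%R.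
Proof.
move=> c1 bG; apply: (bH_ind (P := fun r => (INR r <= _)%R)) => [|m G mn sG nI].
  by apply: pow_le; lra.
rewrite betti_sumE; apply: Rle_trans (bG m G sG (edgeless_free sG nI)) _.
by apply: Rle_pow => //; apply/leP.
Qed.

Lemma edgeless_growth_root (K : fieldType) i (c : R) p : 0 < p -> (1 <= c)%R ->
  (c ^ p <= INR (bH K (edgeless i) p))%R ->
  (forall m (G : graph m), simple_graph G -> clique_free (coedge G) i setT ->
     (INR (betti K G setT) <= c ^ m)%R) ->
  edgeless_growth K i c.
Proof.
move=> p0 c1 cp bG; split=> // [n|y yc]; first exact: bH_edgeless_le.
by exists p => //; apply: Rle_trans cp; apply: pow_incr; lra.
Qed.

Lemma edgeless_growth5 (K : fieldType) : edgeless_growth K 5 (Rpower 3 (/ 4)).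
Proof.
set t := Rpower _ _.
have t4 : (t ^ 4 = 3)%R.
  rewrite -Rpower_pow ?Rpower_mult; last exact: exp_pos.
  by rewrite (_ : (/ 4 * INR 4 = 1)%R) ?Rpower_1 /=; lra.
have t1 : (1 <= t)%R by rewrite -(Rpower_O 3); [apply: Rle_Rpower; lra|lra].
apply: (@edgeless_growth_root K 5 t 4) => // [|m G sG KG].
  rewrite t4; apply: Rle_trans (le_INR _ _ (elimT leP (bH_edgelessS_ge K 4))).
  by rewrite /=; lra.
by have := b_le_3 (betti_branching K sG) t1 t4 KG; rewrite cardsT card_ord.
Qed.

Lemma edgeless_growth4 (K : fieldType) : edgeless_growth K 4 (Rpower 2 (/ 3)).
Proof.
set t := Rpower _ _.
have t3 : (t ^ 3 = 2)%R.
  rewrite -Rpower_pow ?Rpower_mult; last exact: exp_pos.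
  by rewrite (_ : (/ 3 * INR 3 = 1)%R) ?Rpower_1 /=; lra.
have t1 : (1 <= t)%R by rewrite -(Rpower_O 2); [apply: Rle_Rpower; lra|lra].
apply: (@edgeless_growth_root K 4 t 3) => // [|m G sG KG].
  rewrite t3; apply: Rle_trans (le_INR _ _ (elimT leP (bH_edgelessS_ge K 3))).
  by rewrite /=; lra.
by have := b_le_2 (betti_branching K sG) t1 t3 KG; rewrite cardsT card_ord.
Qed.

(** For i = 2 the graph is complete, so any vertex is isolated in the complement and the Betti
    number is 0; for i = 1 only the empty graph remains, with value 1. *)
Lemma edgeless_growth12 (K : fieldType) i : 0 < i <= 2 -> edgeless_growth K i 1.
Proof.
case/andP=> i0 i2; apply: (@edgeless_growth_root K i 1 1) => //; first lra.
  by rewrite pow1; apply: (le_INR 1); apply/leP; apply: bH_gt0.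
move=> m G sG KG; rewrite pow1; have bb := betti_branching K sG.
case: m G sG KG bb => [|m] G sG KG bb.
  rewrite (_ : setT = set0); last by apply/setP => -[].
  by have /leP/le_INR := branching_empty bb.
have [i1|i1] := eqVneq i 1.
  by case: (KG [:: ord0]) => [||//]; rewrite ?i1 // => x _; rewrite inE.
have -> : betti K G setT = 0; last by rewrite /=; lra.
apply: (branching_isolated bb (v := ord0)) => // x _; apply/negP => ex.
have i2' : 2 = i by lia.
case: (KG [:: ord0; x]) => [|y|]; rewrite ?inE //=.
by rewrite ex.
Qed.

Lemma edgeless_growth3 (K : fieldType) : exists c,
  [/\ edgeless_growth K 3 c, (Rpower 8 (/ 14) <= c)%R
    & forall g, (1 <= g <= 2)%R -> (g ^ 8 - g ^ 3 - g ^ 2 - g - 1 = 0)%R -> (c <= g)%R].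
Proof.
pose b n := INR (bH K (edgeless 3) n).
have b1 n : (1 <= b n)%R by apply: (le_INR 1); apply/leP; apply: bH_gt0.
have bE n : 0 < n -> (Rpower (b n) (/ INR n) ^ n = b n)%R.
  move=> n0; have := b1 n => bn.
  rewrite -Rpower_pow; last exact: exp_pos.
  by rewrite Rpower_mult Rinv_l ?Rpower_1; [|lra|apply: not_0_INR; lia].
pose E x := exists2 n, 0 < n & x = Rpower (b n) (/ INR n).
have Ele t : (1 <= t)%R -> (forall n, (b n <= t ^ n)%R) -> is_upper_bound E t.
  by move=> t1 bt x [n n0 ->]; apply: root_le => //; have := b1 n; lra.
have [c [cub club]] : {c | is_lub E c}.
  apply: completeness; last by exists (Rpower (b 1) (/ INR 1)), 1.
  (* The general bound makes the set bounded without first producing a root of the degree 8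
     equation, which enters only through a given [g]. *)
  exists (Rpower 4 (/ 5)); set t := Rpower 4 (/ 5).
  have t5 : (t ^ 5 = 4)%R.
    rewrite -Rpower_pow ?Rpower_mult; last exact: exp_pos.
    by rewrite (_ : (/ 5 * INR 5 = 1)%R) ?Rpower_1 /=; lra.
  have t1 : (1 <= t)%R by rewrite -(Rpower_O 4); [apply: Rle_Rpower; lra|lra].
  apply: Ele => // n; apply: bH_edgeless_le => // m G sG _.
  by have := b_le_4 (betti_branching K sG) t1 t5 setT; rewrite cardsT card_ord.
have cn n : 0 < n -> (Rpower (b n) (/ INR n) <= c)%R.
  by move=> n0; apply: cub; exists n.
have c1 : (1 <= c)%R.
  apply: Rle_trans (cn 1 isT); rewrite /= Rinv_1 Rpower_1 //.
  by have := b1 1; lra.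
exists c; split.
- split=> // [n|y [y0 yc]].
    (* n = 0 has no root and is read off [bH0_le]. *)
    case: n => [|n]; first by apply: (le_INR _ 1); apply/leP; apply: bH0_le.
    rewrite -/(b n.+1) -(bE n.+1) //.
    by apply: pow_incr; split; [exact/Rlt_le/exp_pos|exact: cn].
  apply: NNPP => none; suff : (c <= y)%R by lra.
  apply: club => _ [n n0 ->]; apply: Rnot_lt_le => yn; apply: none; exists n => //.
  by rewrite -/(b n) -(bE n n0); apply: pow_incr; lra.
- apply: Rle_trans (cn 14 isT).
  rewrite [INR 14]INR_IZR_INZ; apply: Rle_Rpower_l; first by rewrite /=; lra.
  have /leP/le_INR := bH_edgeless3_ge K; rewrite -/(b 14) [INR 8]INR_IZR_INZ /=; lra.
move=> g g12 gr; apply: club; apply: Ele; first lra.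
move=> n; apply: bH_edgeless_le; first lra.
move=> m G sG KG.
by have := b_le_root (betti_branching K sG) g12 gr KG; rewrite cardsT card_ord.
Qed.

Lemma geq_sorted_head (s : seq nat) j : sorted geq s -> nth 0 s j <= head 0 s.
Proof.
case: s => [|a s] /=; first by rewrite nth_nil.
rewrite (path_sortedE (rev_trans leq_trans)) => /andP[/allP le _].
case: j => [//|j] /=; have [js|js] := ltnP j (size s); last by rewrite nth_default.
exact/le/mem_nth.
Qed.

Open Scope R_scope.

Theorem theorem1p2 (K : fieldType) :
  exists c' : nat -> R,
    c' 5%nat = Rpower 3 (/ 4) /\
    c' 4%nat = Rpower 2 (/ 3) /\
    Rpower 8 (/ 14) <= c' 3%nat /\
    (forall g : R, 1 <= g <= 2 -> g ^ 8 - g ^ 3 - g ^ 2 - g - 1 = 0 ->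
       c' 3%nat <= g) /\
    c' 2%nat = 1 /\ c' 1%nat = 1 /\
    forall (k : nat) (H : graph k), simple_graph H ->
      exists c : R,
        Un_cv (fun n => Rpower (INR (bH K H n)) (/ INR n)) c /\
        (~ induced_in_K5inf H -> c = Rpower 4 (/ 5)) /\
        (forall s : seq nat,
           s <> [::] -> sorted geq s -> all (fun i : nat => leq 1 i) s ->
           leq (head 0%nat s) 5 ->
           complete_multipartite H s -> c = c' (head 0%nat s)).
Proof.
have [c3 [gr3 c3lo c3hi]] := edgeless_growth3 K.
pose c' (i : nat) : R := match i with
  | 5%nat => Rpower 3 (/ 4) | 4%nat => Rpower 2 (/ 3) | 3%nat => c3 | _ => 1 end.
have gr i : leq 1 i -> leq i 5 -> edgeless_growth K i (c' i).
  case: i => [|[|[|[|[|[|//]]]]]] // _ _.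
  - exact: edgeless_growth12.
  - exact: edgeless_growth12.
  - exact: edgeless_growth4.
  - exact: edgeless_growth5.
exists c'; do 6!split=> //; move=> k H sH.
pose cv c := Un_cv (fun n => Rpower (INR (bH K H n)) (/ INR n)) c.
have multi s : s <> [::] -> sorted geq s -> all (fun i : nat => leq 1 i) s ->
    leq (head 0%nat s) 5 -> complete_multipartite H s -> cv (c' (head 0%nat s)).
  case: s => [//|a s] _ srt /= /andP[a1 _] a5 [p [psz HE]].
  have p0 : #|[set x | p x == ord0]| = a by rewrite psz.
  have [x0 x0p] : exists x, x \in [set x | p x == ord0] by apply/card_gt0P; rewrite p0.
  rewrite inE in x0p; move: x0p => /eqP x0p.
  have part y : [set z | val (p z) == val (p y)] = [set z | p z == p y].
    by apply/setP => z; rewrite !inE.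
  apply: (@multipartite_limit K k H (fun x => val (p x)) x0).
  - by move=> y z; rewrite HE.
  - by move=> y; rewrite !part x0p p0 psz; apply: (geq_sorted_head _ srt).
  - by rewrite part x0p p0; apply: gr.
have uniq_cv c d : cv c -> cv d -> c = d by apply: UL_sequence.
have [nK|K5] := classic (~ induced_in_K5inf H).
  have lim := not_K5inf_limit K nK.
  exists (Rpower 4 (/ 5)); do !split=> //.
  by move=> s s0 srt s1 s5 HE; apply: uniq_cv lim (multi s s0 srt s1 s5 HE).
(* The graph without vertices embeds everywhere, so b_H is constantly 0; since [ln 0] evaluates to
   0, the formal roots are all 1. *)
have [k0|k0] := posnP k.
  have no (x : 'I_k) : False by move: (ltn_ord x); rewrite {2}k0.
  have b0 n : bH K H n = 0%nat.
    apply: (bH_ind (P := fun r => r = 0%nat)) => // m G _ _ nH.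
    by case/has_inducedP: nH; exists (fun x => False_rect _ (no x)); split=> x; case: (no x).
  exists 1; split.
    move=> eps eps0; exists 0%nat => n _; rewrite b0 /Rpower /ln.
    case: Rlt_dec => [h|_]; first by case: (Rlt_irrefl _ h).
    by rewrite Rmult_0_r exp_0 /R_dist Rminus_diag Rabs_R0.
  split=> // s s0 srt s1 s5 HE; exfalso.
  case: s s0 s1 HE {srt s5} => [//|a s] _ /= /andP[a1 _] [p [psz _]].
  have := psz ord0; rewrite /= => E; move: a1; rewrite -E => /card_gt0P[x].
  by case: (no x).
have {}K5 : induced_in_K5inf H by apply: NNPP.
have [f [fi fE]] := K5.
(* The first coordinate names the part; the second separates the vertices of a part, so parts have
   at most 5 vertices. A largest one, at [x0], decides the limit. *)
pose p x := (f x).1; pose sz x := #|[set y | p y == p x]|.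
pose x0 := [arg max_(x > Ordinal k0) sz x].
have x0max y : leq (sz y) (sz x0).
  by rewrite /x0; case: arg_maxnP => // z _; apply.
have sz1 : leq 1 (sz x0) by apply/card_gt0P; exists x0; rewrite inE.
have sz5 : leq (sz x0) 5.
  have := max_card (mem ((fun y => (f y).2) @: [set y | p y == p x0])).
  rewrite card_ord card_in_imset // => y z; rewrite !inE => /eqP py /eqP pz yz.
  by apply/fi/injective_projections; rewrite // -/(p y) py.
have lim : cv (c' (sz x0)).
  by apply: (@multipartite_limit K k H p x0) => //; apply: gr.
exists (c' (sz x0)); split=> //; split=> // s s0 srt s1 s5 HE.
exact: uniq_cv lim (multi s s0 srt s1 s5 HE).
Qed.
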